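(* Every pentagraph is three-colourable, i.e. for every pentagraph $G$ there is a map $\phi:V(G)\to\{1,2,3\}$ with $\phi(u)\neq\phi(v)$ for every edge $uv$ of $G$.
   Context: All graphs are finite, with no loops or parallel edges. A graph $G$ is a pentagraph if every cycle of $G$ has length at least five, and every induced cycle of $G$ of odd length has length exactly five. *)

(* Defs.v *)
From mathcomp Require Import all_boot.

Set Implicit Arguments.
Unset Strict Implicit.
Unset Printing Implicit Defensive.

(* A finite simple graph is a finType of vertices with a symmetric, irreflexive
   adjacency relation. A graph cycle is given by the sequence of its vertices in
   cyclic order, so its length is the size of that sequence. *)

(* The size condition is needed because ucycle accepts [::] and also [:: x; y]
   for an edge xy. *)
Definition graph_cycle (T : finType) (e : rel T) (c : seq T) : Prop :=
  2 < size c /\ ucycle e c.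

Definition induced_cycle (T : finType) (e : rel T) (c : seq T) : Prop :=
  graph_cycle e c /\
  {in c &, forall x y, e x y -> y = next c x \/ x = next c y}.

Definition pentagraph (T : finType) (e : rel T) : Prop :=
  (forall c : seq T, graph_cycle e c -> 5 <= size c) /\
  (forall c : seq T, induced_cycle e c -> odd (size c) -> size c = 5).

Definition proper_colouring (T : finType) (C : eqType) (e : rel T)
    (phi : T -> C) : Prop :=
  forall u v : T, e u v -> phi u != phi v.

Definition colourable (k : nat) (T : finType) (e : rel T) : Prop :=
  exists phi : T -> 'I_k, proper_colouring e phi.

(* Main.v *)
(* Consider a vertex-minimal pentagraph G that is not 3-colourable. Kempe chains
   show that G has minimum degree 3 and no cutset inside an induced three-vertex
   path. If G has no pentagon, it is bipartite. If every vertex is in or next to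
   a pentagon abcdf, then N(b) and the neighbourhoods of the edges cd and fa
   give three colour classes. Otherwise let D be a component of the complement
   of the closed neighbourhood of a pentagon C. Two vertices attached to D whose
   neighbours in C are at distance two must be adjacent, for otherwise C and a
   path through D contain an odd hole; this leaves three patterns for the
   attachments of D to C. In each of them D contains a cut: a connected set K
   that is a component, but not the only one, of G - N[a] - N[b] for some edge
   ab. For a smallest cut the same analysis, applied on the
   other side of a pentagon inside K, would give a smaller one, so K is
   bipartite. It moreover excludes all paths of length two through K from N(a)
   to N(b), all paths of length three through K between two vertices of N(a),
   and vertices of N(a) with neighbours in both classes of K. Hence the vertices
   of K next to N(a) lie in one class and those next to N(b) in the other, and
   a colouring of G - K extends to K by the colours of a and b. *)

Require Import Defs.
From mathcomp Require Import all_boot perm zify.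

Set Implicit Arguments.
Unset Strict Implicit.
Unset Printing Implicit Defensive.

(** Two tools recur. Girth five gives any two vertices at most one common neighbour and turns every
    closed walk of length seven without immediate reversals into an odd hole. And a path through a
    connected set can be closed along two routes of opposite parity; one of the two holes is odd, so
    it has length five, and the path is very short or does not exist. Cuts are taken around an edge
    [ab] because this makes a colouring easy to extend: a vertex of [K] whose outside neighbours all
    lie in N(a) may take the colour of [a], whatever colours these neighbours have. Minimality must
    range over the cuts of all edges, since each construction of a smaller cut changes the edge. The
    obstacle is the attachment pattern on three consecutive vertices of the pentagon. Its
    attachments next to the middle vertex [a] need not be close to the edge [pr] that should carry
    the new cut. The ban on cutsets inside three-vertex paths tames them: they see nothing of [D]
    away from [pr], and they add at most one vertex to the new cut, which loses at least two
    elsewhere. *)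

Section ThreeColours.

Implicit Types x y z w : 'I_3.

Lemma third_colour x y : exists z, (z != x) && (z != y).
Proof.
case: (pickP (fun z => (z != x) && (z != y))) => [z Pz|H]; first by exists z.
suff: #|'I_3| <= #|[set x; y]| by rewrite card_ord cards2; case: (x != y).
apply: subset_leq_card; apply/subsetP => z _; rewrite !inE.
by move: (H z); case: (z == x) => //= /negbFE.
Qed.

Lemma third_colour_uniq x y z w :
  x != y -> z != x -> z != y -> w != x -> w != y -> z = w.
Proof.
move=> xy zx zy wx wy; apply/eqP/negPn/negP => zw.
have uq : uniq [:: x; y; z; w].
  by rewrite /= !inE !negb_or xy zw ![x == _]eq_sym ![y == _]eq_sym zx wx zy wy.
by have := max_card (mem [:: x; y; z; w]); rewrite (card_uniqP uq) card_ord.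
Qed.

(** Renames the colours of one side so that two colourings agree on an edge before they are
    glued. *)
Lemma colour_perm x y x' y' : x != y -> x' != y' ->
  exists s : {perm 'I_3}, s x = x' /\ s y = y'.
Proof.
move=> xy xy'; pose t := tperm x x'; exists (t * tperm (t y) y')%g.
have tx : t x = x' by rewrite /t tpermL.
rewrite !permM tx tpermL; split=> //.
by rewrite tpermD // 1?eq_sym // -tx (inj_eq perm_inj).
Qed.

End ThreeColours.

(** * Induced paths and short cycles *)

Section Pentagraph.

Variables (T : finType) (e : rel T).
Hypotheses (e_sym : symmetric e) (e_irr : irreflexive e).
Hypothesis e_penta : pentagraph e.

(** Induced paths: among the later vertices, each vertex is adjacent to its immediate successor
    only; symmetry of [e] takes care of the earlier ones. When [s'] is empty the default of [head]
    is never compared. *)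
Fixpoint ipath (s : seq T) : bool :=
  if s is x :: s' then
    [&& x \notin s', all (fun z => e x z == (z == head x s')) s' & ipath s']
  else true.

Lemma ipath_cons x y s :
  ipath (y :: s) -> x != y -> x \notin s -> e x y ->
  (forall z, z \in s -> ~~ e x z) -> ipath [:: x, y & s].
Proof.
move=> ips xy xs exy xz; rewrite /= in ips *; case/and3P: (ips) => ys al ip.
rewrite inE negb_or xy xs eqxx exy al ip ys /= !andbT.
apply/allP=> z zs; rewrite (negbTE (xz z zs)) eq_sym eqbF_neg.
by apply: contraNneq ys => <-.
Qed.

Lemma ipath_path x s : ipath (x :: s) -> path e x s.
Proof.
elim: s x => [//|y s IH] x /= /and3P[_ /andP[/eqP]]; rewrite eqxx => -> _ ip.
exact: IH.
Qed.

Lemma ipath_uniq s : ipath s -> uniq s.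
Proof. by elim: s => [//|x s IH] /= /and3P[-> _ /IH]. Qed.

Lemma ipath_catr s1 s2 : ipath (s1 ++ s2) -> ipath s2.
Proof. by elim: s1 => [//|x s IH] /= /and3P[_ _ /IH]. Qed.

Lemma ipath_catl s1 s2 : ipath (s1 ++ s2) -> ipath s1.
Proof.
elim: s1 => [//|x s IH] /= /and3P[]; rewrite mem_cat negb_or all_cat.
move=> /andP[-> _] /andP[al _] /IH->; rewrite andbT /=.
by case: s al {IH} => [//|y s] al; rewrite /= in al *.
Qed.

Lemma ipath_cat s1 s2 :
  ipath s1 -> ipath s2 ->
  (forall u v, u \in s1 -> v \in s2 ->
     u != v /\ e u v = (u == last u s1) && (v == head v s2)) ->
  ipath (s1 ++ s2).
Proof.
elim: s1 => [//|x s IH] ip1 ip2 H; rewrite cat_cons.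
have ips : ipath (s ++ s2).
  apply: IH => //; first by case/and3P: ip1.
  move=> u v us vs; have [||-> ->] := H u v; rewrite ?inE ?us ?orbT //.
  split=> //; congr (_ && _); congr (_ == _).
  by case: (s) us.
case/and3P: (ip1) => xs al _.
rewrite /= ips andbT mem_cat negb_or xs all_cat /=; apply/andP; split.
  by apply/negP=> xs2; case: (H x x (mem_head _ _) xs2); rewrite eqxx.
case: s xs al H {IH ip1 ips} => [|y s] xs al H.
  apply/allP=> v vs2; have [_ ->] := H x v (mem_head _ _) vs2.
  by rewrite /= eqxx; case: (s2) vs2.
rewrite al /=; apply/allP=> v vs2.
have [_ ->] := H x v (mem_head _ _) vs2.
have [|/negbTE yv _] := H y v _ vs2; first by rewrite !inE eqxx orbT.
have /negbTE-> : x != last x [:: x, y & s].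
  by apply: contraNneq xs => ->; exact: (mem_last y s).
by rewrite [head _ _]/= [v == y]eq_sym yv.
Qed.

Lemma ipath_rev s : ipath s -> ipath (rev s).
Proof.
elim: s => [//|x s IH] ip; rewrite rev_cons -cats1.
case/and3P: (ip) => xs al ips.
apply: ipath_cat => //; first exact: IH.
move=> u v; rewrite mem_rev inE => us /eqP->{v}.
split; first by apply: contraNneq xs => <-.
rewrite /= eqxx andbT e_sym (eqP (allP al u us)).
case: s us {al ips ip IH xs} => // y s us.
by rewrite rev_cons last_rcons.
Qed.

Lemma ipath_adj s u v :
  ipath s -> u \in s -> v \in s -> e u v ->
  exists s1 s2, s = s1 ++ [:: u, v & s2] \/ s = s1 ++ [:: v, u & s2].
Proof.
elim: s => [//|x s IH] /= /and3P[xs al ips].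
have hd w : w \in s -> e x w -> exists s', s = w :: s'.
  move=> ws exw; move: (allP al w ws); rewrite exw eq_sym => /eqP/eqP->.
  by case: (s) ws => // y s' _; exists s'.
rewrite !inE => /predU1P[->|us] /predU1P[->|vs] euv.
- by rewrite e_irr in euv.
- by have [s' ->] := hd v vs euv; exists [::], s'; left.
- rewrite e_sym in euv; have [s' ->] := hd u us euv.
  by exists [::], s'; right.
have [s1 [s2 [->|->]]] := IH ips us vs euv.
  by exists (x :: s1), s2; left.
by exists (x :: s1), s2; right.
Qed.

Lemma next_cat (s1 s2 : seq T) u v :
  uniq (s1 ++ [:: u, v & s2]) -> next (s1 ++ [:: u, v & s2]) u = v.
Proof.
move=> us; rewrite -(next_rot (size s1)) // rot_size_cat /=.
by rewrite eqxx.
Qed.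

Lemma next_last (x : T) s u : uniq (x :: rcons s u) -> next (x :: rcons s u) u = x.
Proof.
move=> us; rewrite -(next_rot (size (x :: s))) // -rcons_cons -cats1.
by rewrite rot_size_cat /= eqxx.
Qed.

Lemma induced_cycle_cons x s :
  ipath s -> 1 < size s -> x \notin s ->
  (forall z, z \in s -> e x z = (z == head x s) || (z == last x s)) ->
  induced_cycle e (x :: s).
Proof.
move=> ip; case/lastP: s ip => // s y ip sz xs H.
case: s ip sz xs H => // h s ip sz xs H.
have uq : uniq (x :: rcons (h :: s) y).
  by rewrite cons_uniq xs ipath_uniq.
have exh : e x h by rewrite H ?eqxx // mem_head.
have exy : e x y.
  by rewrite H ?last_rcons ?eqxx ?orbT // mem_rcons mem_head.
split; first split.
- by rewrite /= ltnS size_rcons.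
- rewrite /ucycle uq andbT /= exh /= rcons_path last_rcons e_sym exy andbT.
  exact: (ipath_path ip).
have hx v : v \in rcons (h :: s) y -> e x v ->
    v = next (x :: rcons (h :: s) y) x \/ x = next (x :: rcons (h :: s) y) v.
  move=> vs; rewrite H // last_rcons => /orP[/eqP->|/eqP->].
    by left; rewrite /= eqxx.
  by right; rewrite next_last.
move=> u v; rewrite [in u \in _]inE [in v \in _]inE.
move=> /predU1P[->|us] /predU1P[->|vs] euv.
- by rewrite e_irr in euv.
- exact: hx.
- by rewrite e_sym in euv; have [->|E] := hx u us euv; [right|left].
have [s1 [s2 [E|E]]] := ipath_adj ip us vs euv.
  by left; move: uq; rewrite E => uq; rewrite (next_cat (s1 := x :: s1) uq).
by right; move: uq; rewrite E => uq; rewrite (next_cat (s1 := x :: s1) uq).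
Qed.

Lemma adj_neq x y : e x y -> x != y.
Proof. by apply: contraTneq => ->; rewrite e_irr. Qed.

Lemma no_triangle x y z : e x y -> e y z -> e x z -> False.
Proof.
move=> xy yz xz; have [girth _] := e_penta.
suff: 5 <= size [:: x; y; z] by [].
apply: girth; split=> //; apply/andP; split=> /=.
  by rewrite xy yz e_sym xz.
by rewrite !inE negb_or !adj_neq.
Qed.

Lemma no_triangle' x y z : e x y -> e y z -> ~~ e x z.
Proof. by move=> xy yz; apply/negP => /(no_triangle xy yz). Qed.

Lemma no_square x y z w :
  e x y -> e y z -> e z w -> e w x -> x != z -> y = w.
Proof.
move=> xy yz zw wx xz; apply/eqP/negPn/negP=> yw; have [girth _] := e_penta.
suff: 5 <= size [:: x; y; z; w] by [].
apply: girth; split=> //; apply/andP; split=> /=.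
  by rewrite xy yz zw wx.
by rewrite !inE !negb_or xz yw !adj_neq // e_sym.
Qed.

Lemma common_nbr x z y w :
  x != z -> e x y -> e z y -> e x w -> e z w -> y = w.
Proof.
move=> xz xy zy xw zw; apply: (@no_square x y z w) => //; rewrite e_sym //.
Qed.

Lemma hole_size x s :
  ipath s -> 1 < size s -> x \notin s ->
  (forall z, z \in s -> e x z = (z == head x s) || (z == last x s)) ->
  ~~ odd (size s) -> size s = 4.
Proof.
move=> ip sz xs H od; have [_ /(_ (x :: s))] := e_penta.
move=> /(_ (induced_cycle_cons ip sz xs H)) /= /(_ od).
by case.
Qed.


Lemma no_square' x y z w :
  e x y -> e y z -> e z w -> x != z -> y != w -> ~~ e x w.
Proof.
move=> xy yz zw xz /eqP yw; apply/negP; rewrite e_sym => wx.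
exact: yw (no_square xy yz zw wx xz).
Qed.

Lemma ipath2 x1 x2 : e x1 x2 -> ipath [:: x1; x2].
Proof. by move=> e12; rewrite /= !inE e12 !eqxx adj_neq. Qed.

Lemma ipath3 x1 x2 x3 : e x1 x2 -> e x2 x3 -> x1 != x3 ->
  ipath [:: x1; x2; x3].
Proof.
move=> e12 e23 n13; apply: ipath_cons; rewrite ?inE ?n13 ?adj_neq ?ipath2 //.
by move=> z; rewrite inE => /eqP->; apply/negP; apply: no_triangle e12 e23.
Qed.

Lemma ipath4 x1 x2 x3 x4 : e x1 x2 -> e x2 x3 -> e x3 x4 ->
  x1 != x3 -> x2 != x4 -> ipath [:: x1; x2; x3; x4].
Proof.
move=> e12 e23 e34 n13 n24.
have ne14 := no_square' e12 e23 e34 n13 n24.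
apply: ipath_cons; rewrite ?adj_neq ?ipath3 // ?inE ?negb_or ?n13 /=.
  by apply: contraNneq n13 => E; case: (no_triangle e23 e34); rewrite -E e_sym.
move=> z; rewrite !inE => /orP[]/eqP-> //.
by rewrite (no_triangle' e12 e23).
Qed.

Lemma ipath5 x1 x2 x3 x4 x5 : e x1 x2 -> e x2 x3 -> e x3 x4 -> e x4 x5 ->
  x1 != x3 -> x2 != x4 -> x3 != x5 -> ~~ e x1 x5 ->
  ipath [:: x1; x2; x3; x4; x5].
Proof.
move=> e12 e23 e34 e45 n13 n24 n35 ne15.
have ne14 := no_square' e12 e23 e34 n13 n24.
have n14 : x1 != x4.
  by apply: contraNneq n13 => E; case: (no_triangle e23 e34); rewrite -E e_sym.
have n15 : x1 != x5 by apply: contraNneq ne14 => ->; rewrite e_sym.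
apply: ipath_cons; rewrite ?adj_neq ?ipath4 // ?inE ?negb_or ?n13 ?n14 //.
move=> z; rewrite !inE => /or3P[]/eqP-> //.
by rewrite (no_triangle' e12 e23).
Qed.

Lemma ipath6 x1 x2 x3 x4 x5 x6 :
  e x1 x2 -> e x2 x3 -> e x3 x4 -> e x4 x5 -> e x5 x6 ->
  x1 != x3 -> x2 != x4 -> x3 != x5 -> x4 != x6 ->
  ~~ e x1 x5 -> ~~ e x2 x6 -> ~~ e x1 x6 ->
  ipath [:: x1; x2; x3; x4; x5; x6].
Proof.
move=> e12 e23 e34 e45 e56 n13 n24 n35 n46 ne15 ne26 ne16.
have ne14 := no_square' e12 e23 e34 n13 n24.
have n14 : x1 != x4.
  by apply: contraNneq n13 => E; case: (no_triangle e23 e34); rewrite -E e_sym.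
have n15 : x1 != x5 by apply: contraNneq ne14 => ->; rewrite e_sym.
have n16 : x1 != x6 by apply: contraNneq ne15 => ->; rewrite e_sym.
apply: ipath_cons; rewrite ?adj_neq ?ipath5 // ?inE ?negb_or ?n13 ?n14 ?n15 //.
move=> z; rewrite !inE => /or4P[]/eqP-> //.
by rewrite (no_triangle' e12 e23).
Qed.

(** Excluding immediate reversals is enough: an equality between vertices three steps apart, or an
    edge between vertices two steps apart, gives a triangle, and an edge between vertices three
    steps apart gives a square. So the walk is a hole of length seven. *)
Lemma no_heptagon x1 x2 x3 x4 x5 x6 x7 :
  e x1 x2 -> e x2 x3 -> e x3 x4 -> e x4 x5 -> e x5 x6 -> e x6 x7 -> e x7 x1 ->
  x1 != x3 -> x2 != x4 -> x3 != x5 -> x4 != x6 -> x5 != x7 -> x6 != x1 ->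
  x7 != x2 -> False.
Proof.
move=> e12 e23 e34 e45 e56 e67 e71 n13 n24 n35 n46 n57 n61 n72.
have tri x y z w : e x y -> e y z -> e z w -> x != w.
  move=> xy yz zw; apply: contraTneq zw => <-.
  by rewrite e_sym; apply: no_triangle' xy yz.
have n14 := tri _ _ _ _ e12 e23 e34; have n25 := tri _ _ _ _ e23 e34 e45.
have n36 := tri _ _ _ _ e34 e45 e56; have n47 := tri _ _ _ _ e45 e56 e67.
have n51 := tri _ _ _ _ e56 e67 e71; have n62 := tri _ _ _ _ e67 e71 e12.
have n12 := adj_neq e12; have n23 := adj_neq e23; have n34 := adj_neq e34.
have n45 := adj_neq e45; have n56 := adj_neq e56; have n67 := adj_neq e67.
have n17 : x1 != x7 by rewrite eq_sym adj_neq.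
have n37 : x3 != x7 by rewrite eq_sym (tri _ _ _ _ e71 e12 e23).
rewrite eq_sym in n51; rewrite eq_sym in n61; rewrite eq_sym in n62.
rewrite eq_sym in n72.
have n15 := n51; have n16 := n61; have n26 := n62; have n27 := n72.
have e21 : e x2 x1 by rewrite e_sym.
have e17 : e x1 x7 by rewrite e_sym.
have e76 : e x7 x6 by rewrite e_sym.
have e65 : e x6 x5 by rewrite e_sym.
have ip : ipath [:: x2; x3; x4; x5; x6; x7].
  apply: ipath6 => //.
  - by apply: (no_square' e21 e17 e76); rewrite // eq_sym.
  - by rewrite e_sym; apply: (no_square' e71 e12 e23); rewrite // eq_sym.
  - exact: no_triangle' e21 e17.
suff : size [:: x2; x3; x4; x5; x6; x7] = 4 by [].
apply: (hole_size ip (x := x1)) => //.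
  by rewrite !inE !negb_or n12 n13 n14 n15 n16 n17.
move=> z; rewrite !inE [head _ _]/= [last _ _]/=.
move=> /or4P[/eqP->|/eqP->|/eqP->|/or3P[]/eqP->].
- by rewrite eqxx e12.
- rewrite [x3 == x2]eq_sym (negbTE n23) (negbTE n37).
  by rewrite (negbTE (no_triangle' e12 e23)).
- rewrite [x4 == x2]eq_sym (negbTE n24) (negbTE n47).
  by apply/negbTE; apply: (no_square' e12 e23 e34).
- rewrite [x5 == x2]eq_sym (negbTE n25) (negbTE n57).
  by apply/negbTE; apply: (no_square' e17 e76 e65); rewrite // eq_sym.
- rewrite [x6 == x2]eq_sym (negbTE n26) (negbTE n67).
  by rewrite (negbTE (no_triangle' e17 e76)).
- by rewrite eqxx orbT e17.
Qed.

(* The two paths bound an induced cycle of length [size s + size t + 2]. *)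
Lemma theta p q s t :
  ipath (p :: rcons s q) -> ipath (p :: rcons t q) ->
  0 < size s -> 0 < size t ->
  (forall u v, u \in s -> v \in t -> (u != v) && ~~ e u v) ->
  odd (size s + size t) -> size s + size t = 3.
Proof.
move=> ps pt s0 t0 st od.
have ipr : ipath (rev (rcons t q)).
  by apply: ipath_rev => //; case/and3P: pt.
have ips : ipath (rcons s q) by case/and3P: ps.
(* The cycle is opened at [p]: [hole_size] wants one vertex and the induced path formed by the
   others. *)
have ipc : ipath (s ++ (q :: rev t)).
  apply: ipath_cat; first by move: ips; rewrite -cats1 => /ipath_catl.
    by rewrite -rev_rcons.
  move=> u v us; rewrite inE => /predU1P[->|].
    rewrite /= eqxx andbT; split.
      have := ipath_uniq ips; rewrite rcons_uniq => /andP[qs _].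
      by apply: contraNneq qs => <-.
    have := ips => /ipath_rev; rewrite rev_rcons => /and3P[_ /allP al _].
    rewrite e_sym (eqP (al u _)) ?mem_rev //.
    by case/lastP: (s) us => // s' y _; rewrite rev_rcons last_rcons.
  rewrite mem_rev => vt; have /andP[-> /negbTE->] := st u v us vt.
  split=> //; symmetry; apply/negP=> /andP[_ /= /eqP E].
  have := ipath_uniq ipr; rewrite rev_rcons /= mem_rev -E vt //.
have := @hole_size p (s ++ (q :: rev t)) ipc.
rewrite size_cat /= size_rev addnS => H.
suff : (size s + size t).+1 = 4 by lia.
apply: H; rewrite ?negbK //=; first by lia.
- case/andP: ps; rewrite mem_rcons inE negb_or => /andP[pq pns] _.
  case/andP: pt; rewrite mem_rcons inE negb_or => /andP[_ pnt] _.
  by rewrite mem_cat inE mem_rev !negb_or pns pq.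
case/and3P: ps => _ /allP als _; case/and3P: pt => _ /allP alt _.
have hs : head p (s ++ q :: rev t) = head p (rcons s q).
  by case: (s) s0.
have lt : last p (s ++ q :: rev t) = head p (rcons t q).
  by rewrite last_cat /=; case: (t) t0 => // y t' _; rewrite rev_cons last_rcons.
move=> z; rewrite mem_cat inE mem_rev hs lt.
have zst w : w \in s -> w != head p (rcons t q).
  move=> ws; apply/eqP=> E.
  have : head p (rcons t q) \in t by case: (t) t0 => // y t' _; rewrite /= inE eqxx.
  by rewrite -E => wt; have := st w w ws wt; rewrite eqxx.
have zts w : w \in t -> w != head p (rcons s q).
  move=> wt; apply/eqP=> E.
  have : head p (rcons s q) \in s by case: (s) s0 => // y s' _; rewrite /= inE eqxx.
  by rewrite -E => ws; have := st w w ws wt; rewrite eqxx.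
case/or3P=> [zs|/eqP zq|zt].
- by rewrite (negbTE (zst z zs)) orbF; apply/eqP/als; rewrite mem_rcons inE zs orbT.
- have qs : q \in rcons s q by rewrite mem_rcons mem_head.
  rewrite zq (eqP (als q qs)); suff /negbTE-> : q != head p (rcons t q) by rewrite orbF.
  apply/eqP=> E; have := ipath_uniq ipr; rewrite rev_uniq rcons_uniq => /andP[/negP[]].
  by rewrite {1}E; case: (t) t0 => // y t' _; rewrite /= inE eqxx.
- by rewrite (negbTE (zts z zt)) /=; apply/eqP/alt; rewrite mem_rcons inE zt orbT.
Qed.

(** * Connected sets *)

Implicit Types (W S D : {set T}) (A B P : pred T).

Definition within W : rel T := [rel u v | [&& u \in W, v \in W & e u v]].

Definition conn W : Prop := {in W &, forall u v, connect (within W) u v}.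

(** Contains [v] even if [v] is not in [S], as [connect] is reflexive; hence the assumptions
    [v \in S] below. *)
Definition component S v : {set T} := [set w | connect (within S) v w].

Definition attached p W : bool := [exists w in W, e p w].

Lemma attachedP p W : reflect (exists2 w, w \in W & e p w) (attached p W).
Proof. exact: exists_inP. Qed.

Lemma attachedI p w W : w \in W -> e p w -> attached p W.
Proof. by move=> wW pw; apply/attachedP; exists w. Qed.

Lemma within_sym W : symmetric (within W).
Proof. by move=> u v; rewrite /within /= e_sym andbCA. Qed.

Lemma within_csym W : connect_sym (within W).
Proof. exact: sym_connect_sym (@within_sym W). Qed.

Lemma connect_ind W P u v :
  connect (within W) u v -> P u ->
  (forall x y, x \in W -> y \in W -> e x y -> P x -> P y) -> P v.
Proof.
move=> /connectP[p pp ->] Pu H; elim: p u pp Pu => //= x p IH u.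
by move=> /andP[/and3P[uW xW ux] pp] Pu; apply: (IH x pp); apply: (H u).
Qed.

Lemma conn_ind W P x :
  conn W -> x \in W -> P x ->
  (forall u v, u \in W -> v \in W -> e u v -> P u -> P v) ->
  forall y, y \in W -> P y.
Proof. by move=> cW xW Px H y yW; apply: connect_ind (cW x y xW yW) Px H. Qed.

Lemma conn_exit W P x y :
  conn W -> x \in W -> P x -> y \in W -> ~~ P y ->
  exists u v, [/\ u \in W, v \in W, e u v, P u & ~~ P v].
Proof.
move=> cW xW Px yW nPy.
case: (boolP [exists u in W, exists v in W, [&& e u v, P u & ~~ P v]]).
  move=> /exists_inP[u uW /exists_inP[v vW /and3P[uv Pu nPv]]].
  by exists u, v.
move=> H; case/negP: nPy.
apply: (conn_ind cW xW Px) yW => u v uW vW uv Pu.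
apply: contraR H => nPv; apply/exists_inP; exists u => //.
by apply/exists_inP; exists v => //; rewrite uv Pu.
Qed.

Lemma sub_connect W W' u v : W \subset W' ->
  connect (within W) u v -> connect (within W') u v.
Proof.
move=> /subsetP sW; apply: connect_sub => x y /and3P[xW yW xy].
by apply: connect1; rewrite /within /= !sW.
Qed.

Lemma conn_root W v : (forall u, u \in W -> connect (within W) v u) -> conn W.
Proof.
move=> H x y xW yW; apply: (connect_trans (y := v)); last exact: H.
by rewrite within_csym; apply: H.
Qed.

Lemma conn1 q : conn [set q].
Proof. by move=> u v /set1P-> /set1P->; apply: connect0. Qed.

Lemma connU W1 W2 u v :
  conn W1 -> conn W2 -> u \in W1 -> v \in W2 -> e u v -> conn (W1 :|: W2).
Proof.
move=> c1 c2 uW1 vW2 uv; apply: (@conn_root _ u) => w /setUP[wW|wW].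
  by apply: sub_connect (c1 u w uW1 wW); apply: subsetUl.
apply: (connect_trans (y := v)).
  by apply: connect1; rewrite /within /= !inE uW1 vW2 orbT.
by apply: sub_connect (c2 v w vW2 wW); apply: subsetUr.
Qed.

Lemma connUI W1 W2 u : conn W1 -> conn W2 -> u \in W1 -> u \in W2 ->
  conn (W1 :|: W2).
Proof.
move=> c1 c2 u1 u2; apply: (@conn_root _ u) => w /setUP[wW|wW].
  by apply: sub_connect (c1 u w u1 wW); apply: subsetUl.
by apply: sub_connect (c2 u w u2 wW); apply: subsetUr.
Qed.

Lemma connU1 W q : conn W -> attached q W -> conn (q |: W).
Proof.
move=> cW /attachedP[w wW qw].
exact: (connU (@conn1 q) cW (set11 q) wW qw).
Qed.

Lemma component_id S v : v \in component S v.
Proof. by rewrite inE connect0. Qed.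

Lemma component_sub S v w : v \in S -> w \in component S v -> w \in S.
Proof.
by rewrite inE => vS H; apply: (connect_ind (P := mem S) H vS) => x y.
Qed.

Lemma component_closed S v u w :
  v \in S -> u \in component S v -> e u w -> w \in S -> w \in component S v.
Proof.
move=> vS uC uw wS; have uS := component_sub vS uC.
rewrite !inE in uC *; apply: connect_trans uC _.
by apply: connect1; rewrite /within /= uS wS.
Qed.

Lemma component_conn S v : v \in S -> conn (component S v).
Proof.
move=> vS; apply: (@conn_root _ v) => w; rewrite inE => H.
pose P x := (x \in component S v) && connect (within (component S v)) v x.
suff /andP[] : P w by [].
apply: (connect_ind (P := P) H); rewrite /P ?component_id ?connect0 //.
move=> x y xS yS xy /andP[xC vx].
have yC := component_closed vS xC xy yS; rewrite yC /=.
by apply: connect_trans vx _; apply: connect1; rewrite /within /= xC yC.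
Qed.

Lemma conn_path x s : path e x s -> conn [set z in x :: s].
Proof.
elim: s x => [|y s IH] x /= => [_|/andP[xy ps]].
  have -> : [set z in [:: x]] = [set x] by apply/setP=> z; rewrite !inE.
  exact: conn1.
have -> : [set z in [:: x, y & s]] = x |: [set z in y :: s].
  by apply/setP=> z; rewrite !inE.
by apply: connU1 (IH _ ps) _; apply/attachedP; exists y; rewrite ?inE ?eqxx.
Qed.

(** The new path enters the old one at the last neighbour of [x], so [x] sees nothing else of the
    tail that is kept. *)
Lemma ipath_attach x y w s : ipath (y :: s) -> x \notin y :: s ->
  w \in y :: s -> e x w ->
  exists s', [/\ ipath (x :: s'), last x s' = last y s &
    {subset s' <= y :: s}].
Proof.
elim: s y w => [|z s IH] y w ips xs ws xw.
  move: ws xw; rewrite inE => /eqP-> xy; exists [:: y]; split=> //.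
  exact: (ipath2 xy).
case: (boolP (has (e x) (z :: s))) => [/hasP[v vs xv]|/hasPn H].
  have [||s' [h1 h2 h3]] := IH z v _ _ vs xv.
  - by case/and3P: ips.
  - by move: xs; rewrite inE negb_or => /andP[].
  by exists s'; split=> // u /h3 us; rewrite inE us orbT.
have xy : e x y.
  by move: ws xw; rewrite inE => /predU1P[->//|/H/negbTE->].
move: xs; rewrite inE negb_or => /andP[nxy xs].
exists [:: y, z & s]; split=> //.
exact: (ipath_cons ips nxy xs xy H).
Qed.

Lemma ipath_of_path x p : path e x p ->
  exists s, [/\ ipath (x :: s), last x s = last x p & {subset x :: s <= x :: p}].
Proof.
elim: p x => [|y p IH] x /=; first by exists [::]; split.
case/andP=> xy pp; have [s [ips ls ss]] := IH y pp.
case: (boolP (x \in y :: s)) => [xs|xs].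
  case/splitPl: xs ls ss ips => s1 s2 lx ls ss ips.
  exists s2; rewrite last_cat lx in ls; split => //.
    by move: ips; rewrite -cat_cons lastI cat_rcons lx; apply: ipath_catr.
  move=> z; rewrite inE => /predU1P[->|zs2]; first exact: mem_head.
  by rewrite inE ss ?orbT // inE mem_cat zs2 !orbT.
have [s' [ips' ls' ss']] := ipath_attach ips xs (mem_head y s) xy.
exists s'; split=> //; first by rewrite ls' ls.
move=> z; rewrite inE => /predU1P[->|zs']; first exact: mem_head.
by rewrite inE (ss z (ss' z zs')) orbT.
Qed.

Lemma conn_ipath W x y : conn W -> x \in W -> y \in W ->
  exists s, [/\ ipath (x :: s), last x s = y & {subset x :: s <= W}].
Proof.
move=> cW xW yW; have /connectP[p pp ->] := cW x y xW yW.
have pe : path e x p.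
  by apply: sub_path pp => u v /and3P[].
have [s [ips ls ss]] := ipath_of_path pe; exists s; split=> // z /ss.
suff pW : {subset p <= W} by rewrite inE => /predU1P[->|/pW].
elim: p x {xW pe ips ls ss} pp => //= a p IH x /andP[/and3P[_ aW _] pp] b.
by rewrite inE => /predU1P[->|/(IH a pp)].
Qed.

(** A shortest path works: a further vertex in [A] would allow dropping the part before it, a
    further vertex in [B] the part after it. The path may be a single vertex. *)
Lemma conn_between W A B a b : conn W -> a \in W -> A a -> b \in W -> B b ->
  exists x s, [/\ ipath (x :: s), {subset x :: s <= W}, A x /\ B (last x s),
    (forall z, z \in x :: s -> A z -> z = x) &
    (forall z, z \in x :: s -> B z -> z = last x s)].
Proof.
move=> cW aW Aa bW Bb.
have [s [ips lb ss]] := conn_ipath cW aW bW.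
have Bl : B (last a s) by rewrite lb.
have [n] := ubnP (size s); clear aW lb b bW Bb.
elim: n s a Aa ips ss Bl => // n IH s x Ax ips ss Bl sn.
case: (boolP (has A s)) => [/hasP[z zs Az]|/hasPn nA].
  case/splitPr: zs sn ips ss Bl => s1 s2 sn ips ss Bl.
  apply: (IH s2 z Az); last by move: sn; rewrite size_cat /=; lia.
  - by move: ips; rewrite -cat_cons; apply: ipath_catr.
  - by move=> w ws; apply: ss; rewrite inE mem_cat ws !orbT.
  - by move: Bl; rewrite last_cat.
case: (boolP (has B (belast x s))) => [/hasP[z zs Bz]|/hasPn nB].
  move: (lastI x s); case/splitPr: zs => b1 b2 E.
  have [s1 [Ez lz]] : exists s1, x :: s1 = rcons b1 z /\ last x s1 = z.
    case: b1 E => [|y b1] [-> _]; first by exists [::]; split.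
    by exists (rcons b1 z); rewrite last_rcons.
  have E2 : x :: s = (x :: s1) ++ rcons b2 (last x s).
    by rewrite E Ez rcons_cat /= cat_rcons.
  apply: (IH s1 x Ax).
  - by move: ips; rewrite E2; apply: ipath_catl.
  - by move=> w ws; apply: ss; rewrite E2 mem_cat ws.
  - by rewrite lz.
  - by have := congr1 size E2; rewrite size_cat size_rcons /=; lia.
exists x, s; split=> // z.
  by rewrite inE => /predU1P[//|/nA/negP].
by rewrite lastI mem_rcons inE => /predU1P[//|/nB/negP].
Qed.

(** On a shortest path in [W] from N(p) to N(q) only the first vertex is adjacent to [p] and only
    the last to [q], so adding [p] and [q] keeps it induced. *)
Lemma conn_link W p q : conn W -> p \notin W -> q \notin W -> p != q ->
  ~~ e p q -> attached p W -> attached q W ->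
  exists s, [/\ 0 < size s, {subset s <= W} & ipath (p :: rcons s q)].
Proof.
move=> cW pW qW pq npq /attachedP[a aW pa] /attachedP[b bW qb].
have [x [s [ips ss [px ql] Hp Hq]]] := conn_between cW aW pa bW qb.
exists (x :: s); split=> //.
have ip2 : ipath (rcons (x :: s) q).
  rewrite -cats1; apply: ipath_cat => // u v us; rewrite inE => /eqP->.
  split; first by apply: contraNneq qW => <-; apply: ss.
  rewrite /= eqxx andbT e_sym; apply/idP/eqP => [/Hq->//|->//].
rewrite rcons_cons; apply: ipath_cons => //.
- by apply: contraNneq pW => ->; apply: ss; rewrite mem_head.
- rewrite mem_rcons inE negb_or pq /=; apply: contra pW => ps.
  by apply: ss; rewrite inE ps orbT.
- move=> z; rewrite mem_rcons inE => /predU1P[->//|zs].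
  apply/negP => /Hp; rewrite inE zs orbT => /(_ isT) E.
  by have /= := ipath_uniq ips; rewrite -E zs.
Qed.

(** * Kempe chains *)

Implicit Types phi : T -> 'I_3.

Definition colours S phi : Prop :=
  {in S &, forall u v, e u v -> phi u != phi v}.

Definition bicoloured S phi (al be : 'I_3) : {set T} :=
  [set v in S | (phi v == al) || (phi v == be)].

(** The two colours alternate along the path. *)
Lemma bicoloured_parity S phi al be x s :
  colours S phi -> path e x s -> {subset x :: s <= bicoloured S phi al be} ->
  odd (size s) = (phi x != phi (last x s)).
Proof.
move=> cS; elim: s x => [|y s IH] x /= => [_ _|/andP[xy ps] H].
  by rewrite eqxx.
rewrite (IH y) //; last by move=> z zs; apply: H; rewrite inE zs orbT.
have := H _ (mem_head _ _); have := H y; rewrite !inE eqxx orbT => /(_ isT).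
have : last y s \in [:: x, y & s] by rewrite inE mem_last orbT.
move/H; rewrite inE => /andP[_ Hl] /andP[yS Hy] /andP[xS Hx].
have := cS x y xS yS xy.
by case/orP: Hl => /eqP->; case/orP: Hy => /eqP->; case/orP: Hx => /eqP->;
  rewrite ?eqxx // ![be == al]eq_sym; case: (al == be).
Qed.

(** [F] is the union of the two-coloured components that meet [A]. If [F] avoids [B], exchanging the
    colours on [F] gives the first alternative. Otherwise some component meets both, and a shortest
    path in it from [A] to [B] is the chain; its parity is what later closes odd holes. *)
Lemma kempe S phi al be A B : colours S phi ->
  let P := bicoloured S phi al be in
  (exists phi', [/\ colours S phi',
     {in P, forall v, A v -> phi' v = tperm al be (phi v)},
     {in P, forall v, B v -> phi' v = phi v},
     {in P, forall v, (phi' v == al) || (phi' v == be)} &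
     forall v, v \notin P -> phi' v = phi v]) \/
  (exists x s, [/\ ipath (x :: s), {subset x :: s <= P},
     A x /\ B (last x s),
     (forall z, z \in x :: s -> A z -> z = x) /\
     (forall z, z \in x :: s -> B z -> z = last x s) &
     odd (size s) = (phi x != phi (last x s))]).
Proof.
move=> cS P.
pose F := [set v in P | [exists a in P, A a && connect (within P) a v]].
case: (boolP [exists b in F, B b]) => [/exists_inP[b]|/exists_inPn FB].
  rewrite inE => /andP[bP /exists_inP[a aP /andP[Aa ab]]] Bb; right.
  pose C := component P a.
  have aC : a \in C := component_id P a.
  have bC : b \in C by rewrite inE.
  have [x [s [ips ss [Ax Bl] HA HB]]] :=
    conn_between (component_conn aP) aC Aa bC Bb.
  have sP : {subset x :: s <= P} by move=> z /ss; apply: component_sub.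
  exists x, s; split=> //.
  exact: (bicoloured_parity cS (ipath_path ips) sP).
left; pose phi' v := if v \in F then tperm al be (phi v) else phi v.
have FP v : v \in F -> v \in P by rewrite inE => /andP[].
exists phi'; split.
- move=> u v uS vS uv; rewrite /phi'.
  have closed a b : a \in F -> b \in S -> e a b ->
      b \notin F -> tperm al be (phi a) != phi b.
    move=> aF bS ab bF; have aP := FP _ aF.
    have bP : b \notin P.
      apply: contra bF => bP; rewrite inE bP /=.
      move: aF; rewrite inE => /andP[_ /exists_inP[c cP /andP[Ac ca]]].
      apply/exists_inP; exists c; rewrite // Ac /=.
      by apply: connect_trans ca _; apply: connect1; rewrite /within /= aP bP.
    move: bP; rewrite inE bS negb_or /= => /andP[b1 b2].
    move: aP; rewrite inE => /andP[_ /orP[]/eqP->].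
      by rewrite tpermL eq_sym.
    by rewrite tpermR eq_sym.
  case: ifPn => uF; case: ifPn => vF.
  + by rewrite (inj_eq perm_inj) cS.
  + exact: closed.
  + by rewrite eq_sym; apply: closed; rewrite // e_sym.
  + exact: cS.
- move=> v vP Av; rewrite /phi' ifT // inE vP /=.
  by apply/exists_inP; exists v => //; rewrite Av connect0.
- move=> v vP Bv; rewrite /phi' ifF //; apply/negP => vF.
  by have := FB v vF; rewrite Bv.
- move=> v vP; have : (phi v == al) || (phi v == be) by move: vP; rewrite inE => /andP[].
  rewrite /phi'; case: ifP => // _ /orP[]/eqP->.
    by rewrite tpermL eqxx orbT.
  by rewrite tpermR eqxx.
- by move=> v vP; rewrite /phi' ifF //; apply: contraNF vP => /FP.
Qed.

(** * Pentagons, and two colours without them *)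

Definition pentagon (a b c d f : T) : bool :=
  [&& e a b, e b c, e c d, e d f & e f a].

Lemma pentagonI a b c d f :
  e a b -> e b c -> e c d -> e d f -> e f a -> pentagon a b c d f.
Proof. by rewrite /pentagon => -> -> -> -> ->. Qed.

Lemma pentagon_of_hole v s :
  ipath s -> 1 < size s -> v \notin s ->
  (forall z, z \in s -> e v z = (z == head v s) || (z == last v s)) ->
  ~~ odd (size s) ->
  exists x1 x2 x3 x4, s = [:: x1; x2; x3; x4] /\ pentagon v x1 x2 x3 x4.
Proof.
move=> ips s1 vs H od; have s4 := hole_size ips s1 vs H od.
case: s s4 ips H {s1 vs od} => // x1 [//|x2 [//|x3 [//|x4 [|//]]]] _ ips H.
exists x1, x2, x3, x4; split=> //.
have /= /and4P[e12 e23 e34 _] := ipath_path ips.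
apply: pentagonI => //; last rewrite e_sym; rewrite H ?eqxx ?orbT //.
  exact: mem_head.
by rewrite !inE eqxx !orbT.
Qed.

(** One vertex [v] is added at a time. A chain between neighbours of [v] in different colours has
    odd length, so with [v] it closes to an odd hole, hence a pentagon. Without such a chain all
    neighbours of [v] can be given colour [be], which frees [al] for [v]. *)
Lemma no_pentagon_two_colours (al be : 'I_3) S : al != be ->
  (forall a b c d f, a \in S -> b \in S -> c \in S -> d \in S -> f \in S ->
     ~~ pentagon a b c d f) ->
  exists phi, colours S phi /\ {in S, forall v, (phi v == al) || (phi v == be)}.
Proof.
move=> ab; have [n] := ubnP #|S|; elim: n S => // n IH S Sn noC.
have [->|[v vS]] := set_0Vmem S.
  by exists (fun=> al); split=> u; rewrite inE.
have vD u : u \in S :\ v -> u \in S by rewrite inE => /andP[].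
have [||phi [cphi phi2]] := IH (S :\ v).
- by move: Sn; rewrite (cardsD1 v S) vS.
- by move=> a b c d f /vD aS /vD bS /vD cS' /vD dS /vD fS; apply: noC.
pose A := [pred u | e v u && (phi u == al)].
pose B := [pred u | e v u && (phi u == be)].
have inP u : u \in S :\ v -> u \in bicoloured (S :\ v) phi al be.
  by move=> uS; rewrite inE uS phi2.
have [[psi [cpsi HA HB H2 _]]|[x [s [ips ss [Ax Bl] [HA HB] od]]]] :=
  kempe al be A B cphi.
  have nb u : u \in S -> e v u -> psi u = be.
    move=> uS vu; have uD : u \in S :\ v by rewrite in_setD1 uS eq_sym adj_neq.
    case/orP: (phi2 u uD) => E.
      by rewrite (HA u (inP u uD)) ?inE ?vu ?E // (eqP E) tpermL.
    by rewrite (HB u (inP u uD)) ?inE ?vu ?E // (eqP E).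
  exists (fun u => if u == v then al else psi u); split; last first.
    move=> u uS; case: (eqVneq u v) => [_|uv]; first by rewrite eqxx.
    by apply: H2; apply: inP; rewrite in_setD1 uS uv.
  move=> u w uS wS uw; case: (eqVneq u v) => [uv|uv]; case: (eqVneq w v) => [wv|wv].
  - by rewrite uv wv e_irr in uw.
  - by rewrite nb // -uv.
  - by rewrite eq_sym nb // -wv e_sym.
  - by apply: cpsi => //; rewrite in_setD1 ?uS ?wS ?uv ?wv.
have [px /eqP fx] := andP Ax; have [pl /eqP fl] := andP Bl.
rewrite fx fl ab in od.
have sD z : z \in x :: s -> z \in S :\ v.
  by move/ss; rewrite inE => /andP[].
have s0 : 0 < size s by case: (s) od.
have [||||x1 [x2 [x3 [x4 [E pent]]]]] := @pentagon_of_hole v (x :: s) ips.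
- by [].
- by apply/negP => /sD; rewrite !inE eqxx.
- move=> z zs; apply/idP/orP => [vz|[/eqP->|/eqP->]] //.
  case/orP: (phi2 z (sD z zs)) => fz.
    by left; rewrite (HA z zs) ?inE ?vz.
  by right; rewrite (HB z zs) ?inE ?vz.
- by rewrite /= od.
exfalso; move: pent; apply/negP; apply: noC => //;
  by apply: vD; apply: sD; rewrite E !inE eqxx ?orbT.
Qed.

Lemma no_pentagon_bipartite S :
  (forall a b c d f, a \in S -> b \in S -> c \in S -> d \in S -> f \in S ->
     ~~ pentagon a b c d f) ->
  exists s : T -> bool, {in S &, forall u v, e u v -> s u != s v}.
Proof.
have ab : ord0 != ord_max :> 'I_3 by [].
move=> /(no_pentagon_two_colours ab)[phi [cphi phi2]].
exists (fun v => phi v == ord0) => u v uS vS uv; have := cphi u v uS vS uv.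
by case/orP: (phi2 u uS) => /eqP->; case/orP: (phi2 v vS) => /eqP->.
Qed.

Lemma bipartite_parity (S : {set T}) (sd : T -> bool) x s :
  {in S &, forall u v, e u v -> sd u != sd v} ->
  path e x s -> {subset x :: s <= S} ->
  odd (size s) = (sd x != sd (last x s)).
Proof.
move=> bip; elim: s x => [|y s IH] x /= => [_ _|/andP[xy ps] H].
  by rewrite eqxx.
rewrite (IH y) //; last by move=> z zs; apply: H; rewrite inE zs orbT.
have := bip x y (H x _) (H y _) xy; rewrite !inE !eqxx ?orbT => /(_ isT isT).
by case: (sd x); case: (sd y); case: (sd (last y s)).
Qed.

(** * Minimal counterexamples *)

Section Critical.

Hypothesis crit : forall S : {set T}, S != setT -> exists phi, colours S phi.
Hypothesis not_col : forall phi, ~ colours setT phi.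

Lemma glue S1 S2 phi1 phi2 :
  colours S1 phi1 -> colours S2 phi2 ->
  (forall z, (z \in S1) || (z \in S2)) ->
  (forall u v, u \in S1 -> v \notin S1 -> e u v -> u \in S2) ->
  (forall z, z \in S1 -> z \in S2 -> phi1 z = phi2 z) -> False.
Proof.
move=> c1 c2 cov sep agree.
apply: (not_col (phi := fun z => if z \in S1 then phi1 z else phi2 z)).
have mixed u v : u \in S1 -> v \notin S1 -> e u v -> phi1 u != phi2 v.
  move=> uS vS uv; have uS2 := sep u v uS vS uv.
  by rewrite agree // c2 //; have := cov v; rewrite (negbTE vS).
move=> u v _ _ uv; case: ifPn => uS; case: ifPn => vS.
- exact: c1.
- exact: mixed.
- by rewrite eq_sym mixed // e_sym.
- by apply: c2 => //; [have := cov u | have := cov v];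
    rewrite ?(negbTE uS) ?(negbTE vS).
Qed.

Lemma colours_perm S phi (t : {perm 'I_3}) :
  colours S phi -> colours S (fun z => t (phi z)).
Proof. by move=> cS u v uS vS uv; rewrite (inj_eq perm_inj) cS. Qed.

(** If all neighbours of [v] were among [u1] and [u2], a third colour would extend a colouring of
    the rest to [v]. *)
Lemma degree_ge3 v u1 u2 : exists w, [/\ e v w, w != u1 & w != u2].
Proof.
case: (pickP [pred w | [&& e v w, w != u1 & w != u2]]) => [w /and3P[]|H].
  by exists w.
have [|phi cphi] := crit (S := ~: [set v]).
  by apply/eqP => /setP/(_ v); rewrite !inE eqxx.
have [k /andP[k1 k2]] := third_colour (phi u1) (phi u2).
case: (not_col (phi := fun z => if z == v then k else phi z)).
have nb w : e v w -> k != phi w.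
  by move=> vw; move: (H w); rewrite /= vw /= -negb_or => /negbFE/orP[]/eqP->.
move=> u w _ _ uw; case: (eqVneq u v) => [uv|uv]; case: (eqVneq w v) => [wv|wv].
- by rewrite uv wv e_irr in uw.
- by rewrite nb // -uv.
- by rewrite eq_sym nb // -wv e_sym.
- by rewrite cphi // !inE.
Qed.

(** The chain uses the colour of [a] and the colour [k] absent from [a] and [b]. The colour of [c]
    differs from that of [b], so it is one of these two; a flip at [a] alone changes whether [a] and
    [c] agree, and a chain that prevents the flip avoids [b] because of its colour. *)
Lemma flip_end S phi a b c :
  colours S phi -> a \in S -> b \in S -> c \in S ->
  e a b -> e b c -> a != c ->
  (exists psi, colours S psi /\ (psi a == psi c) = ~~ (phi a == phi c)) \/
  (exists t, [/\ {subset t <= S}, b \notin t, ipath (a :: rcons t c) &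
     odd (size t) = (phi a == phi c)]).
Proof.
move=> cS aS bS cS' ab bc ac.
have [k /andP[ka kb]] := third_colour (phi a) (phi b).
have fab := cS a b aS bS ab; have fbc := cS b c bS cS' bc.
have aP : a \in bicoloured S phi (phi a) k by rewrite inE aS eqxx.
have cP : c \in bicoloured S phi (phi a) k.
  rewrite inE cS' /=; case: eqVneq => //= fca; apply/eqP.
  by apply: (third_colour_uniq fab) => //; rewrite eq_sym.
have [[psi [cpsi HA HB H2 H3]]|[x [s [ips ss [/eqP Ax /eqP Bl] [HA HB] od]]]] :=
    kempe (phi a) k (pred1 a) (pred1 c) cS.
  left; exists psi; split=> //.
  rewrite (HA a aP) ?inE // (HB c cP) ?inE // tpermL.
  move: cP; rewrite inE => /andP[_ /orP[/eqP->|/eqP->]].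
    by rewrite eqxx (negbTE ka).
  by rewrite eqxx eq_sym ka.
right; subst x; case/lastP: s ips ss Bl od {HA HB} => [|t y].
  by move=> _ _ /= E; rewrite E eqxx in ac.
rewrite last_rcons size_rcons /= => ips ss yc; subst y.
move=> od; exists t; split=> //.
- by move=> z zt; have := ss z; rewrite inE mem_rcons inE zt !orbT inE => /(_ isT)/andP[].
- apply/negP => bt; have := ss b; rewrite inE mem_rcons inE bt !orbT inE.
  by move=> /(_ isT)/andP[_]; rewrite eq_sym (negbTE fab) eq_sym (negbTE kb).
- by apply: negb_inj; rewrite od.
Qed.

(* An odd path on one side would close up with an even one on the other side
   to an odd hole. *)
Lemma no_P3_cutset (K : {set T}) a b c k o :
  e a b -> e b c -> a != c -> k \in K -> o \notin K ->
  a \notin K -> b \notin K -> c \notin K -> o != a -> o != b -> o != c ->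
  (forall u z, u \in K -> z \notin K -> e u z -> [|| z == a, z == b | z == c]) ->
  False.
Proof.
move=> ab bc ac kK oK aK bK cK oa ob oc NK.
pose X := [set z | [|| z == a, z == b | z == c]].
pose S1 := K :|: X; pose S2 := ~: K.
have [|phi1 c1] := crit (S := S1).
  by apply/eqP => /setP/(_ o); rewrite !inE (negbTE oK) (negbTE oa)
    (negbTE ob) (negbTE oc).
have [|phi2 c2] := crit (S := S2).
  by apply/eqP => /setP/(_ k); rewrite !inE kK.
have aS1 : a \in S1 by rewrite !inE eqxx orbT.
have bS1 : b \in S1 by rewrite !inE eqxx !orbT.
have cS1 : c \in S1 by rewrite !inE eqxx !orbT.
have aS2 : a \in S2 by rewrite !inE.
have bS2 : b \in S2 by rewrite !inE.
have cS2 : c \in S2 by rewrite !inE.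
(* Up to renaming colours, a colouring of the path is determined by whether its ends agree. *)
have final psi1 psi2 : colours S1 psi1 -> colours S2 psi2 ->
    (psi1 a == psi1 c) = (psi2 a == psi2 c) -> False.
  move=> d1 d2 E.
  have n1 := d1 a b aS1 bS1 ab; have n2 := d2 a b aS2 bS2 ab.
  have m1 := d1 b c bS1 cS1 bc; have m2 := d2 b c bS2 cS2 bc.
  have [t [ta tb]] := colour_perm n2 n1.
  apply: (glue d1 (colours_perm t d2)).
  - by move=> z; rewrite !inE; case: (z \in K); rewrite ?orbT.
  - move=> u v; rewrite !inE => /orP[uK|/or3P[]/eqP->]; rewrite ?aK ?bK ?cK //.
    by rewrite negb_or => /andP[vK /negP nX] uv; case: nX; apply: NK uv.
  move=> z; rewrite !inE => /orP[->//|zX _]; symmetry.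
  case/or3P: zX => /eqP->; rewrite ?ta ?tb //.
  move: E; case: (eqVneq (psi2 a) (psi2 c)) => [<- /eqP<-//|ac2 /negbT ac1].
  apply: (third_colour_uniq n1).
  - by rewrite -ta (inj_eq perm_inj) eq_sym.
  - by rewrite -tb (inj_eq perm_inj) eq_sym.
  - by rewrite eq_sym.
  - by rewrite eq_sym.
case: (eqVneq (phi1 a == phi1 c) (phi2 a == phi2 c)) => [|dif].
  exact: final c1 c2.
have [[psi [cpsi E]]|[t1 [ts1 bt1 ip1 od1]]] :=
    flip_end c1 aS1 bS1 cS1 ab bc ac.
  apply: (final psi phi2) => //; rewrite E.
  by move: dif; case: (phi1 a == _); case: (phi2 a == _).
have [[psi [cpsi E]]|[t2 [ts2 bt2 ip2 od2]]] :=
    flip_end c2 aS2 bS2 cS2 ab bc ac.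
  apply: (final phi1 psi) => //; rewrite E.
  by move: dif; case: (phi1 a == _); case: (phi2 a == _).
have nac : ~~ e a c := no_triangle' ab bc.
have notin t : ipath (a :: rcons t c) -> (a \notin t) /\ (c \notin t).
  move/ipath_uniq; rewrite /= mem_rcons inE negb_or rcons_uniq.
  by case/and3P => /andP[_ ->] ->.
have pos t : ipath (a :: rcons t c) -> 0 < size t.
  by case: t => //= /ipath_path /=; rewrite (negbTE nac).
have K1 z : z \in t1 -> z \in K.
  have [at1 ct1] := notin t1 ip1.
  move=> zt; have := ts1 z zt; rewrite !inE => /orP[//|/or3P[]/eqP E].
  - by rewrite -E zt in at1.
  - by rewrite -E zt in bt1.
  - by rewrite -E zt in ct1.
have s3 : size t1 + size t2 = 3.
  apply: (theta ip1 ip2); rewrite ?pos //.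
    move=> u v /K1 uK vt2; have := ts2 v vt2; rewrite !inE => vK.
    apply/andP; split; first by apply: contraNneq vK => <-.
    have [at2 ct2] := notin t2 ip2.
    apply/negP => /(NK u v uK vK) /or3P[]/eqP E.
    - by rewrite -E vt2 in at2.
    - by rewrite -E vt2 in bt2.
    - by rewrite -E vt2 in ct2.
  by rewrite oddD od1 od2; move: dif; case: (phi1 a == _); case: (phi2 a == _).
(* The sizes add up to three, so one chain has a single inner vertex; it would be a second common
   neighbour of [a] and [c] besides [b]. *)
have short t : ipath (a :: rcons t c) -> b \notin t -> size t != 1.
  case: t => [|x [|//]] //= /ipath_path /= /and3P[ax xc _].
  rewrite inE => /eqP[]; apply: (common_nbr ac ab _ ax).
    by rewrite e_sym.
  by rewrite e_sym.
move: (short t1 ip1 bt1) (short t2 ip2 bt2) (pos t1 ip1) (pos t2 ip2) s3.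
by case: (size t1) (size t2) => [|[|[|[|m]]]] [|[|n]].
Qed.

(** * The complement of the neighbourhood of a pentagon *)

Definition dom (C : seq T) z : bool := (z \in C) || has (e z) C.

Definition far C : {set T} := [set z | ~~ dom C z].

(* The components of the complement of the closed neighbourhood of [C]. *)
Definition piece C (D : {set T}) : Prop :=
  [/\ conn D, D != set0, D \subset far C &
      forall u z, u \in D -> e u z -> z \notin D -> dom C z].

Lemma eq_dom C C' z : C =i C' -> dom C z = dom C' z.
Proof. by move=> E; rewrite /dom E (eq_has_r E). Qed.

Lemma eq_far C C' : C =i C' -> far C = far C'.
Proof. by move=> E; apply/setP => z; rewrite !inE (eq_dom z E). Qed.

Lemma eq_piece C C' D : C =i C' -> piece C D -> piece C' D.
Proof.
move=> E [cD nD fD clD]; split=> //; first by rewrite -(eq_far E).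
by move=> u z uD uz zD; rewrite -(eq_dom z E); apply: clD uz zD.
Qed.

Lemma farP C W w x : W \subset far C -> w \in W -> x \in C ->
  w != x /\ ~~ e w x.
Proof.
move=> /subsetP sW /sW; rewrite inE negb_or => /andP[wC /hasPn H] xC.
by split; [apply: contraNneq wC => -> | apply: H].
Qed.

Lemma piece_component C v : ~~ dom C v -> piece C (component (far C) v).
Proof.
move=> nv; have vF : v \in far C by rewrite inE.
split; first exact: component_conn.
- by apply/set0Pn; exists v; apply: component_id.
- by apply/subsetP => w; apply: component_sub.
move=> u z uK uz; apply: contraR => nz.
by apply: (component_closed vF uK uz); rewrite inE.
Qed.

Lemma piece_absorb C D W x : piece C D -> conn W -> W \subset far C ->
  x \in W -> x \in D -> W \subset D.
Proof.
move=> [_ _ _ clD] cW /subsetP sW xW xD; apply/subsetP.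
apply: (conn_ind cW xW xD) => u v uW vW uv uD.
by apply: contraTT (sW v vW) => vD; rewrite inE negbK; apply: clD uD uv vD.
Qed.

Lemma attached_out C W p : W \subset far C -> attached p W -> p \notin C.
Proof.
move=> fW /attachedP[w wW pw]; apply/negP => pC.
by have [_] := farP fW wW pC; rewrite e_sym pw.
Qed.

Lemma near_notin C W p x : W \subset far C -> e p x -> x \in C -> p \notin W.
Proof.
move=> fW px xC; apply/negP => pW.
by have [_] := farP fW pW xC; rewrite px.
Qed.

(** * How a connected set attaches to a pentagon *)

Lemma pentagon_rot a b c d f : pentagon a b c d f -> pentagon b c d f a.
Proof. by case/and5P => *; apply: pentagonI. Qed.

Lemma pentagon_rev a b c d f : pentagon a b c d f -> pentagon a f d c b.
Proof. by case/and5P => *; apply: pentagonI; rewrite e_sym. Qed.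

Lemma pentagon_neq a b c d f : pentagon a b c d f -> a != c.
Proof.
case/and5P => ab bc cd df fa; apply/eqP => E; rewrite -E in cd.
by apply: (no_triangle cd df); rewrite e_sym.
Qed.

Lemma outside_nadj a b c d f p : pentagon a b c d f ->
  p \notin [:: a; b; c; d; f] -> e p a -> ~~ e p c.
Proof.
move=> C5 pC pa; apply/negP => pc.
have ac := pentagon_neq C5; case/and5P: C5 => ab bc _ _ _.
have pb : p = b.
  by apply: (common_nbr ac); rewrite // e_sym.
by move: pC; rewrite pb !inE eqxx orbT.
Qed.

(** Otherwise a path from [p] to [r] through [W] closes along both sides of the pentagon, with three
    and with four further vertices. One of the two totals is odd, and it exceeds the three allowed
    by [theta]. *)
Lemma attached_dist2_adj a b c d f W p r :
  pentagon a b c d f -> conn W -> W \subset far [:: a; b; c; d; f] ->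
  e p a -> e r c -> attached p W -> attached r W -> e p r.
Proof.
move=> C5 cW fW pa rc pW rW; apply/negPn/negP => npr.
have pC := attached_out fW pW; have rC := attached_out fW rW.
have npc := outside_nadj C5 pC pa.
have ac := pentagon_neq C5; have C5r := pentagon_rev C5.
have ad := pentagon_neq C5r.
have cf : c != f := pentagon_neq (pentagon_rot (pentagon_rot C5)).
case/and5P: (C5) => ab bc cd df fa.
have pr : p != r by apply: contraNneq npc => ->.
move: (pC) (rC); rewrite !inE !negb_or.
move=> /and5P[pna pnb pnc pnd pnf] /and5P[rna rnb rnc rnd rnf].
have nar : ~~ e a r.
  apply/negP => ar; have := common_nbr ac ab; rewrite e_sym in bc.
  by move=> /(_ r bc ar); rewrite e_sym => /(_ rc) E; rewrite E eqxx in rnb.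
have aC : a \in [:: a; b; c; d; f] by rewrite !inE eqxx.
have cC : c \in [:: a; b; c; d; f] by rewrite !inE eqxx !orbT.
have [s [s0 sW ips]] := conn_link cW (near_notin fW pa aC)
  (near_notin fW rc cC) pr npr pW rW.
have anti (t : seq T) : {subset t <= [:: a; b; c; d; f]} ->
    forall u v, u \in s -> v \in t -> (u != v) && ~~ e u v.
  by move=> st u v us /st vC; have [-> ->] := farP fW (sW u us) vC.
have ip1 : ipath (p :: rcons [:: a; b; c] r).
  by apply: ipath5; rewrite // 1?eq_sym // e_sym.
have ip2 : ipath (p :: rcons [:: a; f; d; c] r).
  apply: ipath6; rewrite // 1?eq_sym // e_sym //.
have st1 : {subset [:: a; b; c] <= [:: a; b; c; d; f]}.
  by move=> z; rewrite !inE => /or3P[]->; rewrite ?orbT.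
have st2 : {subset [:: a; f; d; c] <= [:: a; b; c; d; f]}.
  by move=> z; rewrite !inE => /or4P[]->; rewrite ?orbT.
move: s0 (theta ips ip1 s0 isT (anti _ st1)) (theta ips ip2 s0 isT (anti _ st2)).
by rewrite /=; clear; move=> *; lia.
Qed.

(** The path is compared with the routes over [f], [a] and over [r], [b], [a]. The longer route
    cannot give the odd total, since [s] is nonempty; so the shorter one does, and it leaves a
    single vertex for [s]. *)
Lemma attached_consecutive_link a b c d f p q r s :
  pentagon a b c d f -> {subset s <= far [:: a; b; c; d; f]} ->
  p \notin [:: a; b; c; d; f] -> q \notin [:: a; b; c; d; f] ->
  r \notin [:: a; b; c; d; f] ->
  e p f -> e q a -> e r b -> e p r -> ipath (p :: rcons s q) ->
  (forall z, z \in s -> ~~ e z r) -> 0 < size s -> size s = 1.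
Proof.
move=> C5 sf pC qC rC pf qa rb pr ips nsr s0.
case/and5P: (C5) => ab bc cd df fa.
move: (pC) (qC) (rC); rewrite !inE !negb_or.
move=> /and5P[pna pnb _ _ _] /and5P[_ qnb _ _ qnf] /and5P[rna _ _ _ _].
have npq : ~~ e p q.
  by apply: (no_square' pf fa); rewrite // 1?eq_sym // e_sym.
have ip1 : ipath (p :: rcons [:: f; a] q).
  by apply: ipath4; rewrite // 1?eq_sym // e_sym.
have ip2 : ipath (p :: rcons [:: r; b; a] q).
  by apply: ipath5; rewrite // 1?eq_sym // e_sym.
have sC u v : u \in s -> v \in [:: a; b; c; d; f] -> (u != v) && ~~ e u v.
  move=> us vC; have := farP (subxx (far [:: a; b; c; d; f])) (sf u us) vC.
  by case=> -> ->.
have t1 := theta ips ip1 s0 isT.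
have t2 := theta ips ip2 s0 isT.
have {}t1 : odd (size s + 2) -> size s + 2 = 3.
  apply: t1 => u v us; rewrite !inE => vt; apply: sC => //.
  by rewrite !inE; case/orP: vt => ->; rewrite ?orbT.
have {}t2 : odd (size s + 3) -> size s + 3 = 3.
  apply: t2 => u v us; rewrite inE => /predU1P[->|vt].
    rewrite nsr // andbT; apply: contraTneq (sf u us) => ->.
    by rewrite inE negbK /dom /= rb !orbT.
  by apply: sC => //; move: vt; rewrite !inE => /orP[]->; rewrite ?orbT.
by move: s0 t1 t2; clear; move=> *; lia.
Qed.

(** Take an induced path from [pf] to [pa] through [W]. If [pb] has a neighbour on it, the tail from
    there joins [pb] to [pa] in a smaller set, to which the rotated statement applies. If not, the
    path has one inner vertex, which must be the common neighbour [pc] of [pf] and [pa]; but [pc] is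
    next to the pentagon and [W] is not. *)
Lemma no_five_types n : forall W a b c d f pa pb pc pd pf, #|W| < n ->
  pentagon a b c d f -> conn W -> W \subset far [:: a; b; c; d; f] ->
  [/\ pa \notin [:: a; b; c; d; f], pb \notin [:: a; b; c; d; f],
      pc \notin [:: a; b; c; d; f], pd \notin [:: a; b; c; d; f] &
      pf \notin [:: a; b; c; d; f]] ->
  [/\ e pa a, e pb b, e pc c, e pd d & e pf f] ->
  pentagon pa pc pf pb pd -> attached pf W -> attached pa W -> False.
Proof.
elim: n => // n IH W a b c d f pa pb pc pd pf Wn C5 cW fW out adj P5 fpf fpa.
case: (out) (adj) (P5) => oa ob oc od of'.
case=> ea eb ec ed ef /and5P[eac ecf efb ebd eda].
have fa : e f a by case/and5P: C5.
have nfa : pf != pa by rewrite eq_sym; apply: (pentagon_neq P5).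
have paf : pa != f by apply: contraNneq oa => ->; rewrite !inE eqxx ?orbT.
have pfa : pf != a by apply: contraNneq of' => ->; rewrite !inE eqxx ?orbT.
have nefa : ~~ e pf pa.
  by apply: (no_square' ef fa); rewrite // 1?eq_sym // e_sym.
have inf : f \in [:: a; b; c; d; f] by rewrite !inE eqxx ?orbT.
have ina : a \in [:: a; b; c; d; f] by rewrite !inE eqxx.
have inc : c \in [:: a; b; c; d; f] by rewrite !inE eqxx ?orbT.
have inb : b \in [:: a; b; c; d; f] by rewrite !inE eqxx ?orbT.
have [s [s0 sW ips]] := conn_link cW (near_notin fW ef inf)
  (near_notin fW ea ina) nfa nefa fpf fpa.
have sF z : z \in s -> z \in far [:: a; b; c; d; f].
  by move=> /sW; apply: (subsetP fW).
have [x [s' [Es pfx]]] : exists x s', s = x :: s' /\ e pf x.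
  case: s ips s0 {sW sF} => // x s' /and3P[_ /= /andP[/eqP E _] _] _.
  by exists x, s'; rewrite E eqxx.
have pal : e (last pf s) pa.
  have := ipath_path ips.
  by rewrite -cats1 cat_path /= andbT => /andP[].
case: (boolP (has (e pb) s)) => [/hasP[z zs pbz]|/hasPn H].
  have zx : z != x.
    apply: contraTneq pbz => ->; apply: (no_triangle' (y := pf)) => //.
    by rewrite e_sym.
  case/splitPr: zs Es sW sF ips pal => s1 s2 Es sW sF ips pal.
  have s1n : 0 < size s1 by case: s1 Es {sW sF ips pal} => // -[E]; rewrite E eqxx in zx.
  have rotE : [:: b; c; d; f; a] =i [:: a; b; c; d; f].
    exact: (mem_rot 1 [:: a; b; c; d; f]).
  pose W' := [set w in z :: s2].
  have sW' : W' \subset W.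
    by apply/subsetP => w; rewrite inE => ws; apply: sW; rewrite mem_cat ws orbT.
  have ip2 : ipath (z :: s2).
    move: ips; rewrite rcons_cat -cat_cons => /ipath_catr.
    by rewrite -cats1 => /ipath_catl.
  (* One rotation: [pa] and [pb] take over the roles of [pf] and [pa]. The first inner vertex [x] is
     lost, so the set shrinks. *)
  apply: (IH W' b c d f a pb pc pd pf pa).
  - rewrite ltnS in Wn; apply: leq_trans Wn; apply: proper_card.
    apply/properP; split=> //; exists x.
      by apply: sW; case: (s1) s1n Es => // y s1' _ [->] _; rewrite mem_head.
    rewrite inE; have := ipath_uniq ips; rewrite /= rcons_uniq => /and3P[_ _].
    case: (s1) s1n Es => // y s1' _ [->] _.
    by rewrite /= mem_cat negb_or => /andP[/andP[]].
  - exact: pentagon_rot.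
  - exact: conn_path (ipath_path ip2).
  - by rewrite (eq_far rotE); apply: subset_trans sW' fW.
  - by rewrite !rotE; split.
  - by [].
  - exact: (pentagon_rot (pentagon_rot (pentagon_rot P5))).
  - apply: (attachedI (w := last z s2)); first by rewrite in_set mem_last.
    by rewrite e_sym; move: pal; rewrite last_cat.
  - by apply: (attachedI (w := z)); rewrite ?in_set ?mem_head.
have s1 : size s = 1.
  apply: (attached_consecutive_link C5 sF of' oa ob ef ea eb efb ips _ s0).
  by move=> z zs; rewrite e_sym H.
case: s' Es => [|y s'] Es; last by rewrite Es in s1.
rewrite Es /= in pal.
have xpc : x = pc.
  by apply: (common_nbr nfa pfx _ _ eac); rewrite e_sym.
have xW : x \in W by apply: sW; rewrite Es mem_head.
by have [_] := farP fW xW inc; rewrite xpc ec.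
Qed.

(* How a component [D] of the complement of the closed neighbourhood of a
   pentagon can be attached, up to the symmetries of the pentagon. *)
Inductive shape (D : {set T}) (a b c d f : T) : Prop :=
| ShapeEdge of (forall z, z \notin D -> attached z D -> dom [:: a; b] z)
| ShapeDist2 p r of attached p D & attached r D & e p a & e r c & e p r &
    (forall z, z \notin D -> attached z D -> dom [:: p; r] z)
| ShapeTriple p r of attached p D & attached r D & e p f & e r b & e p r &
    (forall z, z \notin D -> attached z D -> [\/ z = p, z = r | e z a]).

Definition meets (D : {set T}) x : bool := [exists z, attached z D && e z x].

Lemma meetsI D z x : attached z D -> e z x -> meets D x.
Proof. by move=> zD zx; apply/existsP; exists z; rewrite zD. Qed.

Lemma piece_nbr a b c d f D z : piece [:: a; b; c; d; f] D ->
  z \notin D -> attached z D -> [|| e z a, e z b, e z c, e z d | e z f].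
Proof.
move=> [_ _ fD clD] zD zat; have zC := attached_out fD zat.
case/attachedP: zat => w wD zw; rewrite e_sym in zw.
by have := clD w z wD zw zD; rewrite /dom (negbTE zC) /= orbF.
Qed.

Lemma shape_edge a b c d f D : piece [:: a; b; c; d; f] D ->
  ~~ meets D c -> ~~ meets D d -> ~~ meets D f -> shape D a b c d f.
Proof.
move=> pD nc nd nf; apply: ShapeEdge => z zD zat.
have := piece_nbr pD zD zat; rewrite /dom /=.
case/or4P=> [->|->|zc|/orP[zd|zf]]; rewrite ?orbT //.
- by rewrite (meetsI zat zc) in nc.
- by rewrite (meetsI zat zd) in nd.
- by rewrite (meetsI zat zf) in nf.
Qed.

(** An attachment next to [a] or [c] equals [p] or [r], by uniqueness of common neighbours. As [d]
    is at distance two from [a], and [f] from [c], an attachment there is adjacent to [p] or [r]. *)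
Lemma shape_dist2 a b c d f D :
  pentagon a b c d f -> piece [:: a; b; c; d; f] D ->
  meets D a -> ~~ meets D b -> meets D c -> shape D a b c d f.
Proof.
move=> C5 pD /existsP[p /andP[pat pa]] nb /existsP[r /andP[rat rc]].
have [cD _ fD _] := pD.
have pr := attached_dist2_adj C5 cD fD pa rc pat rat.
have pC := attached_out fD pat; have rC := attached_out fD rat.
have nra : r != a by apply: contraNneq rC => ->; rewrite !inE eqxx.
have npc : p != c by apply: contraNneq pC => ->; rewrite !inE eqxx ?orbT.
apply: (@ShapeDist2 D a b c d f p r pat rat pa rc pr) => z zD zat.
have := piece_nbr pD zD zat; rewrite /dom /= !inE.
have C5c := pentagon_rot (pentagon_rot C5).
have fDr n : D \subset far (rot n [:: a; b; c; d; f]).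
  by rewrite (eq_far (C' := [:: a; b; c; d; f])) //; apply: mem_rot.
case/or4P=> [za|zb|zc|/orP[zd|zf]].
- have zr := attached_dist2_adj C5 cD fD za rc zat rat.
  by rewrite (common_nbr nra (w := z) (y := p)) ?eqxx // e_sym.
- by rewrite (meetsI zat zb) in nb.
- have pz := attached_dist2_adj C5 cD fD pa zc pat zat.
  by rewrite (common_nbr npc (w := z) (y := r)) ?eqxx ?orbT // e_sym.
- have := attached_dist2_adj (pentagon_rot C5c) cD (fDr 3) zd pa zat pat.
  by move=> ->; rewrite ?orbT.
- have := attached_dist2_adj C5c cD (fDr 2) rc zf rat zat.
  by rewrite e_sym => ->; rewrite ?orbT.
Qed.

(** An attachment next to [f] is adjacent to [r] as well, so [p] is the only one; likewise [r] is
    the only one next to [b]. Nothing is said about those next to [a], which makes this the hard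
    shape. *)
Lemma shape_triple a b c d f D :
  pentagon a b c d f -> piece [:: a; b; c; d; f] D ->
  meets D f -> meets D b -> ~~ meets D c -> ~~ meets D d -> shape D a b c d f.
Proof.
move=> C5 pD /existsP[p /andP[pat pf]] /existsP[r /andP[rat rb]] nc nd.
have [cD _ fD _] := pD.
have C5f := pentagon_rot (pentagon_rot (pentagon_rot (pentagon_rot C5))).
have fDr n : D \subset far (rot n [:: a; b; c; d; f]).
  by rewrite (eq_far (C' := [:: a; b; c; d; f])) //; apply: mem_rot.
have pr := attached_dist2_adj C5f cD (fDr 4) pf rb pat rat.
have pC := attached_out fD pat; have rC := attached_out fD rat.
have nrf : r != f by apply: contraNneq rC => ->; rewrite !inE eqxx ?orbT.
have npb : p != b by apply: contraNneq pC => ->; rewrite !inE eqxx ?orbT.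
apply: (@ShapeTriple D a b c d f p r pat rat pf rb pr) => z zD zat.
have := piece_nbr pD zD zat.
case/or4P=> [za|zb|zc|/orP[zd|zf]].
- exact: Or33.
- have pz := attached_dist2_adj C5f cD (fDr 4) pf zb pat zat.
  by apply: Or32; apply: (common_nbr npb); rewrite // e_sym.
- by rewrite (meetsI zat zc) in nc.
- by rewrite (meetsI zat zd) in nd.
- have zr := attached_dist2_adj C5f cD (fDr 4) zf rb zat rat.
  by apply: Or31; apply: (common_nbr nrf); rewrite // e_sym.
Qed.

Lemma meets_all_false a b c d f D :
  pentagon a b c d f -> piece [:: a; b; c; d; f] D ->
  [/\ meets D a, meets D b, meets D c, meets D d & meets D f] -> False.
Proof.
move=> C5 [cD _ fD _].
case=> /existsP[pa /andP[aA aa]] /existsP[pb /andP[aB bb]].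
move=> /existsP[pc /andP[aC cc]] /existsP[pd /andP[aD dd]] /existsP[pf /andP[aF ff]].
have fDr n : D \subset far (rot n [:: a; b; c; d; f]).
  by rewrite (eq_far (C' := [:: a; b; c; d; f])) //; apply: mem_rot.
have C1 := pentagon_rot C5; have C2 := pentagon_rot C1.
have C3 := pentagon_rot C2; have C4 := pentagon_rot C3.
apply: (@no_five_types #|D|.+1 D a b c d f pa pb pc pd pf) => //.
- by split; apply: attached_out fD _.
- apply: pentagonI.
  + exact: attached_dist2_adj C5 cD fD aa cc aA aC.
  + exact: attached_dist2_adj C2 cD (fDr 2) cc ff aC aF.
  + exact: attached_dist2_adj C4 cD (fDr 4) ff bb aF aB.
  + exact: attached_dist2_adj C1 cD (fDr 1) bb dd aB aD.
  + exact: attached_dist2_adj C3 cD (fDr 3) dd aa aD aA.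
Qed.

(** A proper subset of a 5-cycle lies within an edge, or consists of three consecutive vertices, or
    contains both neighbours of a missing vertex. Each set of vertices that [D] meets is matched
    with one of these after a rotation. *)
Lemma shape_exists a b c d f D :
  pentagon a b c d f -> piece [:: a; b; c; d; f] D ->
  exists a' b' c' d' f', [/\ pentagon a' b' c' d' f',
    [:: a'; b'; c'; d'; f'] =i [:: a; b; c; d; f] & shape D a' b' c' d' f'].
Proof.
move=> C5 pD.
have C1 := pentagon_rot C5; have C2 := pentagon_rot C1.
have C3 := pentagon_rot C2; have C4 := pentagon_rot C3.
have E n := mem_rot n [:: a; b; c; d; f].
have P n : piece (rot n [:: a; b; c; d; f]) D.
  by apply: eq_piece pD => z; rewrite E.
have wrap a' b' c' d' f' : pentagon a' b' c' d' f' ->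
    [:: a'; b'; c'; d'; f'] =i [:: a; b; c; d; f] -> shape D a' b' c' d' f' ->
    exists a' b' c' d' f', [/\ pentagon a' b' c' d' f',
      [:: a'; b'; c'; d'; f'] =i [:: a; b; c; d; f] & shape D a' b' c' d' f'].
  by exists a', b', c', d', f'.
case: (boolP (meets D a)) => ma; case: (boolP (meets D b)) => mb;
case: (boolP (meets D c)) => mc; case: (boolP (meets D d)) => md;
case: (boolP (meets D f)) => mf;
first [ by case: (meets_all_false C5 pD)
      | apply: (wrap _ _ _ _ _ C5 (E 0)); first
        [ by apply: (shape_edge (P 0)) | by apply: (shape_dist2 C5 (P 0))
        | by apply: (shape_triple C5 (P 0))]
      | apply: (wrap _ _ _ _ _ C1 (E 1)); first
        [ by apply: (shape_edge (P 1)) | by apply: (shape_dist2 C1 (P 1))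
        | by apply: (shape_triple C1 (P 1))]
      | apply: (wrap _ _ _ _ _ C2 (E 2)); first
        [ by apply: (shape_edge (P 2)) | by apply: (shape_dist2 C2 (P 2))
        | by apply: (shape_triple C2 (P 2))]
      | apply: (wrap _ _ _ _ _ C3 (E 3)); first
        [ by apply: (shape_edge (P 3)) | by apply: (shape_dist2 C3 (P 3))
        | by apply: (shape_triple C3 (P 3))]
      | apply: (wrap _ _ _ _ _ C4 (E 4)); first
        [ by apply: (shape_edge (P 4)) | by apply: (shape_dist2 C4 (P 4))
        | by apply: (shape_triple C4 (P 4))] ].
Qed.

(** * Cuts around an edge *)

Definition cut (u v : T) (K : {set T}) : Prop :=
  [/\ e u v, piece [:: u; v] K & exists2 o, o \notin K & ~~ dom [:: u; v] o].

Lemma dom2P u v z :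
  reflect [\/ z = u, z = v, e z u | e z v] (dom [:: u; v] z).
Proof.
rewrite /dom /= !inE orbF -orbA.
by apply: (iffP or4P) => [[/eqP|/eqP||]|[->|->|->|->]];
  [constructor 1|constructor 2|constructor 3|constructor 4
  |rewrite eqxx; constructor 1|rewrite eqxx; constructor 2
  |constructor 3|constructor 4].
Qed.

Lemma ndom2P u v z :
  reflect [/\ z != u, z != v, ~~ e z u & ~~ e z v] (~~ dom [:: u; v] z).
Proof. by rewrite /dom /= !inE orbF !negb_or -andbA; apply: and4P. Qed.

Lemma conn_stay K D x : conn K -> x \in K -> x \in D ->
  (forall y z, y \in K -> z \in K -> e y z -> y \in D -> z \in D) ->
  K \subset D.
Proof. by move=> cK xK xD H; apply/subsetP; apply: (conn_ind cK xK xD). Qed.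

(** Otherwise the connected set [D] contains an edge from N(p) to N(r), which closes a square with
    [pr]. *)
Lemma off_edge_exists D p r : e p r -> conn D -> p \notin D -> r \notin D ->
  attached p D -> attached r D -> exists2 v, v \in D & ~~ dom [:: p; r] v.
Proof.
move=> pr cD pD rD /attachedP[x xD px] /attachedP[y yD ry].
case: (boolP [exists v in D, ~~ dom [:: p; r] v]).
  by case/exists_inP => v; exists v.
move=> /exists_inPn H; exfalso.
have npy : ~~ e p y.
  by apply/negP => py; apply: (no_triangle pr ry py).
have [u [v [uD vD uv pu npv]]] := conn_exit cD xD px yD npy.
have rv : e r v.
  have := H v vD; rewrite negbK => /dom2P[E|E|vp|].
  - by rewrite -E vD in pD.
  - by rewrite -E vD in rD.
  - by rewrite e_sym vp in npv.
  - by rewrite e_sym.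
have pv : p != v by apply: contraNneq pD => ->.
have : u = r by apply: (no_square pu uv _ _ pv); rewrite e_sym.
by move=> E; rewrite -E uD in rD.
Qed.

(** If not, an induced path from [p] through [n] and [W] to [q] has at least two inner vertices,
    against [attached_consecutive_link]. *)
Lemma triple_link a b c d f D W p r n q :
  pentagon a b c d f -> D \subset far [:: a; b; c; d; f] ->
  attached p D -> attached r D -> e p f -> e r b -> e p r ->
  conn W -> W \subset D -> W \subset far [:: p; r] ->
  e q a -> attached q W -> n \in D -> e p n -> attached n W -> e q n.
Proof.
move=> C5 fD pat rat pf rb pr cW sWD fW qa qW nD pn nW.
have fWC := subset_trans sWD fD.
have pC := attached_out fD pat; have rC := attached_out fD rat.
have qC := attached_out fWC qW.
have ina : a \in [:: a; b; c; d; f] by rewrite !inE eqxx.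
have qD := near_notin fD qa ina.
have fa : e f a by case/and5P: C5.
have npq : ~~ e p q.
  apply: (no_square' pf fa); rewrite 1?e_sym //.
    by apply: contraNneq pC => ->.
  by apply: contraNneq qC => <-; rewrite !inE eqxx ?orbT.
have npq' : p != q.
  apply: contraTneq qa => <-; apply: no_triangle' pf fa.
rewrite e_sym; apply/negPn/negP => nnq.
have pin : p \in [:: p; r] by rewrite inE eqxx.
have rin : r \in [:: p; r] by rewrite !inE eqxx ?orbT.
have nWn : n \notin W.
  by apply: near_notin fW (_ : e n p) pin; rewrite e_sym.
have nq : n != q by apply: contraNneq qD => <-.
have qnW : q \notin W by apply: near_notin fWC qa ina.
have [s [s0 sW ips]] := conn_link cW nWn qnW nq nnq nW qW.
have ips' : ipath (p :: rcons (n :: s) q).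
  rewrite rcons_cons; apply: ipath_cons => //; first exact: adj_neq.
    rewrite mem_rcons inE negb_or npq' /=; apply/negP => /sW pW.
    by have [/eqP] := farP fW pW pin.
  move=> z; rewrite mem_rcons inE => /predU1P[->//|/sW zW].
  by have [_] := farP fW zW pin; rewrite e_sym.
have : size (n :: s) = 1.
  apply: (attached_consecutive_link C5 _ pC qC rC pf qa rb pr ips') => //.
    by move=> z; rewrite inE => /predU1P[->|/sW/(subsetP sWD)]; apply: (subsetP fD).
  move=> z; rewrite inE => /predU1P[->|/sW zW].
    by apply: (no_triangle' (y := p)); rewrite // e_sym.
  by have [_] := farP fW zW rin.
by case: (s) s0.
Qed.

Lemma pentagon_rev_mem (a b c d f : T) :
  [:: a; f; d; c; b] =i [:: a; b; c; d; f].
Proof.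
move=> z; rewrite !inE; case: (z == a); case: (z == b); case: (z == c);
  case: (z == d); by case: (z == f).
Qed.

(** Suppose such a [q] is attached to [W]. Every other neighbour of [W] lies in [D], is next to [p]
    or [r], and by [triple_link] is next to [q]; by uniqueness of common neighbours there are at
    most two of these and no second [q]. So the boundary of [W] lies in a three-vertex path with
    middle [q]. *)
Lemma triple_inner a b c d f D W p r q :
  pentagon a b c d f -> D \subset far [:: a; b; c; d; f] -> conn D ->
  attached p D -> attached r D -> e p f -> e r b -> e p r ->
  (forall z, z \notin D -> attached z D -> [\/ z = p, z = r | e z a]) ->
  conn W -> W != set0 -> W \subset D -> W \subset far [:: p; r] ->
  (forall u z, u \in W -> e u z -> z \in D -> z \notin W -> dom [:: p; r] z) ->
  e q a -> ~~ attached q W.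
Proof.
move=> C5 fD cD pat rat pf rb pr ND cW /set0Pn[w0 w0W] sWD fW clW qa.
apply/negP => qW.
have fWC := subset_trans sWD fD.
have pC := attached_out fD pat; have rC := attached_out fD rat.
have qC := attached_out fWC qW.
have ina : a \in [:: a; b; c; d; f] by rewrite !inE eqxx.
have inb : b \in [:: a; b; c; d; f] by rewrite !inE eqxx ?orbT.
have ind : d \in [:: a; b; c; d; f] by rewrite !inE eqxx ?orbT.
have inf : f \in [:: a; b; c; d; f] by rewrite !inE eqxx ?orbT.
have pin : p \in [:: p; r] by rewrite inE eqxx.
have rin : r \in [:: p; r] by rewrite !inE eqxx ?orbT.
have qD := near_notin fD qa ina.
have pD := near_notin fD pf inf; have rD := near_notin fD rb inb.
have C5r := pentagon_rev C5.
have revE := pentagon_rev_mem a b c d f.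
have linkp n : n \in D -> e p n -> attached n W -> e q n.
  exact: (triple_link C5 fD pat rat pf rb pr cW sWD fW qa qW).
have linkr n : n \in D -> e r n -> attached n W -> e q n.
  have fD' : D \subset far [:: a; f; d; c; b] by rewrite (eq_far revE).
  have fW' : W \subset far [:: r; p].
    by rewrite (eq_far (C' := [:: p; r])) // => z; rewrite !inE orbC.
  apply: (triple_link C5r fD' rat pat rb pf _ cW sWD fW' qa qW).
  by rewrite e_sym.
have nbrD n : n \in D -> attached n W -> n \notin W -> (e p n \/ e r n) /\ e q n.
  move=> nD nW nnW; case/attachedP: (nW) => w wW nw.
  have wn : e w n by rewrite e_sym.
  have := clW w n wW wn nD nnW.
  case/dom2P => [E|E|np|nr].
  - by rewrite -E nD in pD.
  - by rewrite -E nD in rD.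
  - by rewrite e_sym in np; split; [left|apply: linkp].
  - by rewrite e_sym in nr; split; [right|apply: linkr].
have [x xD px] := attachedP _ _ pat.
have xW : x \notin W by apply: (near_notin fW (_ : e x p) pin); rewrite e_sym.
have w0D := subsetP sWD _ w0W.
have [u [n [uD nD un uW nW]]] := conn_exit (P := mem W) cD w0D w0W xD xW.
have nWat : attached n W by apply: (attachedI uW); rewrite e_sym.
have [npr qn] := nbrD n nD nWat nW.
have na : a != n.
  by have [/negbTE] := farP fD nD ina; rewrite eq_sym => ->.
have ad : a != d := pentagon_neq C5r.
have nqd : ~~ e q d.
  by apply: (outside_nadj C5r _ qa); rewrite revE.
have inX z u' : u' \in W -> z \notin W -> e u' z ->
    z = q \/ (e p z \/ e r z) /\ e q z.
  move=> u'W zW u'z.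
  have zat : attached z W by apply: (attachedI u'W); rewrite e_sym.
  case: (boolP (z \in D)) => [zD|zD]; first by right; apply: nbrD.
  have zatD : attached z D.
    by apply: (attachedI (subsetP sWD _ u'W)); rewrite e_sym.
  left; case: (ND z zD zatD) => [E|E|za].
  - by have [_] := farP fW u'W pin; rewrite -E u'z.
  - by have [_] := farP fW u'W rin; rewrite -E u'z.
  have [_ zn] : (e p n \/ e r n) /\ e z n.
    split=> //; case: npr => H.
      exact: (triple_link C5 fD pat rat pf rb pr cW sWD fW za zat).
    have fD' : D \subset far [:: a; f; d; c; b] by rewrite (eq_far revE).
    have fW' : W \subset far [:: r; p].
      by rewrite (eq_far (C' := [:: p; r])) // => y; rewrite !inE orbC.
    apply: (triple_link C5r fD' rat pat rb pf _ cW sWD fW' za zat) => //.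
    by rewrite e_sym.
  by apply: (common_nbr na); rewrite // e_sym.
have notW z : e p z \/ e r z -> z \notin W.
  case=> H; first by apply: (near_notin fW (_ : e z p) pin); rewrite e_sym.
  by apply: (near_notin fW (_ : e z r) rin); rewrite e_sym.
have qW' : q \notin W by apply: near_notin fWC qa ina.
have aW : a \notin W by apply/negP => aW; have [/eqP] := farP fWC aW ina.
have dW : d \notin W by apply/negP => dW; have [/eqP] := farP fWC dW ind.
have npa : ~~ e p a by case/and5P: C5 => *; apply: (no_triangle' pf).
have nra : ~~ e r a.
  by case/and5P: C5 => ? *; apply: (no_triangle' rb); rewrite e_sym.
have dq : d != q by apply: contraNneq qC => <-.
have nq z : e q z -> d != z by move=> qz; apply: contraNneq nqd => ->.
have pq : p != q by apply: contraNneq npa => ->.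
have rq : r != q by apply: contraNneq nra => ->.
have uniq1 y z x' : x' != q -> e x' y -> e q y -> e x' z -> e q z -> y = z.
  by move=> xq; apply: common_nbr.
case: (pickP [pred z | e p z && e q z]) => [x1 /andP[px1 qx1]|nox].
  case: (pickP [pred z | e r z && e q z]) => [y1 /andP[ry1 qy1]|noy].
    apply: (@no_P3_cutset W x1 q y1 w0 d) => //; rewrite ?nq //.
    - by rewrite e_sym.
    - by apply: contraTneq px1 => ->; apply: no_triangle' pr ry1.
    - by apply: notW; left.
    - by apply: notW; right.
    move=> u' z u'W zW u'z; case: (inX z u' u'W zW u'z) => [->|[[pz|rz] qz]].
    - by rewrite eqxx orbT.
    - by rewrite (uniq1 z x1 p) ?eqxx.
    - by rewrite (uniq1 z y1 r) ?eqxx ?orbT.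
  (* With only one of the two common neighbours present, [a] serves as the other end of the path. *)
  apply: (@no_P3_cutset W x1 q a w0 d) => //; rewrite ?nq //.
  - by rewrite e_sym.
  - by apply: contraTneq px1 => ->.
  - by apply: notW; left.
  move=> u' z u'W zW u'z; case: (inX z u' u'W zW u'z) => [->|[[pz|rz] qz]].
  - by rewrite eqxx orbT.
  - by rewrite (uniq1 z x1 p) ?eqxx.
  - by have := noy z; rewrite /= rz qz.
case: (pickP [pred z | e r z && e q z]) => [y1 /andP[ry1 qy1]|noy].
  apply: (@no_P3_cutset W y1 q a w0 d) => //; rewrite ?nq //.
  - by rewrite e_sym.
  - by apply: contraTneq ry1 => ->.
  - by apply: notW; right.
  move=> u' z u'W zW u'z; case: (inX z u' u'W zW u'z) => [->|[[pz|rz] qz]].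
  - by rewrite eqxx orbT.
  - by have := nox z; rewrite /= pz qz.
  - by rewrite (uniq1 z y1 r) ?eqxx.
by case: npr => H; [have := nox n | have := noy n]; rewrite /= H qn.
Qed.

(** The cut is a component of [D] away from [p] and [r]. It stays a component in the whole graph
    because, by the last hypothesis, every neighbour of it outside [D] is close to [pr]. *)
Lemma cut_inside p r D o : e p r -> conn D -> p \notin D -> r \notin D ->
  attached p D -> attached r D -> o \notin D -> ~~ dom [:: p; r] o ->
  (forall W z, conn W -> W != set0 -> W \subset D -> W \subset far [:: p; r] ->
    (forall u y, u \in W -> e u y -> y \in D -> y \notin W -> dom [:: p; r] y) ->
    z \notin D -> attached z D -> attached z W -> dom [:: p; r] z) ->
  exists K, cut p r K /\ K \subset D.
Proof.
move=> pr cD pD rD pat rat oD no H.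
have [v vD nv] := off_edge_exists pr cD pD rD pat rat.
pose S := D :&: far [:: p; r].
have vS : v \in S by rewrite !inE vD.
pose W := component S v.
have sWS w : w \in W -> (w \in D) && (w \in far [:: p; r]).
  by move/(component_sub vS); rewrite inE.
have sWD : W \subset D by apply/subsetP => w /sWS/andP[].
have fW : W \subset far [:: p; r] by apply/subsetP => w /sWS/andP[].
have cW : conn W := component_conn vS.
have W0 : W != set0 by apply/set0Pn; exists v; apply: component_id.
have clW u y : u \in W -> e u y -> y \in D -> y \notin W -> dom [:: p; r] y.
  move=> uW uy yD; apply: contraR => ny; apply: (component_closed vS uW uy).
  by rewrite !inE yD.
exists W; split=> //; split=> //; last first.
  by exists o => //; apply: contra oD => /(subsetP sWD).
split=> // u z uW uz zW; case: (boolP (z \in D)) => zD; first exact: clW uW uz zD zW.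
apply: (H W z) => //.
  by apply: (attachedI (subsetP sWD _ uW)); rewrite e_sym.
by apply: (attachedI uW); rewrite e_sym.
Qed.

Lemma pentagon_nadj a b c d f : pentagon a b c d f -> ~~ e a c.
Proof. by case/and5P => ab bc _ _ _; apply: no_triangle' ab bc. Qed.

Lemma pentagon_far_edge a b c d f : pentagon a b c d f -> ~~ dom [:: a; b] d.
Proof.
move=> C5; have C1 := pentagon_rot C5; have C3 := pentagon_rot (pentagon_rot C1).
apply/ndom2P; split.
- exact: pentagon_neq C3.
- by rewrite eq_sym; apply: pentagon_neq C1.
- exact: pentagon_nadj C3.
- by rewrite e_sym; apply: pentagon_nadj C1.
Qed.

Lemma piece_contains_cut a b c d f D :
  pentagon a b c d f -> piece [:: a; b; c; d; f] D ->
  exists u v K, cut u v K /\ K \subset D.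
Proof.
move=> C50 pD0; have [a1 [b1 [c1 [d1 [f1 [C5 E sh]]]]]] := shape_exists C50 pD0.
have {pD0} : piece [:: a1; b1; c1; d1; f1] D.
  by apply: eq_piece pD0 => z; rewrite E.
move: C5 sh; move: a1 b1 c1 d1 f1 {a b c d f C50 E} => a b c d f C5 sh pD.
have [cD nD fD clD] := pD.
case/and5P: (C5) => ab bc cd df fa.
have outD x : x \in [:: a; b; c; d; f] -> x \notin D.
  by move=> xC; apply/negP => xD; have [/eqP] := farP fD xD xC.
have ina : a \in [:: a; b; c; d; f] by rewrite !inE eqxx.
have inb : b \in [:: a; b; c; d; f] by rewrite !inE eqxx ?orbT.
have inc : c \in [:: a; b; c; d; f] by rewrite !inE eqxx ?orbT.
have ind : d \in [:: a; b; c; d; f] by rewrite !inE eqxx ?orbT.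
have inf : f \in [:: a; b; c; d; f] by rewrite !inE eqxx ?orbT.
case: sh => [H|p r pat rat pa rc pr H|p r pat rat pf rb pr H].
(* Attachments over a pentagon edge make [D] itself a cut, with the opposite vertex [d] on the other
   side. The other two shapes use the edge [pr]. *)
- exists a, b, D; split=> //; split=> //; last first.
    by exists d; [apply: outD|apply: pentagon_far_edge C5].
  split=> //.
    apply/subsetP => w wD; rewrite inE; apply/ndom2P.
    by have [? ?] := farP fD wD ina; have [? ?] := farP fD wD inb.
  move=> u z uD uz zD; apply: H => //; apply: (attachedI uD).
  by rewrite e_sym.
- have pC := attached_out fD pat; have rC := attached_out fD rat.
  exists p, r; apply: (cut_inside pr cD _ _ pat rat (outD b inb)).
  + exact: near_notin fD pa ina.
  + exact: near_notin fD rc inc.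
  + apply/ndom2P; split.
    * by apply: contraNneq pC => <-.
    * by apply: contraNneq rC => <-.
    * by rewrite e_sym; apply: no_triangle' pa ab.
    * by apply: (no_triangle' bc); rewrite e_sym.
  + by move=> W z _ _ _ _ _ zD zat _; apply: H.
- have pC := attached_out fD pat; have rC := attached_out fD rat.
  exists p, r; apply: (cut_inside pr cD _ _ pat rat (outD a ina)).
  + exact: near_notin fD pf inf.
  + exact: near_notin fD rb inb.
  + apply/ndom2P; split.
    * by apply: contraNneq pC => <-.
    * by apply: contraNneq rC => <-.
    * by rewrite e_sym; apply: no_triangle' pf fa.
    * by apply: (no_triangle' ab); rewrite e_sym.
  + move=> W z cW W0 sWD fW clW zD zatD zatW; apply/dom2P.
    case: (H z zD zatD) => [->|->|za]; [by constructor 1|by constructor 2|].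
    have := triple_inner C5 fD cD pat rat pf rb pr H cW W0 sWD fW clW za.
    by rewrite zatW.
Qed.

(** * Smaller cuts on the near side of a pentagon inside a cut *)

Lemma cut_outside C u v K D p r x y o :
  cut u v K -> {subset C <= K} -> piece C D -> u \in D -> v \in D ->
  e p r -> (forall z, z \notin D -> attached z D -> dom [:: p; r] z) ->
  x \in C -> ~~ dom [:: p; r] x -> y \in C -> dom [:: p; r] y ->
  o \in D -> ~~ dom [:: p; r] o ->
  exists K', cut p r K' /\ #|K'| < #|K|.
Proof.
move=> [uv pK _] sCK pD uD vD pr ND xC nx yC ny oD no.
have [cK _ fK clK] := pK; have [cD _ fD clD] := pD.
have outD z : z \in C -> z \notin D.
  by move=> zC; apply/negP => zD; have [/eqP] := farP fD zD zC.
(* [J] cannot enter [D], whose attachments are all close to [pr]. It cannot leave [K] either: the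
   first vertex outside would be next to [u] or [v], hence attached to [D]. The vertex [y] of [K] is
   lost. *)
have pJ := piece_component nx; set J := component _ x in pJ.
have [cJ _ fJ _] := pJ.
have xJ : x \in J := component_id _ _.
have JD z : z \in J -> z \notin D.
  apply: (conn_ind (P := fun z => z \notin D) cJ xJ (outD x xC)) => s t sJ tJ st sD.
  apply: contraL (subsetP fJ s sJ) => tD; rewrite inE negbK; apply: ND => //.
  exact: attachedI tD st.
have JK : J \subset K.
  apply: (conn_stay cJ xJ (sCK x xC)) => s t sJ tJ st sK.
  apply: contraTT (subsetP fJ t tJ) => tK; rewrite inE negbK.
  have tD := JD t tJ; apply: ND => //.
  have /dom2P[E|E|tu|tv] := clK s t sK st tK.
  - by rewrite E uD in tD.
  - by rewrite E vD in tD.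
  - exact: attachedI uD tu.
  - exact: attachedI vD tv.
exists J; split.
  by split=> //; exists o => //; apply/negP => /JD; rewrite oD.
apply: proper_card; apply/properP; split=> //; exists y; first exact: sCK.
by apply/negP => /(subsetP fJ); rewrite inE ny.
Qed.

(** Attachments next to [a] may be far from [pr], so the component [J] of [c] can leave [K]. The
    proof shows that it gains at most one vertex outside [K], while [K] loses two. *)
Lemma cut_outside_triple a b c d f u v K D p r :
  pentagon a b c d f -> cut u v K -> {subset [:: a; b; c; d; f] <= K} ->
  piece [:: a; b; c; d; f] D -> u \in D -> v \in D ->
  attached p D -> attached r D -> e p f -> e r b -> e p r ->
  (forall z, z \notin D -> attached z D -> [\/ z = p, z = r | e z a]) ->
  exists K', cut p r K' /\ #|K'| < #|K|.
Proof.
move=> C5 [uv pK _] sCK pD uD vD pat rat pf rb pr ND.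
have [cK _ fK clK] := pK; have [cD _ fD clD] := pD.
have [ab bc cd df fa] := and5P C5.
have ina : a \in [:: a; b; c; d; f] by rewrite !inE eqxx.
have inb : b \in [:: a; b; c; d; f] by rewrite !inE eqxx ?orbT.
have inc : c \in [:: a; b; c; d; f] by rewrite !inE eqxx ?orbT.
have inf : f \in [:: a; b; c; d; f] by rewrite !inE eqxx ?orbT.
have pin : p \in [:: p; r] by rewrite inE eqxx.
have rin : r \in [:: p; r] by rewrite !inE eqxx ?orbT.
have outD z : z \in [:: a; b; c; d; f] -> z \notin D.
  by move=> zC; apply/negP => zD; have [/eqP] := farP fD zD zC.
have pC := attached_out fD pat; have rC := attached_out fD rat.
have pD' := near_notin fD pf inf; have rD := near_notin fD rb inb.
have aD := outD a ina.
have [o oD no] := off_edge_exists pr cD pD' rD pat rat.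
have inner z y : z \notin D -> attached z D -> e z a -> y \in D -> e z y ->
    dom [:: p; r] y.
  move=> zD zat za yD zy; apply/negPn/negP => ny.
  pose S := D :&: far [:: p; r].
  have yS : y \in S by rewrite !inE yD.
  have sWS w : w \in component S y -> (w \in D) && (w \in far [:: p; r]).
    by move/(component_sub yS); rewrite inE.
  have := triple_inner C5 fD cD pat rat pf rb pr ND (component_conn yS).
  move=> /(_ z) H; have : ~~ attached z (component S y).
    apply: H => //.
    - by apply/set0Pn; exists y; apply: component_id.
    - by apply/subsetP => w /sWS/andP[].
    - by apply/subsetP => w /sWS/andP[].
    move=> s t sW st tD; apply: contraR => nt.
    by apply: (component_closed yS sW st); rewrite !inE tD.
  by move/negP; apply; apply: attachedI (component_id S y) zy.
have nc : ~~ dom [:: p; r] c.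
  apply/ndom2P; split.
  - by apply: contraNneq pC => <-.
  - by apply: contraNneq rC => <-.
  - apply: (no_square' cd df); rewrite 1?e_sym //.
      exact: pentagon_neq (pentagon_rot (pentagon_rot C5)).
    by apply: contraNneq pC => <-; rewrite !inE eqxx ?orbT.
  - by apply: (no_triangle' (y := b)); rewrite e_sym.
have pJ := piece_component nc; set J := component _ c in pJ.
have [cJ _ fJ _] := pJ; have cinJ : c \in J := component_id _ _.
have JD z : z \in J -> z \notin D.
  apply: (conn_ind (P := fun z => z \notin D) cJ cinJ (outD c inc)).
  move=> s t sJ tJ st sD; apply: contraL (subsetP fJ t tJ) => tD.
  rewrite inE negbK; have sat : attached s D := attachedI tD st.
  case: (ND s sD sat) => [E|E|sa].
  - by have [/eqP] := farP fJ sJ pin.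
  - by have [/eqP] := farP fJ sJ rin.
  - exact: inner sD sat sa tD st.
have nbr z : z \notin D -> dom [:: u; v] z -> attached z D.
  move=> zD /dom2P[E|E|zu|zv].
  - by rewrite E uD in zD.
  - by rewrite E vD in zD.
  - exact: attachedI uD zu.
  - exact: attachedI vD zv.
have inK z x : ~~ dom [:: u; v] z -> x \in [:: a; b; c; d; f] -> e z x -> z \in K.
  move=> nz xC zx; apply: contraR nz => zK.
  by apply: (clK x z (sCK x xC) _ zK); rewrite e_sym.
have attK z : z \notin D -> attached z D -> ~~ dom [:: u; v] z -> z \in K.
  move=> zD zat nz; case: (ND z zD zat) => [E|E|za].
  - by apply: (inK z f nz inf); rewrite E.
  - by apply: (inK z b nz inb); rewrite E.
  - exact: inK ina za.
have npa : ~~ e p a := no_triangle' pf fa.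
have nra : ~~ e r a by apply: (no_triangle' (y := b)); rewrite // e_sym.
(* Meant for [p0], [r0] being [p], [r] in either order, [x0] the end of [uv] next to [p0], and [g],
   [h] their pentagon neighbours. The last hypothesis confines the vertices outside [D] near [uv] to
   [p0] and common neighbours of [a] and [x0]. *)
have fin p0 r0 x0 g h : p0 \in [:: p; r] -> r0 \in [:: p; r] -> x0 \in D ->
    g \in [:: a; b; c; d; f] -> e p0 g -> c != g ->
    h \in [:: a; b; c; d; f] -> e r0 h -> ~~ dom [:: u; v] r0 ->
    (forall z, z \notin D -> dom [:: u; v] z ->
      [/\ e p0 x0, x0 \in [:: u; v] & z = p0 \/ e z a /\ e z x0]) ->
    exists K', cut p r K' /\ #|K'| < #|K|.
  move=> p0in r0in x0D gC p0g cg hC r0h nr0 Hz.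
  have p0C : p0 \notin [:: a; b; c; d; f].
    by move: p0in; rewrite in_cons mem_seq1 => /orP[]/eqP->.
  have np0a : ~~ e p0 a.
    by move: p0in; rewrite in_cons mem_seq1 => /orP[]/eqP->.
  have ax0 : a != x0 by apply: contraNneq aD => ->.
  (* Another component [L] around [uv] would have its boundary in [p0] and at most one common
     neighbour [q] of [a] and [x0]. It is then cut off by the path [p0], [x0], [q], or by [x0],
     [p0], [g] if there is no [q]; for an empty boundary [a], [b], [c] will do. *)
  have claim z : z \in J -> z \notin K -> dom [:: u; v] z.
    move=> zJ zK; apply/negPn/negP => nz.
    have pL := piece_component nz; set L := component _ z in pL.
    have [cL _ fL clL] := pL; have zL : z \in L := component_id _ _.
    have LK y : y \in L -> y \notin K.
      move=> yL; apply: contra zK => yK.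
      exact: subsetP (piece_absorb pK cL fL yL yK) z zL.
    have Ln y : y \in L -> ~~ dom [:: u; v] y.
      by move=> /(subsetP fL); rewrite inE.
    have LD y : y \in L -> y \notin D.
      apply: (conn_ind (P := fun y => y \notin D) cL zL (JD z zJ)) => s t sL tL st sD.
      apply/negP => tD; have := LK s sL; rewrite (attK s) ?Ln //.
      exact: attachedI tD st.
    have bd s t : s \in L -> t \notin L -> e s t -> t \notin D /\ dom [:: u; v] t.
      move=> sL tL st; split; last exact: clL sL st tL.
      apply/negP => tD; have := LK s sL; rewrite (attK s) ?Ln ?LD //.
      exact: attachedI tD st.
    have CL x : x \in [:: a; b; c; d; f] -> x \notin L.
      by move=> xC; apply/negP => /LK; rewrite sCK.
    case: (boolP [exists s in L, exists t, (t \notin L) && e s t]); last first.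
      move=> /exists_inPn nb.
      apply: (@no_P3_cutset L a b c z d) => //; rewrite ?CL // ?inE ?eqxx ?orbT //.
      - exact: pentagon_neq C5.
      - by rewrite eq_sym; apply: pentagon_neq (pentagon_rev C5).
      - by rewrite eq_sym; apply: pentagon_neq (pentagon_rot C5).
      - by rewrite eq_sym; apply: adj_neq.
      move=> s t sL tL st; case/negP: (nb s sL); apply/existsP; exists t.
      by rewrite tL.
    move=> /exists_inP[s sL /existsP[t /andP[tL st]]].
    have [tD dt] := bd s t sL tL st; have [p0x0 x0in _] := Hz t tD dt.
    have x0n y : e y x0 -> y \notin L by move=> yx0; apply: near_notin fL yx0 x0in.
    have x0L : x0 \notin L by apply/negP => /LD; rewrite x0D.
    have cp0 : c != p0 by apply: contraNneq p0C => <-.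
    have cx0 : c != x0 by apply: contraNneq (outD c inc) => ->.
    have p0L := x0n p0 p0x0; have cL' := CL c inc; have gL := CL g gC.
    case: (pickP [pred q | [&& q \notin D, e q a & e q x0]]) => [q /and3P[qD qa qx0]|noq].
      have qC := attached_out fD (attachedI x0D qx0).
      have qL := x0n q qx0.
      apply: (@no_P3_cutset L p0 x0 q z c) => //.
      - by rewrite e_sym.
      - by apply: contraNneq np0a => ->.
      - by apply: contraNneq qC => <-.
      move=> s' t' sL' tL' st'; have [tD' dt'] := bd s' t' sL' tL' st'.
      have [_ _ [->|[ta tx]]] := Hz t' tD' dt'; first by rewrite eqxx.
      by rewrite (common_nbr ax0 (y := t') (w := q)) ?eqxx ?orbT // e_sym.
    apply: (@no_P3_cutset L x0 p0 g z c) => //.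
    - by rewrite e_sym.
    - by apply: contraNneq (outD g gC) => <-.
    move=> s' t' sL' tL' st'; have [tD' dt'] := bd s' t' sL' tL' st'.
    have [_ _ [->|[ta tx]]] := Hz t' tD' dt'; first by rewrite eqxx orbT.
    by have := noq t'; rewrite /= tD' ta tx.
  exists J; split; first by split=> //; exists o => //; apply/negP => /JD; rewrite oD.
  have r0K : r0 \in K := inK r0 h nr0 hC r0h.
  have hK := sCK h hC.
  have r0J : r0 \notin J by apply/negP => /(farP fJ)/(_ r0in)[/eqP].
  have hJ : h \notin J by apply: near_notin fJ (_ : e h r0) r0in; rewrite e_sym.
  have hr : h != r0 by rewrite eq_sym adj_neq.
  have sub z : z \in J -> z \notin K -> e z a /\ e z x0.
    move=> zJ zK; have [_ _ [E|//]] := Hz z (JD z zJ) (claim z zJ zK).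
    by have [/eqP] := farP fJ zJ p0in.
  (* [r0] and its neighbour [h] are in [K] but not in [J]; outside [K], [J] has at most the one
     common neighbour of [a] and [x0]. *)
  have cK2 : #|K| = #|K :\ r0 :\ h|.+2.
    by rewrite (cardsD1 r0) r0K (cardsD1 h (K :\ r0)) !inE hr hK.
  rewrite cK2.
  case: (pickP [pred q | (q \in J) && (q \notin K)]) => [q /andP[qJ qK]|noq].
    rewrite (cardsD1 q) qJ add1n !ltnS; apply: subset_leq_card.
    apply/subsetP => z; rewrite in_setD1 => /andP[zq zJ]; rewrite !inE.
    have -> : z != h by apply: contraTneq zJ => ->.
    have -> : z != r0 by apply: contraTneq zJ => ->.
    apply/negPn/negP => zK; case/eqP: zq.
    have [qa qx] := sub q qJ qK; have [za zx] := sub z zJ zK.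
    by apply: (common_nbr ax0); rewrite // e_sym.
  apply: leq_trans (_ : #|K :\ r0 :\ h| < _) => //; rewrite ltnS.
  apply: subset_leq_card; apply/subsetP => z zJ; rewrite !inE.
  have -> : z != h by apply: contraTneq zJ => ->.
  have -> : z != r0 by apply: contraTneq zJ => ->.
  by have := noq z; rewrite /= zJ /= => /negbFE.
have cf : c != f := pentagon_neq (pentagon_rot (pentagon_rot C5)).
have cb : c != b by rewrite eq_sym adj_neq.
(* Provides the hypotheses of [fin] when [p0] is next to [x0]. An attachment next to [a] and [y0]
   would by [inner] put [y0] next to [p0] or [r0], closing a triangle or a square. *)
have side p0 r0 x0 y0 : p0 \notin D -> r0 \notin D -> e p0 r0 ->
    x0 \in D -> y0 \in D -> e x0 y0 -> e p0 x0 ->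
    (forall z, dom [:: u; v] z -> dom [:: x0; y0] z) ->
    (forall z, dom [:: p; r] z -> dom [:: p0; r0] z) ->
    (forall z, z \notin D -> attached z D -> [\/ z = p0, z = r0 | e z a]) ->
    ~~ dom [:: u; v] r0 /\
    (forall z, z \notin D -> dom [:: u; v] z -> z = p0 \/ e z a /\ e z x0).
  move=> p0D r0D pr0 x0D y0D xy px Duv Dpr ND0.
  have nry : ~~ e r0 y0.
    apply/negP => ry; have E : x0 = r0.
      apply: (no_square px xy); rewrite 1?e_sym //.
      by apply: contraNneq p0D => ->.
    by rewrite -E x0D in r0D.
  have nrx : ~~ e r0 x0 by apply: (no_triangle' (y := p0)); rewrite // e_sym.
  have nr : ~~ dom [:: u; v] r0.
    apply/negP => /Duv/dom2P[E|E|rx|ry].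
    - by rewrite E x0D in r0D.
    - by rewrite E y0D in r0D.
    - by rewrite rx in nrx.
    - by rewrite ry in nry.
  split=> // z zD dz.
  case: (ND0 z zD (nbr z zD dz)) => [->|E|za]; [by left|by rewrite -E dz in nr|].
  right; split=> //; case/dom2P: (Duv z dz) => [E|E|//|zy].
  - by rewrite E x0D in zD.
  - by rewrite E y0D in zD.
  case/dom2P: (Dpr y0 (inner z y0 zD (nbr z zD dz) za y0D zy)) => [E|E|yp|yr].
  - by rewrite -E y0D in p0D.
  - by rewrite -E y0D in r0D.
  - by case/negP: (no_triangle' px xy); rewrite e_sym.
  - by rewrite e_sym yr in nry.
have domC x y z : dom [:: x; y] z -> dom [:: y; x] z.
  by rewrite (eq_dom (C' := [:: y; x])) // => w; rewrite !inE orbC.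
have NDr z : z \notin D -> attached z D -> [\/ z = r, z = p | e z a].
  by move=> zD zat; case: (ND z zD zat); [constructor 2|constructor 1|constructor 3].
have rp : e r p by rewrite e_sym.
have vu : e v u by rewrite e_sym.
have uin : u \in [:: u; v] by rewrite inE eqxx.
have vin : v \in [:: u; v] by rewrite !inE eqxx orbT.
case: (boolP (e p u)) => pu.
  have [nr H] := side p r u v pD' rD pr uD vD uv pu (fun z => id) (fun z => id) ND.
  by apply: (fin p r u f b) => // z zD /(H z zD).
case: (boolP (e p v)) => pv.
  have [nr H] := side p r v u pD' rD pr vD uD vu pv (domC u v) (fun z => id) ND.
  by apply: (fin p r v f b) => // z zD /(H z zD).
case: (boolP (e r u)) => ru.
  have [nr H] := side r p u v rD pD' rp uD vD uv ru (fun z => id) (domC p r) NDr.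
  by apply: (fin r p u b f) => // z zD /(H z zD).
case: (boolP (e r v)) => rv.
  have [nr H] := side r p v u rD pD' rp vD uD vu rv (domC u v) (domC p r) NDr.
  by apply: (fin r p v b f) => // z zD /(H z zD).
have nu y : y \in D -> ~~ e p y -> ~~ e r y -> ~~ dom [:: p; r] y.
  move=> yD py ry; apply/ndom2P; split; rewrite 1?e_sym //.
  - by apply: contraNneq pD' => <-.
  - by apply: contraNneq rD => <-.
have nr : ~~ dom [:: u; v] r.
  apply/ndom2P; split=> //.
  - by apply: contraNneq rD => ->.
  - by apply: contraNneq rD => ->.
(* Neither [p] nor [r] is next to [u] or [v]; then no vertex outside [D] is, and the last hypothesis
   of [fin] holds vacuously. *)
apply: (fin p r u f b) => // z zD dz; exfalso.
have zat := nbr z zD dz.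
case: (ND z zD zat) => [E|E|za].
- rewrite {}E in dz; case/dom2P: dz => [E|E|H|H].
  + by rewrite E uD in pD'.
  + by rewrite E vD in pD'.
  + by rewrite H in pu.
  + by rewrite H in pv.
- by rewrite -E dz in nr.
case/dom2P: dz => [E|E|zu|zv].
- by rewrite E uD in zD.
- by rewrite E vD in zD.
- by have := nu u uD pu ru; rewrite (inner z u).
- by have := nu v vD pv rv; rewrite (inner z v).
Qed.

(** [K] is away from [u] and [v], so both lie in one component [D] behind the pentagon. The shape of
    its attachments supplies the edge of the new cut, which is taken on the side of the pentagon. *)
Lemma cut_with_pentagon_not_minimal a b c d f u v K :
  cut u v K -> pentagon a b c d f -> {subset [:: a; b; c; d; f] <= K} ->
  exists u' v' K', cut u' v' K' /\ #|K'| < #|K|.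
Proof.
move=> cutK C50 sCK0; have [uv pK _] := cutK; have [cK _ fK clK] := pK.
have far0 x : x \in [:: u; v] -> ~~ dom [:: a; b; c; d; f] x.
  move=> xin; rewrite negb_or; apply/andP; split.
    by apply/negP => /sCK0 xK; have [/eqP] := farP fK xK xin.
  apply/hasPn => y /sCK0 yK; rewrite e_sym.
  by have [] := farP fK yK xin.
have uin : u \in [:: u; v] by rewrite inE eqxx.
have vin : v \in [:: u; v] by rewrite !inE eqxx orbT.
have pD0 := piece_component (far0 u uin); set D := component _ u in pD0.
have uD : u \in D := component_id _ _.
have vD : v \in D.
  have uF : u \in far [:: a; b; c; d; f] by rewrite inE far0.
  by apply: (component_closed uF uD uv); rewrite inE far0.
have [a1 [b1 [c1 [d1 [f1 [C5 E sh]]]]]] := shape_exists C50 pD0.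
have {pD0} : piece [:: a1; b1; c1; d1; f1] D.
  by apply: eq_piece pD0 => z; rewrite E.
have : {subset [:: a1; b1; c1; d1; f1] <= K} by move=> z; rewrite E; apply: sCK0.
move: C5 sh; move: a1 b1 c1 d1 f1 {far0 C50 E sCK0} D uD vD.
move=> {a b c d f} a b c d f D uD vD C5 sh sCK pD.
have [cD nD fD clD] := pD.
case/and5P: (C5) => ab bc cd df fa.
have ina : a \in [:: a; b; c; d; f] by rewrite !inE eqxx.
have inb : b \in [:: a; b; c; d; f] by rewrite !inE eqxx ?orbT.
have inc : c \in [:: a; b; c; d; f] by rewrite !inE eqxx ?orbT.
have ind : d \in [:: a; b; c; d; f] by rewrite !inE eqxx ?orbT.
case: sh => [H|p r pat rat pa rc pr H|p r pat rat pf rb pr H].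
- exists a, b.
  apply: (cut_outside cutK sCK pD uD vD ab H ind _ ina _ uD).
  + exact: pentagon_far_edge C5.
  + by apply/dom2P; constructor 1.
  + apply/ndom2P.
    by have [? ?] := farP fD uD ina; have [? ?] := farP fD uD inb.
- have pC := attached_out fD pat; have rC := attached_out fD rat.
  have [o oD no] := off_edge_exists pr cD (near_notin fD pa ina)
    (near_notin fD rc inc) pat rat.
  exists p, r; apply: (cut_outside cutK sCK pD uD vD pr H inb _ ina _ oD no).
  + apply/ndom2P; split.
    * by apply: contraNneq pC => <-.
    * by apply: contraNneq rC => <-.
    * by rewrite e_sym; apply: no_triangle' pa ab.
    * by apply: (no_triangle' bc); rewrite e_sym.
  + by apply/dom2P; constructor 3; rewrite e_sym.
- exists p, r.
  exact: (cut_outside_triple C5 cutK sCK pD uD vD pat rat pf rb pr H).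
Qed.

(** * Minimal cuts *)

Definition min_cut a b K : Prop :=
  cut a b K /\ forall u v K', cut u v K' -> #|K| <= #|K'|.

Lemma min_cut_sym a b K : min_cut a b K -> min_cut b a K.
Proof.
move=> [[ab pK [o oK no]] mK]; split=> //.
have E : [:: a; b] =i [:: b; a] by move=> z; rewrite !inE orbC.
split; first by rewrite e_sym.
  exact: eq_piece pK.
by exists o; rewrite // -(eq_dom o E).
Qed.

Lemma min_cut_far a b K k : min_cut a b K -> k \in K ->
  [/\ k != a, ~~ e k a, k != b & ~~ e k b].
Proof.
move=> [[_ [_ _ fK _] _] _] kK.
have [? ?] := farP fK kK (mem_head a _).
have [? ?] : k != b /\ ~~ e k b by apply: (farP fK kK); rewrite !inE eqxx orbT.
by [].
Qed.

Lemma min_cut_nbr a b K k z : min_cut a b K -> k \in K -> e k z -> z \notin K ->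
  e z a \/ e z b.
Proof.
move=> mK kK kz zK; have [_ na _ nb] := min_cut_far mK kK.
case: mK => -[_ [_ _ _ clK] _] _.
case/dom2P: (clK k z kK kz zK) => [E|E||]; [| |by left|by right].
  by rewrite -E kz in na.
by rewrite -E kz in nb.
Qed.

Lemma min_cut_notin a b K z : min_cut a b K -> e z a \/ e z b -> z \notin K.
Proof.
move=> mK zab; apply/negP => zK.
by have [_ /negP na _ /negP nb] := min_cut_far mK zK; case: zab.
Qed.

Lemma min_cut_bipartite a b K : min_cut a b K ->
  exists s : T -> bool, {in K &, forall u v, e u v -> s u != s v}.
Proof.
move=> [cK mK]; apply: no_pentagon_bipartite => x y z t w xK yK zK tK wK.
apply/negP => C5.
have [|u [v [K' [cK' lt]]]] := cut_with_pentagon_not_minimal cK C5.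
  by move=> s; rewrite !inE => /or4P[/eqP->|/eqP->|/eqP->|/orP[]/eqP->].
by have := mK u v K' cK'; rewrite leqNgt lt.
Qed.

(* By minimality, a pentagon near [K] leaves over no component inside [K]. *)
Lemma min_cut_escape a b K x1 x2 x3 x4 x5 y v :
  min_cut a b K -> pentagon x1 x2 x3 x4 x5 ->
  y \in K -> dom [:: x1; x2; x3; x4; x5] y ->
  v \in K -> ~~ dom [:: x1; x2; x3; x4; x5] v ->
  exists W z, [/\ conn W, W \subset K, W \subset far [:: x1; x2; x3; x4; x5],
    v \in W & [/\ z \notin K, ~~ dom [:: x1; x2; x3; x4; x5] z & attached z W]].
Proof.
set C := [:: x1; x2; x3; x4; x5] => mK C5 yK dy vK nv.
pose S := K :&: far C.
have vS : v \in S by rewrite !inE vK.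
pose W := component S v.
have sWS w : w \in W -> (w \in K) && (w \in far C).
  by move/(component_sub vS); rewrite inE.
have sWK : W \subset K by apply/subsetP => w /sWS/andP[].
have fW : W \subset far C by apply/subsetP => w /sWS/andP[].
case: (boolP [exists z, [&& z \notin K, ~~ dom C z & attached z W]]).
  move=> /existsP[z /and3P[zK nz zW]]; exists W, z; split=> //.
    exact: component_conn.
  exact: component_id.
move=> /existsPn H; exfalso.
have pW : piece C W.
  split=> //; first exact: component_conn.
    by apply/set0Pn; exists v; apply: component_id.
  move=> u z uW uz zW; apply/negPn/negP => nz.
  case: (boolP (z \in K)) => zK.
    by move: zW; rewrite (component_closed vS uW uz) // !inE zK.
  case/negP: (H z); rewrite zK nz /=; apply: (attachedI uW).
  by rewrite e_sym.
have [u [w [K' [cK' sK']]]] := piece_contains_cut C5 pW.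
have [_ mn] := mK; have := mn u w K' cK'; apply/negP; rewrite -ltnNge.
apply: leq_ltn_trans (subset_leq_card sK') _; apply: proper_card.
apply/properP; split=> //; exists y => //.
by apply/negP => /(subsetP fW); rewrite inE dy.
Qed.

(** * Paths of length two from N(a) to N(b) *)

Lemma two_link_pentagon a b K p q w : min_cut a b K ->
  e p a -> e q b -> w \in K -> e p w -> e q w -> pentagon a p w q b.
Proof.
move=> [[ab _ _] _] pa qb wK pw qw.
by apply: pentagonI; rewrite // e_sym.
Qed.

(** [K] can only be left through neighbours of [a] or [b], which are close to the pentagon
    [a p w q b]; so [min_cut_escape] shows that this pentagon dominates [K]. A second neighbour of
    [x] inside [K] would then close a triangle or a square, and degree three forces one neighbour in
    each of N(a) and N(b). *)
Lemma two_link_nbr a b K p q w x : min_cut a b K ->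
  e p a -> e q b -> w \in K -> e p w -> e q w -> e w x -> x != p -> x != q ->
  exists p' q', [/\ x \in K, e p' a, e q' b, e x p' & e x q'] /\
    (forall z, e x z -> [\/ z = w, z = p' | z = q']).
Proof.
move=> mK pa qb wK pw qw wx xp xq.
have C5 := two_link_pentagon mK pa qb wK pw qw.
have [ab _ _] := mK.1.
have [wna _ wnb _] := min_cut_far mK wK.
have wp : e w p by rewrite e_sym.
have wq : e w q by rewrite e_sym.
have ap : e a p by rewrite e_sym.
have bq : e b q by rewrite e_sym.
have xK : x \in K.
  apply/negPn/negP => xK; case: (min_cut_nbr mK wK wx xK) => H.
    by case/eqP: xp; apply: (common_nbr wna wx _ wp ap); rewrite e_sym.
  by case/eqP: xq; apply: (common_nbr wnb wx _ wq bq); rewrite e_sym.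
have pK : p \notin K by apply: (min_cut_notin mK); left.
have qK : q \notin K by apply: (min_cut_notin mK); right.
have domK z : z \in K -> dom [:: a; p; w; q; b] z.
  move=> zK; apply/negPn/negP => nz.
  have dw : dom [:: a; p; w; q; b] w by rewrite /dom !inE eqxx ?orbT.
  have [W [y [_ sWK _ _ [yK ny /attachedP[u uW yu]]]]]
    := min_cut_escape mK C5 wK dw zK nz.
  have uy : e u y by rewrite e_sym.
  have := min_cut_nbr mK (subsetP sWK u uW) uy yK.
  by case=> H; move: ny; rewrite /dom /= H ?orbT.
have outer z : e x z -> z != w -> e z a \/ e z b.
  move=> xz zw; case: (boolP (z \in K)) => [zK|]; last exact: min_cut_nbr mK xK xz.
  exfalso; have [zna zea znb zeb] := min_cut_far mK zK.
  have zx : e z x by rewrite e_sym.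
  have zne y : y \notin K -> z != y by move=> yK; apply: contraNneq yK => <-.
  have := domK z zK; rewrite /dom /= !inE orbF (negbTE zna) (negbTE znb).
  rewrite (negbTE zea) (negbTE zeb) (negbTE (zne p pK)) (negbTE (zne q qK)).
  rewrite (negbTE zw) /= orbF.
  case/or3P=> H.
  - by case/eqP: zw; apply: (no_square xz H pw wx xp).
  - by apply: (no_triangle xz H); rewrite e_sym.
  - by case/eqP: zw; apply: (no_square xz H qw wx xq).
have ax : a != x by have [? _ _ _] := min_cut_far mK xK; rewrite eq_sym.
have bx : b != x by have [_ _ ? _] := min_cut_far mK xK; rewrite eq_sym.
have same1 z z' : e z a -> e z' a -> e x z -> e x z' -> z = z'.
  by move=> *; apply: (common_nbr ax); rewrite // e_sym.
have same2 z z' : e z b -> e z' b -> e x z -> e x z' -> z = z'.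
  by move=> *; apply: (common_nbr bx); rewrite // e_sym.
have [z1 [xz1 z1w _]] := degree_ge3 x w w.
have [z2 [xz2 z2w z21]] := degree_ge3 x w z1.
have fin p' q' : e x p' -> e x q' -> e p' a -> e q' b ->
   exists p' q', [/\ x \in K, e p' a, e q' b, e x p' & e x q'] /\
    (forall z, e x z -> [\/ z = w, z = p' | z = q']).
  move=> xp' xq' p'a q'b; exists p', q'; split=> // z xz.
  case: (eqVneq z w) => [|zw]; first by constructor 1.
  by case: (outer z xz zw) => H; [constructor 2; apply: same1|constructor 3; apply: same2].
case: (outer z1 xz1 z1w) => h1; case: (outer z2 xz2 z2w) => h2.
- by case/eqP: z21; apply: same1.
- exact: fin xz1 xz2 h1 h2.
- exact: fin xz2 xz1 h2 h1.
- by case/eqP: z21; apply: same2.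
Qed.

(** Both [w] and [x] have degree three. A colouring of the other vertices fails to extend only if it
    forces the same colour [i] on both; Kempe chains then force [i] on [a] and on [b], which are
    adjacent. *)
Lemma no_two_link a b K p q w : min_cut a b K ->
  e p a -> e q b -> w \in K -> e p w -> e q w -> False.
Proof.
move=> mK pa qb wK pw qw.
have [ab _ _] := mK.1.
have [x [wx xp xq]] := degree_ge3 w p q.
have [p' [q' [[xK p'a q'b xp' xq'] Nx]]] := two_link_nbr mK pa qb wK pw qw wx xp xq.
have outA z : e z a -> z \notin K by move=> H; apply: (min_cut_notin mK); left.
have outB z : e z b -> z \notin K by move=> H; apply: (min_cut_notin mK); right.
have neK y z : y \in K -> z \notin K -> y != z by move=> yK; apply: contraNneq => <-.
have Nw z : e w z -> [\/ z = x, z = p | z = q].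
  move=> wz; case: (eqVneq z p) => [|zp]; first by constructor 2.
  case: (eqVneq z q) => [|zq]; first by constructor 3.
  have [p2 [q2 [[zK p2a q2b zp2 zq2] _]]] := two_link_nbr mK pa qb wK pw qw wz zp zq.
  constructor 1; apply/eqP/negPn/negP => zx.
  have [xa _ xb _] := min_cut_far mK xK; have [za _ zb _] := min_cut_far mK zK.
  have [wa _ wb _] := min_cut_far mK wK.
  have q2K := outB q2 q2b; have p'K := outA p' p'a.
  (* Two further neighbours [x] and [z] of [w] would close a walk of length seven over the edge
     [ab]. *)
  apply: (@no_heptagon a p' x w z q2 b); rewrite // 1?e_sym //.
  - by rewrite eq_sym.
  - by rewrite eq_sym neK.
  - by rewrite eq_sym.
  - by rewrite neK.
  - by apply: contraTneq zq2 => ->; have [] := min_cut_far mK zK.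
  - by apply: contraTneq xp' => <-; have [] := min_cut_far mK xK.
have pp' : p != p'.
  apply: contraTneq xp' => <-; rewrite e_sym; apply: (no_triangle' pw wx).
have qq' : q != q'.
  apply: contraTneq xq' => <-; rewrite e_sym; apply: (no_triangle' qw wx).
pose S := ~: [set w; x].
have inS z : z != w -> z != x -> z \in S by rewrite !inE negb_or => -> ->.
have outS z : z \notin K -> z \in S.
  by move=> zK; apply: inS; rewrite eq_sym; apply: neK.
have ext psi i j : colours S psi -> i != j -> i != psi p -> i != psi q ->
    j != psi p' -> j != psi q' -> False.
  move=> cpsi ij ip iq jp jq.
  pose phi z := if z == w then i else if z == x then j else psi z.
  have phiw : phi w = i by rewrite /phi eqxx.
  have phix : phi x = j by rewrite /phi eqxx eq_sym (negbTE (adj_neq wx)).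
  have phiS z : z \in S -> phi z = psi z.
    by rewrite !inE negb_or /phi => /andP[/negbTE-> /negbTE->].
  have hw z : e w z -> i != phi z.
    case/Nw => ->; first by rewrite phix.
      by rewrite phiS // outS // outA.
    by rewrite phiS // outS // outB.
  have hx z : e x z -> j != phi z.
    case/Nx => ->; first by rewrite phiw eq_sym.
      by rewrite phiS // outS // outA.
    by rewrite phiS // outS // outB.
  apply: (not_col (phi := phi)) => y z _ _ yz.
  case: (eqVneq y w) => [E|yw]; first by rewrite E phiw hw // -E.
  case: (eqVneq y x) => [E|yx]; first by rewrite E phix hx // -E.
  case: (eqVneq z w) => [E|zw]; first by rewrite E phiw eq_sym hw // -E e_sym.
  case: (eqVneq z x) => [E|zx]; first by rewrite E phix eq_sym hx // -E e_sym.
  by rewrite !phiS ?inS // cpsi ?inS.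
have [|psi cpsi] := crit (S := S).
  by apply/eqP => /setP/(_ w); rewrite !inE eqxx.
have aS : a \in S.
  by apply: outS; apply/negP => aK; have [/eqP] := min_cut_far mK aK.
have bS : b \in S.
  by apply: outS; apply/negP => bK; have [_ _ /eqP] := min_cut_far mK bK.
have pS : p \in S by rewrite outS // outA.
have p'S : p' \in S by rewrite outS // outA.
have qS : q \in S by rewrite outS // outB.
have q'S : q' \in S by rewrite outS // outB.
have cpa := cpsi p a pS aS pa; have cp'a := cpsi p' a p'S aS p'a.
have cqb := cpsi q b qS bS qb; have cq'b := cpsi q' b q'S bS q'b.
have cab := cpsi a b aS bS ab.
have [i /andP[ip iq]] := third_colour (psi p) (psi q).
have [j /andP[jp jq]] := third_colour (psi p') (psi q').
case: (eqVneq i j) => [E|ij]; last exact: ext cpsi ij ip iq jp jq.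
subst j.
case: (eqVneq (psi p) (psi q)) => [E|pq].
  have [k /andP[kp ki]] := third_colour (psi p) i.
  by apply: (ext psi k i cpsi ki kp _ jp jq); rewrite -E.
case: (eqVneq (psi p') (psi q')) => [E|p'q'].
  have [k /andP[kp ki]] := third_colour (psi p') i.
  by apply: (ext psi i k cpsi _ ip iq kp); [rewrite eq_sym|rewrite -E].
(* a Kempe chain between [q] and [q'] must pass through [b] *)
have chain y y' z z' c : y \in S -> y' \in S -> c \in S -> y != y' ->
    z \in S -> z' \in S ->
    e y w -> e y' x -> e y c -> e y' c ->
    (forall t, e w t -> [\/ t = x, t = y | t = z]) ->
    (forall t, e x t -> [\/ t = w, t = y' | t = z']) ->
    psi y = psi y' -> psi z = psi z' -> psi y != psi z -> i != psi y ->
    i != psi z ->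
    (forall phi, colours S phi -> phi y = i -> phi y' = psi y ->
       phi z = psi z -> phi z' = psi z -> False) -> psi c = i.
  move=> yS y'S cS yy' zS z'S yw y'x yc y'c Nw' Nx' E E' nyz iy iz H.
  have [[phi [cphi HA HB _ H3]]|[v [s [ips ss [/eqP Ev /eqP El] _ od]]]] :=
    kempe (psi y) i (pred1 y) (pred1 y') cpsi.
    have yP : y \in bicoloured S psi (psi y) i by rewrite inE yS eqxx.
    have y'P : y' \in bicoloured S psi (psi y) i by rewrite inE y'S E eqxx.
    have nP t : psi t = psi z -> t \notin bicoloured S psi (psi y) i.
      move=> Et; rewrite inE Et eq_sym (negbTE nyz) eq_sym (negbTE iz).
      by rewrite andbF.
    exfalso; apply: (H phi cphi).
    - by rewrite (HA y yP) ?inE // tpermL.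
    - by rewrite (HB y' y'P) ?inE.
    - by rewrite H3 // nP.
    - by rewrite H3 ?nP.
  subst v; case/lastP: s ips ss El od => [|t l].
    by move=> _ _ /= E2; rewrite E2 eqxx in yy'.
  rewrite last_rcons size_rcons => ips ss El; subst l.
  rewrite E eqxx /= => /negbFE od.
  have tP v : v \in t -> (v \in S) && ((psi v == psi y) || (psi v == i)).
    by move=> vt; have := ss v; rewrite inE mem_rcons inE vt !orbT inE => /(_ isT).
  have [yt y't] : y \notin t /\ y' \notin t.
    have := ipath_uniq ips; rewrite /= mem_rcons inE negb_or rcons_uniq.
    by case/and3P => /andP[_ ->] ->.
  have zt v : psi v = psi z -> v \notin t.
    move=> Ev; apply/negP => /tP/andP[_]; rewrite Ev eq_sym (negbTE nyz).
    by rewrite eq_sym (negbTE iz).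
  have t0 : 0 < size t by case: (t) od.
  have ipw : ipath (y :: rcons [:: w; x] y').
    apply: ipath4; rewrite // 1?e_sym //.
      by move: yS; rewrite !inE negb_or => /andP[].
    by move: y'S; rewrite !inE negb_or eq_sym => /andP[].
  (* The ends have equal colours, so the chain has an odd number of inner vertices; against the two
     vertices [w], [x] it has just one, the common neighbour [c]. *)
  have := theta ips ipw t0 isT; rewrite /= => th.
  have t1 : size t = 1.
    suff : size t + 2 = 3 by clear; lia.
    apply: th; last by rewrite oddD od.
    move=> v v' vt; have := tP v vt; rewrite !inE negb_or => /andP[/andP[vw vx] _].
    case/orP=> /eqP->; rewrite ?vw ?vx /=; apply/negP; rewrite e_sym.
      case/Nw' => Ev; rewrite {}Ev ?eqxx // in vt vx.
        by rewrite vt in yt.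
      by rewrite (negbTE (zt z _)) in vt.
    case/Nx' => Ev; rewrite {}Ev ?eqxx // in vt vw.
      by rewrite vt in y't.
    by rewrite (negbTE (zt z' _)) in vt.
  case: t t1 ips tP {th od ss yt y't zt t0} => // m [|//] _ ips tP.
  have /= /and3P[ym my' _] := ipath_path ips.
  have Em : m = c by apply: (common_nbr yy' ym _ yc y'c); rewrite e_sym.
  have /andP[_ /orP[/eqP F|/eqP]] := tP m (mem_head _ _); last by rewrite Em.
  by have := cpsi y c yS cS yc; rewrite -Em F eqxx.
have ninj k : k != psi p -> k != psi q -> k = i.
  by move=> kp kq; apply: (third_colour_uniq pq).
have EE : (psi p' = psi p /\ psi q' = psi q) \/ (psi p' = psi q /\ psi q' = psi p).
  case: (eqVneq (psi p') (psi p)) => [E|np].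
    left; split=> //; case: (eqVneq (psi q') (psi q)) => // nq.
    have : psi q' = i by apply: ninj; rewrite // -E eq_sym.
    by move=> F; rewrite F eqxx in jq.
  have E : psi p' = psi q.
    case: (eqVneq (psi p') (psi q)) => // nq.
    by have F := ninj _ np nq; rewrite F eqxx in jp.
  right; split=> //; case: (eqVneq (psi q') (psi p)) => // nq.
  have : psi q' = i by apply: ninj; rewrite // -E eq_sym.
  by move=> F; rewrite F eqxx in jq.
(* If the two pairs are coloured crosswise, [a] and [b] each see both colours other than [i]. *)
case: EE => [[Ep Eq]|[Ep Eq]]; last first.
  have ea : psi a = i by apply: ninj; rewrite eq_sym // -Ep.
  have eb : psi b = i by apply: ninj; rewrite eq_sym // -Eq.
  by rewrite ea eb eqxx in cab.
have q'x : e q' x by rewrite e_sym.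
have p'x : e p' x by rewrite e_sym.
have qp : psi q != psi p by rewrite eq_sym.
have eb : psi b = i.
  apply: (chain q q' p p' b qS q'S bS qq' pS p'S qw q'x qb q'b _ _
    (esym Eq) (esym Ep) qp iq ip).
  - by move=> t /Nw[]->; [constructor 1|constructor 3|constructor 2].
  - by move=> t /Nx[]->; [constructor 1|constructor 3|constructor 2].
  move=> phi cphi h1 h2 h3 h4.
  apply: (ext phi (psi q) i cphi); rewrite ?h1 ?h2 ?h3 ?h4 //.
  by rewrite eq_sym.
  by rewrite eq_sym.
have ea : psi a = i.
  apply: (chain p p' q q' a pS p'S aS pp' qS q'S pw p'x pa p'a _ _
    (esym Ep) (esym Eq) pq ip iq).
  - by move=> t /Nw[]->; [constructor 1|constructor 2|constructor 3].
  - by move=> t /Nx[]->; [constructor 1|constructor 2|constructor 3].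
  move=> phi cphi h1 h2 h3 h4.
  apply: (ext phi (psi p) i cphi); rewrite ?h1 ?h2 ?h3 ?h4 //.
  by rewrite eq_sym.
  by rewrite eq_sym.
by rewrite ea eb eqxx in cab.
Qed.

(** * Paths of length three between two vertices of N(a) *)

Section ThreeLink.

Variables (a b : T) (K : {set T}) (p d d' p' : T).
Hypothesis mK : min_cut a b K.
Hypotheses (dK : d \in K) (d'K : d' \in K).
Hypotheses (pd : e p d) (dd' : e d d') (d'p' : e d' p').
Hypotheses (pa : e p a) (p'a : e p' a).

Let C := [:: a; p; d; d'; p'].

Let ab : e a b. Proof. by have [[]] := mK. Qed.

Let C5 : pentagon a p d d' p'.
Proof. by apply: pentagonI; rewrite // e_sym. Qed.

Let outA z : e z a -> z \notin K.
Proof. by move=> H; apply: (min_cut_notin mK); left. Qed.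

Let outB z : e z b -> z \notin K.
Proof. by move=> H; apply: (min_cut_notin mK); right. Qed.

Let neK y z : y \in K -> z \notin K -> y != z.
Proof. by move=> yK; apply: contraNneq => <-. Qed.

Let two_link z w q : e z a -> e q b -> w \in K -> e z w -> ~~ e q w.
Proof. by move=> za qb wK zw; apply/negP => /(no_two_link mK za qb wK zw). Qed.

Lemma three_link_far q : e q b -> q != a -> ~~ dom C q.
Proof.
move=> qb qa; rewrite /dom /C /= orbF !inE !negb_or -!andbA.
have nqa : ~~ e q a by apply: (no_triangle' qb); rewrite e_sym.
have npb : ~~ e p b := no_triangle' pa ab.
have np'b : ~~ e p' b := no_triangle' p'a ab.
have pb : p != b.
  by apply: contraTneq pd => ->; rewrite e_sym; have [] := min_cut_far mK dK.
have p'b : p' != b.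
  by apply: contraTneq d'p' => ->; have [] := min_cut_far mK d'K.
have nq y : e y a -> y != b -> ~~ e q y.
  move=> ya yb; rewrite e_sym; apply/negP => yq; case/eqP: yb.
  by apply: (@no_square a y q b); rewrite // 1?e_sym // eq_sym.
have d'p : e p' d' by rewrite e_sym.
have qne y : y \in K -> q != y by move=> yK; rewrite eq_sym neK // outB.
have qp : q != p by apply: contraTneq qb => ->.
have qp' : q != p' by apply: contraTneq qb => ->.
rewrite qa qp qp' !qne // nqa (nq p pa pb) (nq p' p'a p'b) /=.
by rewrite (two_link pa qb dK pd) (two_link p'a qb d'K d'p).
Qed.

(** [W] connects [v] to [b] off the pentagon. Since [b] is next to [a], a vertex next to [W] and to
    [d] or [d'] would have to be adjacent to [b]. *)
Definition reaches_b v : Prop :=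
  exists W, [/\ conn W, W \subset far C, attached b W, v \in W &
    forall w, w \in W -> w \in K \/ e w b].

Lemma reaches_b_inner v : v \in K -> ~~ dom C v -> reaches_b v.
Proof.
move=> vK nv; have dd : dom C d by rewrite /dom !inE eqxx ?orbT.
have [W [z [cW sWK fW vW [zK nz zW]]]] := min_cut_escape mK C5 dK dd vK nv.
have zb : e z b.
  have /attachedP[w wW zw] := zW; have wz : e w z by rewrite e_sym.
  case: (min_cut_nbr mK (subsetP sWK w wW) wz zK) => // za.
  by case/negP: nz; rewrite /dom /= za ?orbT.
exists (z |: W); split.
- exact: connU1.
- by apply/subsetP => y; rewrite !inE => /predU1P[->//|/(subsetP fW)]; rewrite inE.
- by apply: (attachedI (setU11 z W)); rewrite e_sym.
- by rewrite setU1r.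
- by move=> w /setU1P[->|/(subsetP sWK)]; [right|left].
Qed.

Lemma reaches_b_outer q : e q b -> q != a -> reaches_b q.
Proof.
move=> qb qa; exists [set q]; split.
- exact: conn1.
- by apply/subsetP => y /set1P->; rewrite inE three_link_far.
- by apply: (attachedI (set11 q)); rewrite e_sym.
- exact: set11.
- by move=> w /set1P->; right.
Qed.

Lemma reaches_b_middle n z : n \in K -> e n d \/ e n d' -> e n z ->
  reaches_b z -> False.
Proof.
move=> nK nd nz [W [cW fW bW zW _]].
have nW : attached n W := attachedI zW nz.
have ba : e b a by rewrite e_sym.
have [_ _ _ /negP] := min_cut_far mK nK; apply; rewrite e_sym.
case: nd => nd; first exact: (attached_dist2_adj C5 cW fW ba nd bW nW).
have fW' : W \subset far [:: a; p'; d'; d; p].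
  by rewrite (eq_far (pentagon_rev_mem a p d d' p')).
exact: (attached_dist2_adj (pentagon_rev C5) cW fW' ba nd bW nW).
Qed.

(** By [reaches_b_middle] no neighbour of [x] reaches [b]. Its neighbours other than [d] are
    therefore in N(a), or in [K] and next to [p']; there is at most one of each kind, and degree
    three requires both. *)
Lemma three_link_nbr x : e d x -> x != p -> x != d' ->
  exists n y, [/\ x \in K, n \in K, e n p', e y a & e x n /\ e x y] /\
    (forall z, e x z -> [\/ z = d, z = n | z = y]).
Proof.
move=> dx xp xd'.
have [dna _ dnb _] := min_cut_far mK dK.
have xd : e x d by rewrite e_sym.
have xK : x \in K.
  apply/negPn/negP => xK; case: (min_cut_nbr mK dK dx xK) => H.
    by case/eqP: xp; apply: (common_nbr dna dx _ _ _); rewrite e_sym.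
  by have := two_link pa H dK pd; rewrite xd.
have pK := outA pa; have p'K := outA p'a.
have nK z : e x z -> z != d -> (z \in K /\ e z p') \/ e z a.
  move=> xz zd; case: (boolP (z \in K)) => zK; last first.
    case: (min_cut_nbr mK xK xz zK) => H; [by right|exfalso].
    have za : z != a.
      apply: contraTneq xz => ->.
      by have [] := min_cut_far mK xK.
    by apply: (reaches_b_middle xK (or_introl xd) xz); apply: reaches_b_outer.
  left; split=> //; case: (boolP (dom C z)) => [|nz]; last first.
    by case: (reaches_b_middle xK (or_introl xd) xz); apply: reaches_b_inner.
  have [zna zea _ _] := min_cut_far mK zK.
  rewrite /dom /C /= !inE orbF (negbTE zna) (negbTE zea) (negbTE zd) /=.
  rewrite (negbTE (neK zK pK)) (negbTE (neK zK p'K)) /= orbF.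
  case/orP=> [/eqP E|/or4P[H|H|H|//]].
  - by case: (no_triangle xd dd'); rewrite -E.
  - by case/eqP: zd; apply: (no_square xz H pd dx xp).
  - by case: (no_triangle xz H xd).
  - case/eqP: zd; apply: (no_square xz H _ dx); rewrite 1?e_sym //.
have [xna _ xnb _] := min_cut_far mK xK.
have xp' : x != p' := neK xK p'K.
have same1 z z' : e z p' -> e z' p' -> e x z -> e x z' -> z = z'.
  by move=> *; apply: (common_nbr xp'); rewrite // e_sym.
have same2 z z' : e z a -> e z' a -> e x z -> e x z' -> z = z'.
  by move=> *; apply: (common_nbr xna); rewrite // e_sym.
have [z1 [xz1 z1d _]] := degree_ge3 x d d.
have [z2 [xz2 z2d z21]] := degree_ge3 x d z1.
have fin n y : n \in K -> e n p' -> e y a -> e x n -> e x y ->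
  exists n y, [/\ x \in K, n \in K, e n p', e y a & e x n /\ e x y] /\
    (forall z, e x z -> [\/ z = d, z = n | z = y]).
  move=> nK' np' ya xn xy; exists n, y; split=> // z xz.
  case: (eqVneq z d) => [|zd]; first by constructor 1.
  case: (nK z xz zd) => [[_ H]|H]; [constructor 2|constructor 3].
    exact: same1.
  exact: same2.
case: (nK z1 xz1 z1d) => [[h1 k1]|h1]; case: (nK z2 xz2 z2d) => [[h2 k2]|h2].
- by case/eqP: z21; apply: same1.
- exact: fin h1 k1 h2 xz1 xz2.
- exact: fin h2 k2 h1 xz2 xz1.
- by case/eqP: z21; apply: same2.
Qed.

Lemma three_link_nbr2 x n z : x \in K -> e d' x -> n \in K -> e x n ->
  e n p -> e n z -> [\/ z = p, z = x, z \in K /\ e z p' | reaches_b z].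
Proof.
move=> xK d'x nK xn np nz.
have [nna nea _ neb] := min_cut_far mK nK.
have pK := outA pa; have p'K := outA p'a.
have nd : n != d.
  by apply: contraTneq xn => ->; rewrite e_sym; apply: no_triangle' dd' d'x.
have nd' : n != d'.
  by apply: contraTneq np => ->; rewrite e_sym; apply: no_triangle' pd dd'.
case: (boolP (z \in K)) => zK; last first.
  case: (min_cut_nbr mK nK nz zK) => H.
    by constructor 1; apply: (common_nbr nna); rewrite // e_sym.
  constructor 4; apply: reaches_b_outer => //.
  by apply: contraNneq nea => <-.
case: (boolP (dom C z)) => [|nzd]; last by constructor 4; apply: reaches_b_inner.
have [zna zea _ _] := min_cut_far mK zK.
rewrite /dom /C /= !inE orbF (negbTE zna) (negbTE zea) /=.
rewrite (negbTE (neK zK pK)) (negbTE (neK zK p'K)) /= orbF.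
case/orP=> [/orP[/eqP E|/eqP E]|/or4P[H|H|H|H]].
- by case: (no_triangle np pd); rewrite -E.
- by case: (no_triangle d'x xn); rewrite -E e_sym.
- by case: (no_triangle nz H np).
- have E : p = z by apply: (no_square np pd _ _ nd); rewrite e_sym.
  by rewrite E zK in pK.
- have E : x = z by apply: (@no_square n x d' z); rewrite // e_sym.
  by constructor 2.
- by constructor 3.
Qed.

End ThreeLink.

(** The neighbours found on both sides give ten vertices [a], [p], [p'], [y], [d], [d'], [e1], [e2],
    [n], [n'], forming a Petersen graph if [n] and [n'] are adjacent. Only [n] and [n'] can lead
    from here through [K] towards [b], and a path doing so meets two routes of opposite parity. *)
Lemma no_three_link a b K p d d' p' k q : min_cut a b K ->
  d \in K -> d' \in K -> e p d -> e d d' -> e d' p' -> e p a -> e p' a ->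
  p != p' -> k \in K -> e q k -> e q b -> False.
Proof.
move=> mK dK d'K pd dd' d'p' pa p'a pp' kK qk qb.
have [ab _ _] := mK.1.
have d'd : e d' d by rewrite e_sym.
have p'd' : e p' d' by rewrite e_sym.
have dp : e d p by rewrite e_sym.
have p'p : p' != p by rewrite eq_sym.
pose C := [:: a; p; d; d'; p'].
have C5 : pentagon a p d d' p' by apply: pentagonI; rewrite // e_sym.
have C5r := pentagon_rev C5.
have revE := pentagon_rev_mem a p d d' p'.
have outA z : e z a -> z \notin K by move=> H; apply: (min_cut_notin mK); left.
have outB z : e z b -> z \notin K by move=> H; apply: (min_cut_notin mK); right.
have neK y z : y \in K -> z \notin K -> y != z by move=> yK; apply: contraNneq => <-.
have pK := outA p pa; have p'K := outA p' p'a.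
have npd' : p != d' := pentagon_neq (pentagon_rot C5).
have np'd : p' != d := pentagon_neq (pentagon_rot C5r).
have [e1 [de1 e1p e1d']] := degree_ge3 d p d'.
have [e2 [d'e2 e2p' e2d]] := degree_ge3 d' p' d.
have [n' [y [[e1K n'K n'p' ya [e1n' e1y]] Ne1]]] :=
  three_link_nbr mK dK d'K pd dd' d'p' pa p'a de1 e1p e1d'.
have [n [y2 [[e2K nK np y2a [e2n e2y2]] Ne2]]] :=
  three_link_nbr mK d'K dK p'd' d'd dp p'a pa d'e2 e2p' e2d.
have aK z : z \in K -> a != z by move=> zK; have [] := min_cut_far mK zK; rewrite eq_sym.
(* Different neighbours of [a] on the two sides would close a walk of length seven through [d] and
   [d']. *)
have yy z u : z \in K -> e d z -> e z u -> e u a -> z != d' -> u = y2.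
  move=> zK dz zu ua zd'; apply/eqP/negPn/negP => ne.
  apply: (@no_heptagon a u z d d' e2 y2); rewrite // 1?e_sym //.
  - by rewrite aK.
  - by rewrite eq_sym neK // outA.
  - by rewrite eq_sym.
  - by rewrite neK // outA.
  - by rewrite eq_sym aK.
  - by rewrite eq_sym.
have Ey : y = y2 := yy e1 y e1K de1 e1y ya e1d'.
subst y2; rename e2y2 into e2y.
have Nd z : z \in K -> e d z -> z = d' \/ z = e1.
  move=> zK dz; case: (eqVneq z d') => [|zd']; [by left|right].
  have zp := neK z p zK pK.
  have [_ [u [[_ _ _ ua [_ zu]] _]]] :=
    three_link_nbr mK dK d'K pd dd' d'p' pa p'a dz zp zd'.
  have E := yy z u zK dz zu ua zd'; subst u.
  have dy : d != y by apply: neK => //; apply: outA.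
  by apply: (common_nbr dy); rewrite // e_sym.
have Nd' z : z \in K -> e d' z -> z = d \/ z = e2.
  move=> zK dz; case: (eqVneq z d) => [|zd']; [by left|right].
  have zp := neK z p' zK p'K.
  have [_ [u [[_ _ _ ua [_ zu]] _]]] :=
    three_link_nbr mK d'K dK p'd' d'd dp p'a pa dz zp zd'.
  have E : u = y.
    apply/eqP/negPn/negP => ne.
    apply: (@no_heptagon a u z d' d e1 y); rewrite // 1?e_sym //.
    - by rewrite aK.
    - by rewrite eq_sym neK // outA.
    - by rewrite eq_sym.
    - by rewrite neK // outA.
    - by rewrite eq_sym aK.
    - by rewrite eq_sym.
  subst u.
  have dy : d' != y by apply: neK => //; apply: outA.
  by apply: (common_nbr dy); rewrite // e_sym.
have e12 : e1 != e2.
  by apply: contraTneq d'e2 => <-; rewrite e_sym; apply: (no_triangle' _ dd'); rewrite e_sym.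
have yK := outA y ya; have qK := outB q qb.
have e1p' : e1 != p' := neK _ _ e1K p'K.
have e2p : e2 != p := neK _ _ e2K pK.
pose R v := exists W, [/\ conn W, W \subset far C, attached b W, v \in W &
  forall w, w \in W -> w \in K \/ e w b].
have third z : e n z -> [\/ z = p, z = e2, z = n' | R z].
  move=> nz; have := three_link_nbr2 mK dK d'K pd dd' d'p' pa p'a e2K d'e2 nK e2n np nz.
  case=> [->|->|[zK zp']|Rz]; [by constructor 1|by constructor 2| |by constructor 4].
  constructor 3; apply/eqP/negPn/negP => zn'.
  apply: (@no_heptagon y e1 n' p' z n e2); rewrite // 1?e_sym //.
  - by rewrite eq_sym neK.
  - by rewrite eq_sym.
  - by rewrite eq_sym neK.
  - apply: contraTneq zp' => ->; apply: (no_triangle' (y := d')); by rewrite // e_sym.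
  - by rewrite neK.
  - by rewrite eq_sym.
have third' z : e n' z -> [\/ z = p', z = e1, z = n | R z].
  move=> nz; have := three_link_nbr2 mK d'K dK p'd' d'd dp p'a pa e1K de1 n'K e1n' n'p' nz.
  case=> [->|->|[zK zp]|]; [by constructor 1|by constructor 2| |].
    constructor 3; apply/eqP/negPn/negP => zn.
    apply: (@no_heptagon y e2 n p z n' e1); rewrite // 1?e_sym //.
    - by rewrite eq_sym neK.
    - by rewrite eq_sym.
    - by rewrite eq_sym neK.
    - apply: contraTneq zp => ->; apply: (no_triangle' (y := d)); by rewrite // e_sym.
    - by rewrite neK.
  case=> W [cW fW bW zW H]; constructor 4; exists W; split=> //.
  by rewrite -(eq_far revE).
have ina : a \in C by rewrite !inE eqxx.
have inp : p \in C by rewrite !inE eqxx ?orbT.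
have ind : d \in C by rewrite !inE eqxx ?orbT.
have ind' : d' \in C by rewrite !inE eqxx ?orbT.
have inp' : p' \in C by rewrite !inE eqxx ?orbT.
have bK z : z \in K -> ~~ e z b /\ z != b.
  by move=> zK; have [] := min_cut_far mK zK.
have npb : ~~ e p b := no_triangle' pa ab.
have np'b : ~~ e p' b := no_triangle' p'a ab.
have nyb : ~~ e y b := no_triangle' ya ab.
have nbp z : z \in K -> e z p -> b != p 
  by move=> zK zp; apply: contraTneq zp => <-; have [] := bK z zK.
have bp : b != p := nbp n nK np.
have bp' : b != p' by apply: contraTneq n'p' => <-; have [] := bK n' n'K.
have Rn1 W : W \subset far C -> forall w, w \in W -> ~~ e w e1.
  move=> fW w wW; rewrite e_sym; apply/negP => /Ne1[E|E|E]; subst w.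
  - by have [/eqP] := farP fW wW ind.
  - by have [_] := farP fW wW inp'; rewrite n'p'.
  - by have [_] := farP fW wW ina; rewrite ya.
have Rn2 W : W \subset far C -> forall w, w \in W -> ~~ e w e2.
  move=> fW w wW; rewrite e_sym; apply/negP => /Ne2[E|E|E]; subst w.
  - by have [/eqP] := farP fW wW ind'.
  - by have [_] := farP fW wW inp; rewrite np.
  - by have [_] := farP fW wW ina; rewrite ya.
have nnp' : ~~ e n p'.
  apply/negP => H; have an := aK n nK.
  by case/eqP: pp'; apply: (common_nbr an); rewrite // e_sym.
have nn'p : ~~ e n' p.
  apply/negP => H; have an := aK n' n'K.
  by case/eqP: pp'; apply: (common_nbr an); rewrite // e_sym.
have nd : n != d.
  by apply: contraTneq e2n => ->; rewrite e_sym; apply: no_triangle' dd' d'e2.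
have n'd' : n' != d'.
  by apply: contraTneq e1n' => ->; rewrite e_sym; apply: no_triangle' d'd de1.
have n'd : d != n'.
  by apply: contraTneq n'p' => <-; apply: no_triangle' dd' d'p'.
have nd' : d' != n.
  by apply: contraTneq np => <-; apply: no_triangle' d'd dp.
have ba : e b a by rewrite e_sym.
(* If not adjacent, both have a third neighbour that reaches [b]. A link from [n] to [n'] by way of
   [b] is compared with the routes over [p], [d], [e1] and over [p], [d], [d'], [p']. *)
case: (boolP (e n n')) => nn'; last first.
  have [z [nz zp ze2]] := degree_ge3 n p e2.
  have [W1 [cW1 fW1 bW1 zW1 _]] : R z.
    by case: (third z nz) => // E; [rewrite E eqxx in zp|rewrite E eqxx in ze2|rewrite -E nz in nn'].
  have [z' [nz' zp' ze1]] := degree_ge3 n' p' e1.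
  have [W2 [cW2 fW2 bW2 zW2 _]] : R z'.
    case: (third' z' nz') => // E; [by rewrite E eqxx in zp'|by rewrite E eqxx in ze1|].
    by rewrite -E e_sym nz' in nn'.
  pose X := (b |: W1) :|: (b |: W2).
  have cX : conn X.
    apply: (connUI (u := b)); rewrite ?setU11 //; exact: connU1.
  have nX : attached n X by apply: (attachedI (w := z)); rewrite // !inE zW1 ?orbT.
  have n'X : attached n' X by apply: (attachedI (w := z')); rewrite // !inE zW2 ?orbT.
  have Xcase w : w \in X -> w = b \/ exists W, W \subset far C /\ w \in W.
    rewrite !inE => /orP[/predU1P[->|wW]|/predU1P[->|wW]]; try by left.
      by right; exists W1.
    by right; exists W2.
  have Xn m : m \in K -> e m p \/ e m p' -> m \notin X.
    move=> mK' mp; apply/negP => /Xcase[E|[W [fW mW]]].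
      by have [_] := bK m mK'; rewrite E eqxx.
    case: mp => H; first by have [_] := farP fW mW inp; rewrite H.
    by have [_] := farP fW mW inp'; rewrite H.
  have nn'' : n != n' by apply: contraTneq np => ->.
  have [s [s0 sX ips]] := conn_link cX (Xn n nK (or_introl np))
    (Xn n' n'K (or_intror n'p')) nn'' nn' nX n'X.
  have anti : forall v w, v \in s -> w \in [:: p; d; d'; p'; e1] -> (v != w) && ~~ e v w.
    move=> v w /sX/Xcase[->|[W [fW vW]]].
      rewrite !inE => /or4P[/eqP->|/eqP->|/eqP->|/orP[]/eqP->].
      - by rewrite bp e_sym npb.
      - by have [? ?] := bK d dK; rewrite e_sym eq_sym; apply/andP.
      - by have [? ?] := bK d' d'K; rewrite e_sym eq_sym; apply/andP.
      - by rewrite bp' e_sym np'b.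
      - by have [? ?] := bK e1 e1K; rewrite e_sym eq_sym; apply/andP.
    rewrite inE => /predU1P[->|]; first by have [-> ->] := farP fW vW inp.
    rewrite inE => /predU1P[->|]; first by have [-> ->] := farP fW vW ind.
    rewrite inE => /predU1P[->|]; first by have [-> ->] := farP fW vW ind'.
    rewrite !inE => /orP[]/eqP->; first by have [-> ->] := farP fW vW inp'.
    rewrite (Rn1 W fW v vW) andbT; apply: contraTneq vW => ->.
    by apply: (near_notin fW (_ : e e1 d) ind); rewrite e_sym.
  have ip1 : ipath (n :: rcons [:: p; d; e1] n').
    by apply: ipath5; rewrite // 1?e_sym // eq_sym.
  have ip2 : ipath (n :: rcons [:: p; d; d'; p'] n').
    by apply: ipath6; rewrite // 1?e_sym // eq_sym.
  have t1 := theta ips ip1 s0 isT; have t2 := theta ips ip2 s0 isT.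
  have {}t1 : odd (size s + 3) -> size s + 3 = 3.
    apply: t1 => v w vs; rewrite !inE => wt; apply: anti => //; rewrite !inE.
    by case/or3P: wt => ->; rewrite ?orbT.
  have {}t2 : odd (size s + 4) -> size s + 4 = 3.
    apply: t2 => v w vs; rewrite !inE => wt; apply: anti => //; rewrite !inE.
    by case/or4P: wt => ->; rewrite ?orbT.
  by move: s0 t1 t2; clear; move=> *; lia.
pose F := [:: d; d'; e1; e2; n; n'].
(* Either [k] lies in [F], and then it is [n] or [n'] by [no_two_link]; or the connected set [K]
   leaves [F], which is possible only from [n] or [n']. *)
have [W [cW fW bW nW]] : exists W, [/\ conn W, W \subset far C, attached b W &
    attached n W \/ attached n' W].
  have fromR m z : m = n \/ m = n' -> e m z -> R z -> exists W,
      [/\ conn W, W \subset far C, attached b W & attached n W \/ attached n' W].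
    move=> mn mz [W [cW fW bW zW _]]; exists W; split=> //.
    by case: mn => E; subst m; [left|right]; apply: attachedI zW mz.
  case: (boolP (k \in F)) => kF.
    have qz z : z \in K -> q != z by move=> zK; rewrite eq_sym neK.
    have qa' z : e z a -> q != z by move=> za; apply: contraTneq qb => ->; apply: no_triangle' za ab.
    have kq : e k q by rewrite e_sym.
    have nlink z w : e z a -> w \in K -> e z w -> ~~ e q w.
      by move=> za wK zw; apply/negP => /(no_two_link mK za qb wK zw).
    move: kF; rewrite !inE => /or4P[/eqP E|/eqP E|/eqP E|/or3P[/eqP E|/eqP E|/eqP E]]; subst k.
    - by have := nlink p d pa dK pd; rewrite qk.
    - by have := nlink p' d' p'a d'K p'd'; rewrite qk.
    - have ye1 : e y e1 by rewrite e_sym.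
      by have := nlink y e1 ya e1K ye1; rewrite qk.
    - have ye2 : e y e2 by rewrite e_sym.
      by have := nlink y e2 ya e2K ye2; rewrite qk.
    - apply: (fromR n q (or_introl erefl) kq).
      case: (third q kq) => // E.
      + by have := qa' p pa; rewrite E eqxx.
      + by have := qz e2 e2K; rewrite E eqxx.
      + by have := qz n' n'K; rewrite E eqxx.
    - apply: (fromR n' q (or_intror erefl) kq).
      case: (third' q kq) => // E.
      + by have := qa' p' p'a; rewrite E eqxx.
      + by have := qz e1 e1K; rewrite E eqxx.
      + by have := qz n nK; rewrite E eqxx.
  have dF : d \in F by rewrite !inE eqxx.
  have cK : conn K by case: mK => -[_ []].
  have [u [v [uK vK uv uF vF]]] := conn_exit (P := mem F) cK dK dF kK kF.
  have notF : v = d \/ v = d' \/ v = e1 \/ v = e2 \/ v = n \/ v = n' -> False.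
    move=> H; move/negP: vF; apply; rewrite !inE.
    by case: H => [->|[->|[->|[->|[->|->]]]]]; rewrite eqxx ?orbT.
  have nv z : z \notin K -> v <> z by move=> zK E; rewrite -E vK in zK.
  move: uF; rewrite !inE => /or4P[/eqP E|/eqP E|/eqP E|/or3P[/eqP E|/eqP E|/eqP E]]; subst u.
  - by case: (Nd v vK uv) => E; case: notF; tauto.
  - by case: (Nd' v vK uv) => E; case: notF; tauto.
  - by case: (Ne1 v uv) => E; [case: notF; tauto|case: notF; tauto|case: (nv y yK)].
  - by case: (Ne2 v uv) => E; [case: notF; tauto|case: notF; tauto|case: (nv y yK)].
  - case: (third v uv) => [E|E|E|]; [by case: (nv p pK)|by case: notF; tauto
      |by case: notF; tauto|exact: (fromR n v (or_introl erefl))].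
  - case: (third' v uv) => [E|E|E|]; [by case: (nv p' p'K)|by case: notF; tauto
      |by case: notF; tauto|exact: (fromR n' v (or_intror erefl))].
pose B z := e n z || e n' z.
have [w0 [w0W Bw0]] : exists w, w \in W /\ B w.
  by rewrite /B; case: nW => /attachedP[w wW nw]; exists w; rewrite nw ?orbT.
have /attachedP[w1 w1W bw1] := bW.
have [x [s [ips ss [bx Bl] Hb HB]]] := conn_between (A := e b) cW w1W bw1 w0W Bw0.
(* [m] is the one of [n], [n'] where the path from [b] ends. From [a] over [b] this path has at
   least two inner vertices, and the routes over [p1'], [m'] and over [p1'], [g'], [f] have two and
   three: both totals exceed three, and one is odd. *)
have finA m m' g' f p1' : m \in K -> m' \in K -> g' \in K -> f \in K ->
    p1' \in C -> g' \in C -> b != p1' -> ~~ e p1' b -> e p1' a ->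
    e p1' g' -> e g' f -> e f m -> e p1' m' -> e m' m -> e m (last x s) ->
    (forall z, B z = e m z || e m' z) -> m' \notin W -> f \notin W ->
    m \notin W -> p1' != f -> g' != m -> m' != a ->
    (forall w, w \in W -> ~~ e w f) -> ~~ e m a -> ~~ e p1' m -> False.
  move=> mK' m'K gK fK p1C gC bp1 p1b p1a p1g gf fm p1m m'm ml BE
    m'W fW' mW p1f gm m'a wf ma p1nm.
  have bn z : z \in K -> b != z by move=> zK; rewrite eq_sym; have [] := bK z zK.
  have nbz z : z \in K -> ~~ e b z by move=> zK; rewrite e_sym; have [] := bK z zK.
  have lW : {subset x :: s <= W} by [].
  have ip0 : ipath (rcons (x :: s) m).
    rewrite -cats1; apply: ipath_cat => // v w vs; rewrite inE => /eqP->.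
    split; first by apply: contraNneq mW => <-; apply: lW.
    rewrite /= eqxx andbT e_sym; apply/idP/eqP => [mv|->//].
    by apply: HB => //; rewrite BE mv.
  have bW' : b \notin W by apply: near_notin fW ba ina.
  have ip1 : ipath (b :: rcons (x :: s) m).
    rewrite rcons_cons; apply: ipath_cons => //.
    - by apply: contraNneq bW' => ->; apply: lW; apply: mem_head.
    - rewrite mem_rcons inE negb_or bn //=; apply: contra bW' => H.
      by apply: lW; rewrite inE H orbT.
    - move=> z; rewrite mem_rcons inE => /predU1P[->|zs]; first exact: nbz.
      apply/negP => bz; have E : z = x by apply: Hb; rewrite // inE zs orbT.
      by have := ipath_uniq ips; rewrite /= -E zs.
  have ip2 : ipath (a :: rcons (b :: x :: s) m).
    rewrite rcons_cons; apply: ipath_cons => //.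
    - exact: adj_neq.
    - rewrite mem_rcons inE negb_or aK //=; apply/negP => /lW aW.
      by have [/eqP] := farP fW aW ina.
    - move=> z; rewrite mem_rcons inE => /predU1P[->|/lW zW]; first by rewrite e_sym.
      by rewrite e_sym; have [] := farP fW zW ina.
  have anti v w : v \in b :: x :: s -> w \in [:: p1'; m'; g'; f] -> (v != w) && ~~ e v w.
    rewrite inE => /predU1P[->|vs].
      rewrite !inE => /or4P[]/eqP->; first by rewrite bp1 e_sym p1b.
      - by rewrite bn // nbz.
      - by rewrite bn // nbz.
      - by rewrite bn // nbz.
    have vW := lW v vs.
    rewrite !inE => /or4P[]/eqP->.
    - by have [-> ->] := farP fW vW p1C.
    - apply/andP; split; first by apply: contraNneq m'W => <-.
      rewrite e_sym; apply/negP => vm'.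
      have E : v = last x s by apply: HB; rewrite // BE vm' orbT.
      by apply: (no_triangle m'm ml); rewrite -E.
    - by have [-> ->] := farP fW vW gC.
    - by rewrite wf // andbT; apply: contraNneq fW' => <-.
  have ap1 : e a p1' by rewrite e_sym.
  have ipA : ipath (a :: rcons [:: p1'; m'] m).
    apply: ipath4; rewrite //; first by rewrite eq_sym.
    by apply: contraNneq ma => <-.
  have ipB : ipath (a :: rcons [:: p1'; g'; f] m).
    by apply: ipath5; rewrite // ?(aK g' gK) // e_sym.
  have t1 := theta ip2 ipA isT isT; have t2 := theta ip2 ipB isT isT.
  have {}t1 : odd ((size s).+2 + 2) -> (size s).+2 + 2 = 3.
    apply: t1 => v w vs; rewrite !inE => wt; apply: anti => //; rewrite !inE.
    by case/orP: wt => ->; rewrite ?orbT.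
  have {}t2 : odd ((size s).+2 + 3) -> (size s).+2 + 3 = 3.
    apply: t2 => v w vs; rewrite !inE => wt; apply: anti => //; rewrite !inE.
    by case/or3P: wt => ->; rewrite ?orbT.
  by move: t1 t2; clear; move=> *; lia.
have nWn : n \notin W by apply: near_notin fW np inp.
have nWn' : n' \notin W by apply: near_notin fW n'p' inp'.
have e1W : e1 \notin W by apply: (near_notin fW (_ : e e1 d) ind); rewrite e_sym.
have e2W : e2 \notin W by apply: (near_notin fW (_ : e e2 d') ind'); rewrite e_sym.
have nea z : z \in K -> ~~ e z a by move=> zK; have [] := min_cut_far mK zK.
case/orP: Bl => Bl.
  apply: (finA n n' d' e2 p') => //; rewrite ?nea // 1?e_sym // 1?eq_sym ?aK //.
  exact: Rn2 fW.
apply: (finA n' n d e1 p) => //; rewrite ?nea // 1?e_sym // 1?eq_sym ?aK //.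
- by move=> z; rewrite /B orbC.
- exact: Rn1 fW.
Qed.


(** * Vertices of N(a) that see both classes of a minimal cut *)

Lemma pentagon_outer_reach a b K p t s s' t' k q z w :
  min_cut a b K -> k \in K -> e q k -> e q b -> e p a ->
  pentagon p t s s' t' -> t \in K -> s \in K -> s' \in K -> t' \in K ->
  w \in K -> e w z -> z \notin K -> z != p ->
  exists Y, [/\ conn Y, Y \subset far [:: p; t; s; s'; t'], attached a Y & z \in Y].
Proof.
set C := [:: p; t; s; s'; t'] => mK kK qk qb pa C5 tK sK s'K t'K wK wz zK zp.
have [ab _ _] := mK.1.
have C5r := pentagon_rev C5.
have /and5P[pt ts ss' s't' t'p] := C5.
have pt' : e p t' by rewrite e_sym.
have t's' : e t' s' by rewrite e_sym.
have az y : y \in K -> a != y.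
  by move=> yK; have [] := min_cut_far mK yK; rewrite eq_sym.
have zne y : y \in K -> z != y by move=> yK; apply: contraNneq zK => ->.
have farz : ~~ e z p -> ~~ e z t -> ~~ e z s -> ~~ e z s' -> ~~ e z t' -> z \in far C.
  move=> h1 h2 h3 h4 h5; rewrite inE /dom /= !inE orbF.
  by rewrite (negbTE zp) !(negbTE (zne _ _)) //= !negb_or h1 h2 h3 h4 h5.
(* Next to [a], the vertex [z] alone will do: [no_three_link] keeps it off [s] and [s'], and a
   square keeps it off [t] and [t']. *)
case: (min_cut_nbr mK wK wz zK) => [za|zb].
  have az' : e a z by rewrite e_sym.
  have nK y : y \in K -> e p y -> ~~ e z y.
    move=> yK py; apply/negP => zy; case/eqP: zp.
    by apply: (common_nbr (az y yK)); rewrite // e_sym.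
  have n3 y y' : y \in K -> y' \in K -> e p y -> e y y' -> ~~ e z y'.
    move=> yK y'K py yy'; apply/negP => zy'; rewrite e_sym in zy'.
    by apply: (no_three_link mK yK y'K py yy' zy' pa za _ kK qk qb); rewrite eq_sym.
  exists [set z]; split; [exact: conn1| |exact: attachedI (set11 z) az'|exact: set11].
  rewrite sub1set; apply: farz; [|exact: nK|exact: n3 ts|exact: n3 t's'|exact: nK].
  by rewrite e_sym; apply: no_triangle' pa az'.
(* Next to [b], the set consists of [z] and [b]. Here [no_two_link] keeps [z] off [t] and [t']; next
   to [s] or [s'] it would be adjacent to [a], giving a triangle. *)
have bz : e b z by rewrite e_sym.
have bK y : y \in K -> b != y /\ ~~ e b y.
  by move=> yK; have [_ _] := min_cut_far mK yK; rewrite eq_sym e_sym.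
have bp : b != p by apply: contraTneq pt => <-; have [] := bK t tK.
have nbp : ~~ e b p by rewrite e_sym; apply: no_triangle' pa ab.
have bF : b \in far C.
  rewrite inE /dom /= !inE orbF (negbTE bp) (negbTE nbp) /= !negb_or.
  have [-> ->] := bK t tK; have [-> ->] := bK s sK.
  by have [-> ->] := bK s' s'K; have [-> ->] := bK t' t'K.
have ap : e a p by rewrite e_sym.
have bF1 : [set b] \subset far C by rewrite sub1set.
have aB : attached a [set b] := attachedI (set11 b) ab.
have zB : attached z [set b] := attachedI (set11 b) zb.
have tri : ~~ e a z := no_triangle' ab bz.
have zF : z \in far C.
  apply: farz.
  - apply/negP => ep; have E : b = p.
      by apply: (common_nbr (x := a) (z := z)); rewrite // eq_sym -?E;
        apply: contraTneq wz => ->; have [] := min_cut_far mK wK.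
    by rewrite E eqxx in bp.
  - by apply/negP; apply: no_two_link mK pa zb tK pt.
  - apply/negP => zs; case/negP: tri.
    exact: attached_dist2_adj C5 (@conn1 b) bF1 ap zs aB zB.
  - apply/negP => zs'; case/negP: tri.
    apply: attached_dist2_adj C5r (@conn1 b) _ ap zs' aB zB.
    by rewrite (eq_far (pentagon_rev_mem _ _ _ _ _)).
  - by apply/negP; apply: no_two_link mK pa zb t'K pt'.
exists (z |: [set b]); split.
- exact: connU1 (@conn1 b) zB.
- by rewrite subUset sub1set zF.
- by apply: (attachedI _ ab); rewrite !inE eqxx orbT.
- exact: setU11.
Qed.

(** A neighbour of [x] that is connected to [a] off the pentagon would make [x] adjacent to [a]. So
    the neighbours of [x] other than [s] lie in [K] and are next to [p] or [t']; at most one is next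
    to [t'], and degree three supplies one next to [p]. *)
Lemma pentagon_two_sided_step a b K p t s s' t' k q :
  min_cut a b K -> k \in K -> e q k -> e q b -> e p a ->
  pentagon p t s s' t' -> t \in K -> s \in K -> s' \in K -> t' \in K ->
  exists x n, [/\ x \in K, n \in K, e s x, e x n & e p n] /\ x != s'.
Proof.
set C := [:: p; t; s; s'; t'] => mK kK qk qb pa C5 tK sK s'K t'K.
have outer := pentagon_outer_reach mK kK qk qb pa C5 tK sK s'K t'K.
have /and5P[pt ts ss' s't' t'p] := C5.
have pK : p \notin K by apply: (min_cut_notin mK); left.
have ap : e a p by rewrite e_sym.
have inner z : z \in K -> ~~ dom C z ->
    exists Y, [/\ conn Y, Y \subset far C, attached a Y & z \in Y].
  move=> zK nz; have ds : dom C s by rewrite /dom !inE eqxx ?orbT.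
  have [W [y [cW sWK fW zW [yK ny yW]]]] := min_cut_escape mK C5 sK ds zK nz.
  have /attachedP[w wW yw] := yW.
  have yp : y != p by apply: contraNneq ny => ->; rewrite /dom inE eqxx.
  have wy : e w y by rewrite e_sym.
  have [Y [cY fY aY yY]] := outer y w (subsetP sWK w wW) wy yK yp.
  exists (Y :|: W); split; first exact: connU cY cW yY wW yw.
  - by rewrite subUset fY.
  - by have /attachedP[u uY au] := aY; apply: (attachedI _ au); rewrite inE uY.
  - by rewrite inE zW orbT.
have block x z : x \in K -> e x s -> e x z ->
    (exists Y, [/\ conn Y, Y \subset far C, attached a Y & z \in Y]) -> False.
  move=> xK xs xz [Y [cY fY aY zY]].
  have := attached_dist2_adj C5 cY fY ap xs aY (attachedI zY xz).
  by rewrite e_sym; apply/negP; have [] := min_cut_far mK xK.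
have ps : p != s := pentagon_neq C5.
have nps : ~~ e p s := pentagon_nadj C5.
have st : e s t by rewrite e_sym.
have [x [sx xt xs']] := degree_ge3 s t s'.
have xs : e x s by rewrite e_sym.
have xp : x != p by apply: contraNneq nps => <-.
have xK : x \in K.
  apply/negPn/negP => xK; have [Y [_ fY _ xY]] := outer x s sK sx xK xp.
  have sC : s \in C by rewrite !inE eqxx ?orbT.
  by have [_] := farP fY xY sC; rewrite xs.
have xt' : x != t'.
  by apply: contraTneq sx => ->; apply: no_triangle' ss' s't'.
have nbr z : e x z -> z != s -> (z \in K) && (e z p || e z t').
  move=> xz zs; have zK : z \in K.
    apply/negPn/negP => zK; apply: (block x z xK xs xz).
    apply: (outer z x) => //; apply: contra_neq xt => E; subst z.
    by apply: (common_nbr ps); rewrite // e_sym.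
  have : dom C z by apply/negPn/negP => nz; apply: (block x z xK xs xz); apply: inner.
  rewrite zK /dom /= !inE orbF; case/orP.
    case/or4P => [/eqP E|/eqP E|/eqP E|/orP[]/eqP E]; subst z.
    - by rewrite zK in pK.
    - by case: (no_triangle xs st xz).
    - by rewrite eqxx in zs.
    - by case: (no_triangle xs ss' xz).
    - case/eqP: xs'; have ns : s != t'.
        by apply: contraTneq ts => ->; apply: (no_triangle' (y := p)); rewrite e_sym.
      by apply: (common_nbr ns); rewrite // e_sym.
  case/or4P => [->//|H|H|/orP[H|->]]; rewrite ?orbT //; exfalso.
  - by case/eqP: zs; apply: (no_square xz H ts sx).
  - exact: no_triangle xz H xs.
  - by case/eqP: zs; apply: (common_nbr xs'); rewrite // e_sym.
have [z [xz zs _]] := degree_ge3 x s s.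
have fin y : e x y -> y \in K -> e y p -> exists x n,
    [/\ x \in K, n \in K, e s x, e x n & e p n] /\ x != s'.
  by move=> xy yK yp; exists x, y; split=> //; split=> //; rewrite e_sym.
have /andP[zK /orP[zp|zt']] := nbr z xz zs; first exact: fin zp.
have [z' [xz' z's z'z]] := degree_ge3 x s z.
have /andP[z'K /orP[z'p|z't']] := nbr z' xz' z's; first exact: fin z'p.
by case/eqP: z'z; apply: (common_nbr xt'); rewrite // e_sym.
Qed.

(** A shortest path in [K] between the two kinds of neighbours of [p] closes with [p] to an odd
    hole, a pentagon. The step lemma at both vertices opposite [p] gives a closed walk of length
    seven, whose two neighbours of [p] differ because they lie in different classes. *)
Lemma no_two_sided a b K sd p t t' k q : min_cut a b K ->
  {in K &, forall u v, e u v -> sd u != sd v :> bool} ->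
  k \in K -> e q k -> e q b -> e p a ->
  t \in K -> t' \in K -> e p t -> e p t' -> sd t = sd t'.
Proof.
move=> mK bip kK qk qb pa tK t'K pt pt'; apply/eqP/negPn/negP => ne.
have pK : p \notin K by apply: (min_cut_notin mK); left.
have cK : conn K by case: mK => -[_ []].
pose A z := e p z && (sd z == sd t); pose B z := e p z && (sd z != sd t).
have At : A t by rewrite /A pt eqxx.
have Bt' : B t' by rewrite /B pt' eq_sym ne.
have [x [s [ips ss [/andP[px Ax] /andP[pl Bl]] HA HB]]] := conn_between cK tK At t'K Bt'.
have od := bipartite_parity bip (ipath_path ips) ss.
rewrite (eqP Ax) eq_sym Bl in od.
have [x1 [x2 [x3 [x4 [E C5]]]]] : exists x1 x2 x3 x4,
    x :: s = [:: x1; x2; x3; x4] /\ pentagon p x1 x2 x3 x4.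
  apply: pentagon_of_hole => //=; last by rewrite od.
  - by case: (s) od.
  - by apply: contra pK => /ss.
  move=> z zs; apply/idP/idP => [pz|/orP[]/eqP->//].
  case: (boolP (sd z == sd t)) => sz.
    by rewrite (HA z zs) ?eqxx // /A pz.
  by rewrite (HB z zs) ?eqxx ?orbT // /B pz.
have {ss} ss y : y \in [:: x1; x2; x3; x4] -> y \in K by rewrite -E; apply: ss.
have [x1K x2K x3K x4K] : [/\ x1 \in K, x2 \in K, x3 \in K & x4 \in K].
  by split; apply: ss; rewrite !inE eqxx ?orbT.
have [e1 [n1 [[e1K n1K s1 s2 s3] e1x]]] :=
  pentagon_two_sided_step mK kK qk qb pa C5 x1K x2K x3K x4K.
have C5r := pentagon_rev C5.
have [e2 [n2 [[e2K n2K r1 r2 r3] e2x]]] :=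
  pentagon_two_sided_step mK kK qk qb pa C5r x4K x3K x2K x1K.
have neK y : y \in K -> p != y by move=> yK; apply: contraNneq pK => ->.
have /and5P[_ _ x23 _ _] := C5.
apply: (@no_heptagon p n1 e1 x2 x3 e2 n2); rewrite // 1?e_sym //.
- exact: neK.
- by apply: contraTneq s3 => ->; apply: pentagon_nadj C5.
- by rewrite eq_sym.
- by rewrite eq_sym; apply: contraTneq r3 => ->; apply: pentagon_nadj C5r.
- by rewrite eq_sym; apply: neK.
apply/eqP => E2; subst n2.
have h1 := bip _ _ x2K e1K s1; have h2 := bip _ _ e1K n1K s2.
have h3 := bip _ _ x3K e2K r1; have h4 := bip _ _ e2K n1K r2.
have h5 := bip _ _ x2K x3K x23.
by move: h1 h2 h3 h4 h5; do 5!case: (sd _).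
Qed.

(** * Extending a colouring into a minimal cut *)

Lemma no_extension (K : {set T}) psi f : colours (~: K) psi -> colours K f ->
  (forall k z, k \in K -> z \notin K -> e k z -> f k != psi z) -> False.
Proof.
move=> cpsi cf H; apply: (not_col (phi := fun z => if z \in K then f z else psi z)).
move=> u v _ _ uv; case: ifPn => uK; case: ifPn => vK.
- exact: cf.
- exact: H.
- by rewrite eq_sym H // e_sym.
- by rewrite cpsi ?inE.
Qed.

Lemma crit_setC (K : {set T}) k : k \in K -> exists psi, colours (~: K) psi.
Proof. by move=> kK; apply: crit; apply/eqP => /setP/(_ k); rewrite !inE kK. Qed.

(** If all outside neighbours of [K] were in N(a), each vertex of [K] would have at most one. One
    class could take the colour of [a], the other a colour avoiding that of [a] and that of this one
    neighbour. *)
Lemma min_cut_attached a b K : min_cut a b K ->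
  exists k q, [/\ k \in K, e q k & e q b].
Proof.
move=> mK; have [sd bip] := min_cut_bipartite mK.
case: (boolP [exists k in K, exists q, e q k && e q b]).
  by case/exists_inP => k kK /existsP[q /andP[qk qb]]; exists k, q.
move=> /exists_inPn H; exfalso.
have [k kK] : exists k, k \in K by case: mK => -[_ [_ /set0Pn]].
have [psi cpsi] := crit_setC kK.
have Na z u : u \in K -> z \notin K -> e u z -> e z a.
  move=> uK zK uz; case: (min_cut_nbr mK uK uz zK) => // zb.
  by case/existsPn/(_ z)/negP: (H u uK); rewrite zb e_sym uz.
have aK : a \in ~: K.
  by rewrite inE; apply/negP => aK; have [] := min_cut_far mK aK; rewrite eqxx.
(* The default [u] occurs only when there is no outside neighbour to avoid. *)
pose y u := odflt u [pick z | e u z && e a z].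
pose c u := xchoose (third_colour (psi a) (psi (y u))).
have cP u : (c u != psi a) && (c u != psi (y u)) := xchooseP (third_colour _ _).
apply: (no_extension (f := fun u => if sd u then psi a else c u) cpsi).
  move=> u v uK vK uv; have := bip u v uK vK uv.
  have /andP[cu _] := cP u; have /andP[cv _] := cP v.
  by case: (sd u); case: (sd v) => // _; rewrite eq_sym.
move=> u z uK zK uz; have za := Na z u uK zK uz.
have zS : z \in ~: K by rewrite inE.
case: (sd u); first by apply: cpsi; rewrite // e_sym.
suff -> : z = y u by case/andP: (cP u).
rewrite /y; case: pickP => [w /andP[uw aw]|/(_ z)]; last by rewrite uz e_sym za.
have [na _ _ _] := min_cut_far mK uK.
by apply: (common_nbr na uz _ uw aw); rewrite e_sym.
Qed.

Lemma no_min_cut a b K : min_cut a b K -> False.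
Proof.
move=> mK; have [sd bip] := min_cut_bipartite mK.
have mK' := min_cut_sym mK.
have [k1 [q0 [k1K q0k1 q0b]]] := min_cut_attached mK.
have [k0 [p0 [k0K p0k0 p0a]]] := min_cut_attached mK'.
have [ab [cK _ _ _] _] := mK.1.
have outA z : e z a -> z \notin K by move=> H; apply: (min_cut_notin mK); left.
have outB z : e z b -> z \notin K by move=> H; apply: (min_cut_notin mK); right.
have sideA p t t' : e p a -> t \in K -> t' \in K -> e p t -> e p t' -> sd t = sd t'.
  exact: (no_two_sided mK bip k1K q0k1 q0b).
have sideB q t t' : e q b -> t \in K -> t' \in K -> e q t -> e q t' -> sd t = sd t'.
  exact: (no_two_sided mK' bip k0K p0k0 p0a).
have parity p q s : ipath (p :: rcons s q) -> 0 < size s -> {subset s <= K} ->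
    exists x y, [/\ x \in s, y \in s, e p x & e q y] /\ odd (size s) = (sd x == sd y).
  case: s => // x s ips _ ss; exists x, (last x s).
  have := ipath_path ips; rewrite rcons_path /= => /andP[/andP[px pth] lq].
  split; first by rewrite mem_head mem_last px e_sym lq.
  by rewrite /= (bipartite_parity bip pth ss) negbK.
have aKn v : v \in K -> (v != a) && ~~ e v a.
  by move=> vK; have [-> ->] := min_cut_far mK vK.
have bKn v : v \in K -> (v != b) && ~~ e v b.
  by move=> vK; have [_ _ -> ->] := min_cut_far mK vK.
have claimA p k : e p a -> k \in K -> e p k -> sd k = sd k0.
  move=> pa kK pk; apply/eqP/negPn/negP => ne.
  have pp0 : p0 != p by apply: contraNneq ne => E; rewrite (sideA p0 k k0) // E.
  have ap : e a p by rewrite e_sym.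
  have ap0 : e a p0 by rewrite e_sym.
  have np : ~~ e p0 p := no_triangle' p0a ap.
  have [s [s0 ss ips]] := conn_link cK (outA p0 p0a) (outA p pa) pp0 np
    (attachedI k0K p0k0) (attachedI kK pk).
  have [x [y [[xs ys p0x py] od]]] := parity _ _ _ ips s0 ss.
  rewrite (sideA p0 x k0 p0a (ss x xs) k0K p0x p0k0) in od.
  rewrite (sideA p y k pa (ss y ys) kK py pk) eq_sym (negbTE ne) in od.
  have ipa : ipath (p0 :: rcons [:: a] p) by apply: ipath3.
  (* Ends in different classes make the inner part even; against the route over [a] alone it has two
     vertices, which [no_three_link] excludes. *)
  have : size s + 1 = 3.
    apply: (theta ips ipa s0) => //=; last by rewrite addn1 /= od.
    by move=> u v us; rewrite inE => /eqP->; apply: aKn; apply: ss.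
  rewrite addn1 => -[].
  case: s ips ss {s0 xs ys od} => [|d [|d' [|? ?]]] // ips ss _.
  have /= := ipath_path ips; case/and4P => p0d dd' d'p _.
  by apply: (no_three_link mK _ _ p0d dd' d'p p0a pa pp0 k1K q0k1 q0b);
    apply: ss; rewrite !inE eqxx ?orbT.
have claimB : forall q k, e q b -> k \in K -> e q k -> sd k != sd k0.
  move=> q k qb kK qk; apply/eqP => E.
  have ap0 : e a p0 by rewrite e_sym.
  have bq : e b q by rewrite e_sym.
  have ba : e b a by rewrite e_sym.
  have p0b : p0 != b.
    by apply: contraTneq p0k0 => ->; rewrite e_sym; case/andP: (bKn k0 k0K).
  have aq : a != q.
    by apply: contraTneq qk => <-; rewrite e_sym; case/andP: (aKn k kK).
  have np : ~~ e p0 q := no_square' p0a ab bq p0b aq.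
  have pq : p0 != q by apply: contraTneq qb => <-; apply: no_triangle' p0a ab.
  have [s [s0 ss ips]] := conn_link cK (outA p0 p0a) (outB q qb) pq np
    (attachedI k0K p0k0) (attachedI kK qk).
  have [x [y [[xs ys p0x qy] od]]] := parity _ _ _ ips s0 ss.
  rewrite (sideA p0 x k0 p0a (ss x xs) k0K p0x p0k0) in od.
  rewrite (sideB q y k qb (ss y ys) kK qy qk) E eqxx in od.
  have ipab : ipath (p0 :: rcons [:: a; b] q) by apply: ipath4.
  (* Ends in the same class make the inner part odd; against the route over [a] and [b] it has one
     vertex, which [no_two_link] excludes. *)
  have : size s + 2 = 3.
    apply: (theta ips ipab s0) => //=; last by rewrite addn2 /= od.
    by move=> u v /ss us; rewrite !inE => /orP[]/eqP->; [apply: aKn|apply: bKn].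
  rewrite addn2 => -[].
  case: s ips ss {s0 xs ys od} => [|w [|? ?]] // ips ss _.
  have /= := ipath_path ips; case/and3P => p0w wq _.
  apply: (no_two_link mK p0a qb (ss w (mem_head _ _)) p0w).
  by rewrite e_sym.
have [psi cpsi] := crit_setC k0K.
have [aK bK] : a \in ~: K /\ b \in ~: K.
  rewrite !inE; split; apply/negP => H; first by have := aKn a H; rewrite eqxx.
  by have := bKn b H; rewrite eqxx.
have pab : psi a != psi b by apply: cpsi.
apply: (no_extension (f := fun u => if sd u == sd k0 then psi a else psi b) cpsi).
  move=> u v uK vK uv; have := bip u v uK vK uv.
  by case: (sd u); case: (sd v); case: (sd k0); rewrite //= eq_sym.
move=> u z uK zK uz; have zu : e z u by rewrite e_sym.
have zS : z \in ~: K by rewrite inE.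
case: (min_cut_nbr mK uK uz zK) => H.
  by rewrite (claimA z u) // eqxx; apply: cpsi; rewrite // e_sym.
by rewrite (negbTE (claimB z u H uK zu)); apply: cpsi; rewrite // e_sym.
Qed.

(** * Pentagons that dominate the graph *)

Lemma near_edge_stable x y u v : e x y -> u != x -> u != y -> v != x -> v != y ->
  e u x || e u y -> e v x || e v y -> ~~ e u v.
Proof.
move=> xy ux uy vx vy hu hv; apply/negP => uv; have vu : e v u by rewrite e_sym.
have yx : e y x by rewrite e_sym.
case/orP: hu => hu; case/orP: hv => hv.
- exact: no_triangle uv hv hu.
- by rewrite e_sym in hv; case/eqP: vx; rewrite (no_square hu xy hv vu uy).
- by rewrite e_sym in hv; case/eqP: vy; rewrite (no_square hu yx hv vu ux).
- exact: no_triangle uv hv hu.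
Qed.

(** The ends of the edges [fa] and [cd] are removed from [A1] and [A2] to make these stable. The
    pentagon itself stays covered: [a] and [c] are in N(b), [b] and [d] in [A1], and [f] in [A2]. *)
Lemma far_pentagon_neq0 a b c d f : pentagon a b c d f ->
  exists v, ~~ dom [:: a; b; c; d; f] v.
Proof.
move=> C5; case: (pickP (fun v => ~~ dom [:: a; b; c; d; f] v)) => [v|H].
  by exists v.
exfalso; have {}H v : dom [:: a; b; c; d; f] v by apply: negbFE (H v).
have C51 := pentagon_rot C5; have C52 := pentagon_rot C51.
have C53 := pentagon_rot C52; have C54 := pentagon_rot C53.
have /and5P[ab bc cd df fa] := C5.
pose A1 z := [&& z != f, z != a & e z f || e z a].
pose A2 z := [&& z != c, z != d & e z c || e z d].
have cover z : ~~ e z b -> ~~ A1 z -> A2 z.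
  rewrite /A1 /A2; move: (H z); rewrite /dom /= !inE orbF => Hz.
  have ac := pentagon_neq C5; have bd := pentagon_neq C51.
  have cf := pentagon_neq C52; have da := pentagon_neq C53; have fb := pentagon_neq C54.
  have [na nb nc nd nf] : [/\ a != b, b != c, c != d, d != f & f != a].
    by split; apply: adj_neq.
  have [ba cb dc fd af] : [/\ e b a, e c b, e d c, e f d & e a f] by split; rewrite e_sym.
  case: (eqVneq z a) Hz => [->|za]; first by rewrite ab.
  have [bf b'a d'f] : [/\ b != f, b != a & f != d] by split; rewrite eq_sym.
  case: (eqVneq z b) => [->|zb]; first by rewrite ?bf ?b'a ba orbT.
  case: (eqVneq z c) => [->|zc]; first by rewrite cb.
  case: (eqVneq z d) => [->|zd]; first by rewrite ?nd ?da ?nf df.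
  case: (eqVneq z f) => [->|zf]; first by rewrite ?d'f ?(eq_sym f c) ?cf fd !orbT.
  by rewrite /=; case: (e z a); case: (e z b); case: (e z c); case: (e z d); case: (e z f).
pose phi z : 'I_3 := if e z b then inord 0 else if A1 z then inord 1 else inord 2.
have stable u v : e u v ->
    [/\ ~~ (e u b && e v b), ~~ (A1 u && A1 v) & ~~ (A2 u && A2 v)].
  move=> uv; split; apply/negP.
  - by case/andP => ub vb; apply: no_triangle uv vb ub.
  - case/andP => /and3P[u1 u2 u3] /and3P[v1 v2 v3].
    by case/negP: (near_edge_stable fa u1 u2 v1 v2 u3 v3).
  - case/andP => /and3P[u1 u2 u3] /and3P[v1 v2 v3].
    by case/negP: (near_edge_stable cd u1 u2 v1 v2 u3 v3).
apply: (not_col (phi := phi)) => u v _ _ uv; have [s0 s1 s2] := stable u v uv.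
rewrite /phi; move: (cover u) (cover v) s0 s1 s2.
case: (e u b); case: (e v b); case: (A1 u); case: (A1 v) => //= hu hv _ _;
  rewrite ?(hu isT isT) ?(hv isT isT) //; by rewrite -val_eqE /= !inordK.
Qed.

Lemma no_cut a b K : cut a b K -> False.
Proof.
have [n] := ubnP #|K|; elim: n a b K => // n IH a b K leK cK.
apply: (no_min_cut (a := a) (b := b) (K := K)); split=> // u v K' cK'.
rewrite leqNgt; apply/negP => lt; apply: IH cK'.
exact: leq_trans lt leK.
Qed.

Lemma no_critical : False.
Proof.
have ne : ord0 != ord_max :> 'I_3 by [].
case: (boolP [exists a, exists b, exists c, exists d, exists f, pentagon a b c d f]).
  move=> /existsP[a /existsP[b /existsP[c /existsP[d /existsP[f C5]]]]].
  have [v nv] := far_pentagon_neq0 C5.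
  have [u [w [K [cK _]]]] := piece_contains_cut C5 (piece_component nv).
  exact: no_cut cK.
move=> H; have [|phi [cphi _]] := no_pentagon_two_colours (S := setT) ne.
  move=> a b c d f _ _ _ _ _; apply: contra H => C5.
  by apply/existsP; exists a; apply/existsP; exists b; apply/existsP; exists c;
     apply/existsP; exists d; apply/existsP; exists f.
exact: not_col cphi.
Qed.

End Critical.

End Pentagraph.

(** * Reduction to critical pentagraphs *)

Lemma pentagraph_induced (T : finType) (e : rel T) (S : {set T}) :
  pentagraph e ->
  pentagraph (relpre val e : rel {x : T | x \in S}).
Proof.
move=> [girth odd5]; have inj := @val_inj T (mem S) {x : T | x \in S}.
have gc (c : seq {x : T | x \in S}) :
    graph_cycle (relpre val e) c -> graph_cycle e (map val c).
  case=> c2 /andP[cc uc]; split; rewrite ?size_map //.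
  by apply/andP; rewrite cycle_map map_inj_uniq.
split=> [c /gc/girth|c [cc ic] od]; first by rewrite size_map.
rewrite -(size_map val) odd5 ?size_map //; split; first exact: gc.
move=> x y /mapP[u uc ->] /mapP[v vc ->] uv.
have [_ /andP[_ uq]] := cc.
by case: (ic u v uc vc uv) => E; [left|right]; rewrite next_map // -E.
Qed.

(** Colourings are searched among finite functions, so that their existence is decidable. If there
    is none, the induction hypothesis on the subtype of each proper vertex subset makes the graph
    critical. *)
Lemma pentagraph_3colourable n (T : finType) (e : rel T) : #|T| < n ->
  symmetric e -> irreflexive e -> pentagraph e -> colourable 3 e.
Proof.
elim: n T e => // n IH T e leT e_sym e_irr e_penta.
pose proper (phi : {ffun T -> 'I_3}) := [forall u, forall v, e u v ==> (phi u != phi v)].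
case: (boolP [exists phi, proper phi]) => [/existsP[phi /forallP H]|/existsPn H].
  by exists phi => u v uv; have /forallP/(_ v)/implyP := H u; apply.
exfalso; apply: (no_critical e_sym e_irr e_penta) => [S neS|phi cphi].
  have [|||phi cphi] := IH {x : T | x \in S} (relpre val e) _ _ _
    (pentagraph_induced S e_penta).
  - rewrite card_sig -ltnS; apply: leq_trans leT; rewrite ltnS.
    by rewrite -cardsT; apply: proper_card; rewrite properT.
  - by move=> u v; apply: e_sym.
  - by move=> u; apply: e_irr.
  (* The default [ord0] is taken only outside [S]. *)
  exists (fun z => if insub z is Some u then phi u else ord0) => u v uS vS uv.
  by rewrite !insubT; apply: cphi.
case/negP: (H (finfun phi)); apply/forallP => u; apply/forallP => v; apply/implyP => uv.
by rewrite !ffunE; apply: cphi; rewrite ?inE.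
Qed.

Theorem mainTheorem1 (T : finType) (e : rel T)
    (e_sym : symmetric e) (e_irr : irreflexive e)
    (e_penta : pentagraph e) :
  colourable 3 e.
Proof. exact: (pentagraph_3colourable (ltnSn #|T|)). Qed.
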